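(* Let $\Gamma\subset\mathbb{R}^3$ be a smooth simple closed curve of length $\mathcal{L}$, parametrized by arc length as $\gamma:\mathbb{R}/\mathcal{L}\mathbb{Z}\to\mathbb{R}^3$, and let $\mu_0>0$ be a constant. For $\varepsilon>0$ put $D_\varepsilon=\{(s_1,s_2):|\gamma(s_1)-\gamma(s_2)|>\varepsilon\}\subset(\mathbb{R}/\mathcal{L}\mathbb{Z})^2$. For $s_1,s_2$ with $\gamma(s_1)\neq\gamma(s_2)$ write $\vec r_{12}=\gamma(s_2)-\gamma(s_1)$ and $\hat r_{12}=\vec r_{12}/|\vec r_{12}|$, and set $$\rho_N(s_1,s_2)=\gamma'(s_1)\cdot\gamma'(s_2),\qquad \rho_W(s_1,s_2)=(\hat r_{12}\cdot\gamma'(s_1))(\hat r_{12}\cdot\gamma'(s_2)).$$ Then: (1) The limits $$H_N(\Gamma)=\lim_{\varepsilon\to0^+}\Big(\frac{\mu_0}{4\pi}\iint_{D_\varepsilon}\frac{\rho_N(s_1,s_2)}{|\gamma(s_1)-\gamma(s_2)|}\,ds_1ds_2+\frac{\mu_0\mathcal{L}}{2\pi}\log\varepsilon\Big),$$ $$H_W(\Gamma)=\lim_{\varepsilon\to0^+}\Big(\frac{\mu_0}{4\pi}\iint_{D_\varepsilon}\frac{\rho_W(s_1,s_2)}{|\gamma(s_1)-\gamma(s_2)|}\,ds_1ds_2+\frac{\mu_0\mathcal{L}}{2\pi}\log\varepsilon\Big)$$ exist. (2) The functions $$F_N(z)=\frac{\mu_0}{4\pi}\iint|\gamma(s_1)-\gamma(s_2)|^z\rho_N(s_1,s_2)\,ds_1ds_2,\qquad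 F_W(z)=\frac{\mu_0}{4\pi}\iint|\gamma(s_1)-\gamma(s_2)|^z\rho_W(s_1,s_2)\,ds_1ds_2$$ (integrals over $(\mathbb{R}/\mathcal{L}\mathbb{Z})^2$) are well defined and holomorphic on $\{z\in\mathbb{C}:\operatorname{Re}z>-1\}$, and they extend by analytic continuation to meromorphic functions on $\mathbb{C}$ (denoted by the same symbols) whose only possible poles are simple poles at negative odd integers. Moreover $\operatorname{Res}(F_N,-1)=\operatorname{Res}(F_W,-1)=\frac{\mu_0\mathcal{L}}{2\pi}$, and the limits $$A_N(\Gamma)=\lim_{z\to-1}\Big(F_N(z)-\frac{\mu_0\mathcal{L}}{2\pi(z+1)}\Big),\qquad A_W(\Gamma)=\lim_{z\to-1}\Big(F_W(z)-\frac{\mu_0\mathcal{L}}{2\pi(z+1)}\Big)$$ exist. (3) $H_N(\Gamma)=A_N(\Gamma)$ and $H_W(\Gamma)=A_W(\Gamma)$. (4) $H_W(\Gamma)=H_N(\Gamma)+\frac{\mu_0}{2\pi}\mathcal{L}$.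
   Context: $\mu_0$ denotes the permeability of free space (a positive constant). The integrands correspond to Neumann's formula $\frac{d\vec x_1\cdot d\vec x_2}{|\vec x_1-\vec x_2|}$ and Weber's formula $\frac{(\hat r_{12}\cdot d\vec x_1)(\hat r_{12}\cdot d\vec x_2)}{|\vec x_1-\vec x_2|}$ for the mutual inductance, applied to the pair $(\Gamma,\Gamma)$; $D_\varepsilon$ is the complement in $\Gamma\times\Gamma$ of the set $\{(\vec x_1,\vec x_2):|\vec x_1-\vec x_2|\le\varepsilon\}$. *)

(* Defs.v *)
From HB Require Import structures.
From mathcomp Require Import all_boot all_order all_algebra.
From mathcomp Require Import all_classical all_reals all_analysis.
From mathcomp Require Import complex.
Set Implicit Arguments. Unset Strict Implicit. Unset Printing Implicit Defensive.
Import Order.TTheory GRing.Theory Num.Theory.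
Import numFieldTopology.Exports numFieldNormedType.Exports.
Local Open Scope classical_set_scope.
Local Open Scope ring_scope.
Local Open Scope complex_scope.

(* topology on the complex plane: the metric topology of the modulus *)
HB.instance Definition _ (R : realType) := PseudoPointedMetric.copy R[i] (R[i])^o.

Section Defs.
Variable R : realType.

Definition dot3 (u v : 'rV[R]_3) : R := \sum_(i < 3) u ord0 i * v ord0 i.
Definition enorm3 (u : 'rV[R]_3) : R := Num.sqrt (dot3 u u).

Definition coord3 (g : R -> 'rV[R]_3) (i : 'I_3) : R -> R := fun t => g t ord0 i.
Definition vel (g : R -> 'rV[R]_3) (s : R) : 'rV[R]_3 :=
  \row_(i < 3) derive1 (coord3 g i) s.

Definition smooth_fun (f : R -> R) : Prop :=
  forall (n : nat) (x : R), derivable (derive1n n f) x 1.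

Definition arclength_simple_closed_curve (L : R) (g : R -> 'rV[R]_3) : Prop :=
  [/\ 0 < L,
      (forall i, smooth_fun (coord3 g i)),
      (forall s, g (s + L) = g s),
      (forall s, enorm3 (vel g s) = 1) &
      (forall s1 s2, 0 <= s1 < L -> 0 <= s2 < L -> g s1 = g s2 -> s1 = s2)].

Definition torus (L : R) : set (R * R) :=
  [set p | 0 <= p.1 < L /\ 0 <= p.2 < L].

Definition leb2 := ((@lebesgue_measure R) \x (@lebesgue_measure R))%E.

Definition dist12 (g : R -> 'rV[R]_3) (p : R * R) : R := enorm3 (g p.1 - g p.2).

Definition Deps (L : R) (g : R -> 'rV[R]_3) (e : R) : set (R * R) :=
  [set p | torus L p /\ e < dist12 g p].

Definition rhoN (g : R -> 'rV[R]_3) (p : R * R) : R := dot3 (vel g p.1) (vel g p.2).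

Definition rhoW (g : R -> 'rV[R]_3) (p : R * R) : R :=
  let r := g p.2 - g p.1 in
  let rh := (enorm3 r)^-1 *: r in
  dot3 rh (vel g p.1) * dot3 rh (vel g p.2).

(* complex power d^z = exp(z log d) for d > 0, written out *)
Definition cpow (d : R) (z : R[i]) : R[i] :=
  ((d `^ complex.Re z) * cos (complex.Im z * ln d)) +i* ((d `^ complex.Re z) * sin (complex.Im z * ln d)).

Definition cintegrable (L : R) (f : R * R -> R[i]) : Prop :=
  leb2.-integrable (torus L) (fun p => (complex.Re (f p))%:E) /\
  leb2.-integrable (torus L) (fun p => (complex.Im (f p))%:E).

Definition cintegral (L : R) (f : R * R -> R[i]) : R[i] :=
  (Rintegral leb2 (torus L) (fun p => complex.Re (f p))) +i*
  (Rintegral leb2 (torus L) (fun p => complex.Im (f p))).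

Definition holomorphic_at (f : R[i] -> R[i]) (z : R[i]) : Prop :=
  cvg ((fun h : R[i] => (f (z + h) - f z) / h) @ 0^').

Definition neg_odd_int (z : R[i]) : Prop := exists k : nat, z = - (k.*2.+1)%:R.

End Defs.

Definition Fkernel (R : realType) (g : R -> 'rV[R]_3) (rho : R * R -> R)
  (z : R[i]) (p : R * R) : R[i] :=
  cpow (dist12 g p) z * (rho p)%:C%C.

(* Main.v *)
(* Everything is read off the sublevel integrals Phi(u) of rho over {d <= u}, where
   d(s, t) = |gamma(s) - gamma(t)|. By Fubini, the integral of f(d) rho over {d > e} equals
   f(M) Phi(M) - f(e) Phi(e) - int_e^M f'(u) Phi(u) du for every C^1 function f, so both
   regularizations only depend on the behaviour of Phi at 0.
   Phi has an expansion in odd powers, Phi(u) = sum_(j < N) c_j u^(2j+1) + O(u^(2N+1)) with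
   c_0 = 2L: for fixed s the signed distance sigma = t (|gamma(s+t) - gamma(s)|^2 / t^2)^(1/2)
   is a smooth coordinate near the diagonal, {d <= u} is the arc -u <= sigma <= u, and the
   integral of rho over this arc is odd in u. Inserting the expansion for f(u) = u^z gives the
   meromorphic continuation, whose poles come from int_0^M u^(z+2j) du = M^(z+2j+1)/(z+2j+1),
   and for f(u) = 1/u the limit H; the constant term at z = -1 is the same expression.
   For the last claim, (rhoW - rhoN)/d is the t-derivative of -rhat . gamma'(s), so its integral
   over {t : d > e} is the jump 2 + O(e) of this function across the excluded arc. *)
Require Import Defs.
From HB Require Import structures.
From mathcomp Require Import all_boot all_order all_algebra.
From mathcomp Require Import all_classical all_reals all_analysis.
From mathcomp Require Import complex measurable_realfun ring lra.
Import Order.TTheory GRing.Theory Num.Theory.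
Import numFieldTopology.Exports numFieldNormedType.Exports.
Set Implicit Arguments. Unset Strict Implicit. Unset Printing Implicit Defensive.
Local Open Scope classical_set_scope.
Local Open Scope ring_scope.

(** * Bounded integrals and sublevel integrals *)

(** Joint smoothness of sigma in (s, t) is replaced by polynomial expansions of every finite order
    with an error uniform in s ([expands]). This class is closed under sums, products, change of
    variable, Newton's iteration for an inverse square root and inversion of t -> sigma. Each order
    has its own polynomial; the c_j become independent of the order only afterwards, because a
    polynomial of degree < m that is O(x^m) at 0 vanishes. The coefficients are kept measurable in s
    so that expansions can be averaged along the curve. Two facts tie this to the constants of the
    theorem. Both densities are 1 + O(t) near the diagonal and sigma = t + O(t^2), so the inner
    integral is 2u + O(u^2) and c_0 = 2L. The density 1 satisfies the same hypotheses, so {d <= u}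
    has measure O(u): the diagonal is a null set and d^x is integrable for x > -1, which makes F an
    absolutely convergent integral before it is identified with its continuation. *)

Section BoundedIntegrals.
Context d (T : measurableType d) (R : realType).
Variable mu : {measure set T -> \bar R}.
Implicit Types (D : set T) (f : T -> R).

Lemma bounded_integrable D f C : measurable D -> (mu D < +oo)%E ->
  measurable_fun D f -> (forall x, D x -> `|f x| <= C) ->
  mu.-integrable D (EFin \o f).
Proof.
move=> mD Dfin mf bf; apply: measurable_bounded_integrable => //.
exists C; split; first exact: num_real.
by move=> y Cy x Dx; apply: le_trans (bf _ Dx) (ltW Cy).
Qed.

Lemma normr_Rintegral_le D f C : measurable D -> (mu D < +oo)%E ->
  measurable_fun D f -> (forall x, D x -> `|f x| <= C) ->
  `|\int[mu]_(x in D) f x| <= C * fine (mu D).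
Proof.
move=> mD Dfin mf bf.
have intf := bounded_integrable mD Dfin mf bf.
apply: le_trans (le_normr_Rintegral mD intf) _.
rewrite -Rintegral_cst//; apply: le_Rintegral => //.
- exact: (integrable_norm intf).
- by apply: (@bounded_integrable _ _ `|C|) => // x _; rewrite ?lexx.
Qed.

End BoundedIntegrals.

Section FubiniBounded.
Context d1 d2 (T1 : measurableType d1) (T2 : measurableType d2) (R : realType).
Variables (m1 : {sigma_finite_measure set T1 -> \bar R}).
Variables (m2 : {sigma_finite_measure set T2 -> \bar R}).
Variables (D1 : set T1) (D2 : set T2) (f : T1 * T2 -> R) (C : R).
Hypotheses (mD1 : measurable D1) (mD2 : measurable D2).
Hypotheses (D1fin : (m1 D1 < +oo)%E) (D2fin : (m2 D2 < +oo)%E).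
Hypothesis mf : measurable_fun (D1 `*` D2) f.
Hypothesis bf : forall p, (D1 `*` D2) p -> `|f p| <= C.

(** Extension by zero turns integrals over the rectangle into integrals over the whole product,
    where Fubini's theorem is applied. *)
Let g := f \_ (D1 `*` D2).

Let mD : measurable (D1 `*` D2). Proof. exact: measurableX. Qed.

Let Dfin : ((m1 \x m2) (D1 `*` D2) < +oo)%E.
Proof. by rewrite product_measure1E// lte_mul_pinfty// ge0_fin_numE. Qed.

Let mg : measurable_fun setT g.
Proof. by apply/(measurable_restrictT f mD). Qed.

Let ig : (m1 \x m2)%E.-integrable setT (EFin \o g).
Proof.
rewrite /g -restrict_EFin; apply/(integrable_mkcond _ mD).
exact: bounded_integrable bf.
Qed.

Lemma measurable_fun_section1 x : D1 x -> measurable_fun D2 (fun y => f (x, y)).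
Proof.
move=> D1x; apply: (@measurable_comp _ _ _ _ _ _ (D1 `*` D2) f _ (pair x)) => //.
by move=> _ [y D2y <-].
exact: measurable_funTS.
Qed.

Lemma measurable_fun_section2 y : D2 y -> measurable_fun D1 (fun x => f (x, y)).
Proof.
move=> D2y; apply: (@measurable_comp _ _ _ _ _ _ (D1 `*` D2) f _ (pair^~ y)) => //.
by move=> _ [x D1x <-].
exact: measurable_funTS.
Qed.

(** Boundedness of f makes each section integral finite, so the extended-real partial integral is a
    real function. *)
Let FE : fubini_F m2 (EFin \o g) =
  EFin \o ((fun x => \int[m2]_(y in D2) f (x, y)) \_ D1).
Proof.
apply/funext => x; rewrite /fubini_F /= patchE; case: ifPn => xD1; last first.
  rewrite integral0_eq// => y _; rewrite /g patchE ifF//.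
  by apply/negbTE; rewrite notin_setE => -[/= /mem_set]; rewrite (negbTE xD1).
rewrite inE in xD1.
rewrite fineK; last first.
  apply: integrable_fin_num => //.
  apply: (@bounded_integrable _ _ _ _ _ _ C) => //.
    exact: measurable_fun_section1.
  by move=> y D2y; exact: bf.
rewrite [RHS]integral_mkcond; apply: eq_integral => y _.
rewrite /g !patchE /=; have [yD2|yD2] := boolP (y \in D2).
  by rewrite ifT// inE; split => //=; rewrite inE in yD2.
by rewrite ifF//; apply/negbTE; rewrite notin_setE => -[/= _ /mem_set]; rewrite (negbTE yD2).
Qed.

Let GE : fubini_G m1 (EFin \o g) =
  EFin \o ((fun y => \int[m1]_(x in D1) f (x, y)) \_ D2).
Proof.
apply/funext => y; rewrite /fubini_G /= patchE; case: ifPn => yD2; last first.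
  rewrite integral0_eq// => x _; rewrite /g patchE ifF//.
  by apply/negbTE; rewrite notin_setE => -[/= _ /mem_set]; rewrite (negbTE yD2).
rewrite inE in yD2.
rewrite fineK; last first.
  apply: integrable_fin_num => //.
  apply: (@bounded_integrable _ _ _ _ _ _ C) => //.
    exact: measurable_fun_section2.
  by move=> x D1x; exact: bf.
rewrite [RHS]integral_mkcond; apply: eq_integral => x _.
rewrite /g !patchE /=; have [xD1|xD1] := boolP (x \in D1).
  by rewrite ifT// inE; split => //=; rewrite inE in xD1.
by rewrite ifF//; apply/negbTE; rewrite notin_setE => -[/= /mem_set]; rewrite (negbTE xD1).
Qed.

Lemma Rintegral_prod12 : \int[(m1 \x m2)%E]_(p in D1 `*` D2) f p =
  \int[m1]_(x in D1) \int[m2]_(y in D2) f (x, y).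
Proof.
rewrite Rintegral_mkcond [RHS]Rintegral_mkcond /Rintegral.
by rewrite -(integral12_prod_meas1 ig) FE.
Qed.

Lemma Rintegral_prod21 : \int[(m1 \x m2)%E]_(p in D1 `*` D2) f p =
  \int[m2]_(y in D2) \int[m1]_(x in D1) f (x, y).
Proof.
rewrite Rintegral_mkcond [RHS]Rintegral_mkcond /Rintegral.
by rewrite -(integral21_prod_meas1 ig) GE.
Qed.

Lemma measurable_fun_Rintegral1 :
  measurable_fun D1 (fun x => \int[m2]_(y in D2) f (x, y)).
Proof.
apply/(measurable_restrictT _ mD1)/measurable_EFinP; rewrite -FE.
exact: (measurable_fubini_F ig).
Qed.

Lemma measurable_fun_Rintegral2 :
  measurable_fun D2 (fun y => \int[m1]_(x in D1) f (x, y)).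
Proof.
apply/(measurable_restrictT _ mD2)/measurable_EFinP; rewrite -GE.
exact: (measurable_fubini_G ig).
Qed.

Lemma Rintegral_Fubini : \int[m1]_(x in D1) \int[m2]_(y in D2) f (x, y) =
  \int[m2]_(y in D2) \int[m1]_(x in D1) f (x, y).
Proof. by rewrite -Rintegral_prod12 Rintegral_prod21. Qed.

End FubiniBounded.

(** * Integrals on the line: fundamental theorem, translation, periodicity *)

Section RealIntegrals.
Variable R : realType.
Notation mu := (@lebesgue_measure R).
Implicit Types (f F : R -> R) (a b c : R).

Lemma lebesgue_itv_lty (b0 b1 : bool) a b :
  (mu [set` Interval (BSide b0 a) (BSide b1 b)] < +oo)%E.
Proof.
by rewrite lebesgue_measure_itv/=; case: ifP => // _; rewrite -EFinB ltry.
Qed.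

Lemma continuous_at_within f a b :
  (forall x, a <= x <= b -> {for x, continuous f}) ->
  {within `[a, b], continuous f}.
Proof.
move=> cf; apply: continuous_in_subspaceT => x.
by rewrite inE/= in_itv/= => /cf.
Qed.

Lemma continuous_at_bounded f a b :
  (forall x, a <= x <= b -> {for x, continuous f}) ->
  exists C, forall x, a <= x <= b -> `|f x| <= C.
Proof.
move=> cf; have := continuous_compact (continuous_at_within cf) (@segment_compact _ a b).
move=> /compact_bounded[M [_ Mb]]; exists (M + 1) => x axb.
by apply: (Mb (M + 1)); [rewrite ltrDl | exists x].
Qed.

Lemma continuous_at_measurable f a b :
  (forall x, a <= x <= b -> {for x, continuous f}) ->
  measurable_fun `[a, b] f.
Proof.
by move=> cf; apply: subspace_continuous_measurable_fun => //; exact: continuous_at_within.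
Qed.

Lemma continuous_itv_integrable f a b :
  (forall x, a <= x <= b -> {for x, continuous f}) ->
  mu.-integrable `[a, b] (EFin \o f).
Proof.
move=> cf; have [C Cb] := continuous_at_bounded cf.
apply: (@bounded_integrable _ _ _ _ _ _ C) => //.
- exact: lebesgue_itv_lty.
- exact: continuous_at_measurable.
Qed.

Lemma Rintegral_FTC2 f F a b : a <= b ->
  (forall x, a <= x <= b -> is_derive x 1 F (f x)) ->
  (forall x, a <= x <= b -> {for x, continuous f}) ->
  \int[mu]_(x in `[a, b]) f x = F b - F a.
Proof.
rewrite le_eqVlt => /predU1P[<- _ _|ab dF cf].
  by rewrite set_itv1 Rintegral_set1 subrr.
have cF x : a <= x <= b -> {for x, continuous F}.
  move=> /dF[dx _]; apply: differentiable_continuous; exact/derivable1_diffP.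
rewrite /Rintegral (@continuous_FTC2 _ f F)//.
- exact: continuous_at_within.
- split.
  + move=> x; rewrite in_itv/= => /andP[/ltW ax /ltW xb].
    by have [] // := dF x; rewrite ax.
  + by apply: cvg_at_right_filter; apply: cF; rewrite lexx ltW.
  + by apply: cvg_at_left_filter; apply: cF; rewrite lexx ltW.
- move=> x; rewrite in_itv/= => /andP[/ltW ax /ltW xb].
  by rewrite derive1E; apply: derive_val; apply: dF; rewrite ax.
Qed.

(** The translated measure has the right value on half-open intervals, and these determine Lebesgue
    measure. *)
Lemma lebesgue_measureDr c (A : set R) : measurable A ->
  pushforward mu ((fun x => x + c) : measurableTypeR R -> measurableTypeR R) A = mu A.
Proof.
move=> mA.
have mf : measurable_fun setT ((fun x => x + c) : measurableTypeR R -> measurableTypeR R).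
  by apply: measurable_funD => //; exact: measurable_id.
pose f := HB.pack_for {mfun measurableTypeR R >-> measurableTypeR R}
  ((fun x => x + c) : measurableTypeR R -> measurableTypeR R)
  (isMeasurableFun.Build _ _ _ _ _ mf).
apply/esym; apply: (@lebesgue_measure_unique R (pushforward mu f)) => //= _ [[a b]] _ <-.
rewrite /pushforward (_ : _ @^-1` _ = `]a - c, b - c]%classic); last first.
  by apply/seteqP; split => x /=; rewrite !in_itv/= ltrBlDr lerBrDr.
rewrite !lebesgue_measure_itv/= !lte_fin ltrD2r -!EFinB.
by case: ifP => // _; congr EFin; ring.
Qed.

Section Translation.
Variables (f : R -> R) (C : R).
Hypothesis mf : measurable_fun setT f.
Hypothesis bf : forall x, `|f x| <= C.

Let intf a b : mu.-integrable `[a, b[ (EFin \o f).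
Proof.
apply: (@bounded_integrable _ _ _ _ _ _ C) => //.
- exact: lebesgue_itv_lty.
- exact: measurable_funTS.
Qed.

Lemma Rintegral_translation a b c :
  \int[mu]_(x in `[a, b[) f (x + c) = \int[mu]_(x in `[a + c, b + c[) f x.
Proof.
have mg : measurable_fun setT ((fun x => x + c) : measurableTypeR R -> measurableTypeR R).
  by apply: measurable_funD => //; exact: measurable_id.
have E : `[a, b[%classic = ((fun x => x + c) : measurableTypeR R -> measurableTypeR R) @^-1` `[a + c, b + c[%classic.
  by apply/seteqP; split => x /=; rewrite !in_itv/= lerD2r ltrD2r.
pose g := HB.pack_for {mfun measurableTypeR R >-> measurableTypeR R}
  ((fun x => x + c) : measurableTypeR R -> measurableTypeR R)
  (isMeasurableFun.Build _ _ _ _ _ mg).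
rewrite /Rintegral E -(@integral_pushforward _ _ (measurableTypeR R) (measurableTypeR R) R (fun x : R => x + c) mg mu `[a + c, b + c[ (EFin \o f)) //=.
- congr fine; apply: (@eq_measure_integral _ _ _ _ mu (pushforward mu g)) => //= A mA _.
  exact: lebesgue_measureDr.
- exact/measurable_EFinP.
- rewrite -E; apply: (@bounded_integrable _ (measurableTypeR R) R mu `[a, b[%classic (f \o (fun x : R => x + c)) C) => //.
    exact: lebesgue_itv_lty.
  by apply: measurable_funTS; exact: (measurableT_comp mf mg).
  by move=> x _; exact: bf.
Qed.

Lemma Rintegral_itv_split a b c : a <= b -> b <= c ->
  \int[mu]_(x in `[a, c[) f x = \int[mu]_(x in `[a, b[) f x + \int[mu]_(x in `[b, c[) f x.
Proof.
move=> ab bc.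
have E : `[a, c[%classic = `[a, b[%classic `|` `[b, c[%classic :> set R.
  by rewrite -itv_bndbnd_setU// bnd_simp.
rewrite E Rintegral_setU// -?E//.
apply/disj_setPS => x [] /=; rewrite !in_itv/= => /andP[_ xb] /andP[bx _].
by have := lt_le_trans xb bx; rewrite ltxx.
Qed.

(** Since |a| <= L, the two periods differ by a single piece, which is carried from one end to the
    other by a translation by L. *)
Lemma Rintegral_periodic L a : 0 < L -> (forall x, f (x + L) = f x) -> `|a| <= L ->
  \int[mu]_(x in `[a, a + L[) f x = \int[mu]_(x in `[0, L[) f x.
Proof.
move=> L0 pf aL.
have tr x y : \int[mu]_(x in `[x, y[) f x = \int[mu]_(x in `[x + L, y + L[) f x.
  by rewrite -Rintegral_translation; apply: eq_Rintegral => z _; rewrite pf.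
have [a0|a0] := leP 0 a.
  rewrite ger0_norm// in aL.
  rewrite (Rintegral_itv_split aL) ?lerDr//.
  by rewrite (Rintegral_itv_split a0 aL) [in RHS]tr add0r addrC.
rewrite ltr0_norm// in aL.
rewrite (@Rintegral_itv_split a 0 (a + L)) ?(ltW a0)//; last lra.
rewrite (@Rintegral_itv_split 0 (a + L) L); [|lra|lra].
by rewrite tr add0r addrC.
Qed.

End Translation.

End RealIntegrals.

Lemma measurable_fun_bool_natr d (T : measurableType d) (R : realType) (D : set T)
  (b : T -> bool) : measurable_fun D b -> measurable_fun D (fun x => (b x)%:R : R).
Proof.
move=> mb; exact: (measurableT_comp (f := fun b : bool => b%:R : R) _ mb).
Qed.

Lemma normr_mul_bool_le (R : numDomainType) (x : R) (b : bool) :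
  `|x * b%:R| <= `|x|.
Proof. by case: b; rewrite ?mulr1// mulr0 normr0. Qed.

(** * Layer cake formula with a signed density *)

Section LayerCake.
Context d (T : measurableType d) (R : realType).
Variable mu : {sigma_finite_measure set T -> \bar R}.
Notation leb := (@lebesgue_measure R).
Variables (D : set T) (dist rho : T -> R) (C : R).
Hypotheses (mD : measurable D) (Dfin : (mu D < +oo)%E).
Hypotheses (mdist : measurable_fun D dist) (mrho : measurable_fun D rho).
Hypothesis brho : forall p, D p -> `|rho p| <= C.

Definition sublevel_integral (u : R) := \int[mu]_(p in D `&` [set p | dist p <= u]) rho p.

Let irho : mu.-integrable D (EFin \o rho).
Proof. exact: bounded_integrable brho. Qed.

Let mle u : measurable (D `&` [set p | dist p <= u]).
Proof.
exact: (mdist mD (measurable_itv `]-oo, u])).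
Qed.

Let mgt u : measurable (D `&` [set p | u < dist p]).
Proof.
have := mdist mD (measurable_itv `]u, +oo[); congr measurable; congr (_ `&` _).
by apply/seteqP; split => x /=; rewrite in_itv/= andbT.
Qed.

Lemma sublevel_integralE u :
  sublevel_integral u = \int[mu]_(p in D) (rho p * (dist p <= u)%R%:R).
Proof.
rewrite /sublevel_integral Rintegral_mkcondr; apply: eq_Rintegral => p _.
rewrite patchE; case: ifPn => [|].
  by rewrite inE/= => ->; rewrite mulr1.
by rewrite notin_setE/= => /negP/negbTE ->; rewrite mulr0.
Qed.

Lemma normr_sublevel_integral_le u : `|sublevel_integral u| <= C * fine (mu D).
Proof.
rewrite sublevel_integralE; apply: normr_Rintegral_le => //.
- apply: measurable_funM => //.
  apply: measurable_fun_bool_natr.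
  by apply: measurable_fun_ler => //.
- move=> p Dp; exact: le_trans (normr_mul_bool_le _ _) (brho Dp).
Qed.

Section Kernel.
Variables (E : set R) (g : R -> R) (Cg : R).
Hypotheses (mE : measurable E) (Efin : (leb E < +oo)%E).
Hypotheses (mg : measurable_fun E g) (bg : forall u, E u -> `|g u| <= Cg).

(** The two iterated integrals of this kernel are the two sides of [Rintegral_sublevel_integralM];
    integration in p first produces the sublevel integral at height u. *)
Let K (p : T * R) := rho p.1 * (g p.2 * (dist p.1 <= p.2)%R%:R).

Let mK : measurable_fun (D `*` E) K.
Proof.
have m1 (f : T -> R) : measurable_fun D f -> measurable_fun (D `*` E) (fun p => f p.1).
  move=> mf; apply: (@measurable_comp _ _ _ _ _ _ D f (D `*` E) fst) => //.
    by move=> _ [[x y] [Dx _] <-].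
  exact: measurable_funTS.
have m2 (f : R -> R) : measurable_fun E f -> measurable_fun (D `*` E) (fun p => f p.2).
  move=> mf; apply: (@measurable_comp _ _ _ _ _ _ E f (D `*` E) snd) => //.
    by move=> _ [[x y] [_ Ey] <-].
  exact: measurable_funTS.
apply: measurable_funM; first exact: m1.
apply: measurable_funM; first exact: m2.
apply: measurable_fun_bool_natr.
apply: measurable_fun_ler; first exact: m1.
by apply: (m2 id); exact: measurable_id.
Qed.

Let bK p : (D `*` E) p -> `|K p| <= C * Cg.
Proof.
move=> [Dp Ep]; rewrite normrM; apply: ler_pM => //; first exact: brho.
exact: le_trans (normr_mul_bool_le _ _) (bg Ep).
Qed.

Lemma measurable_fun_sublevel_integralM :
  measurable_fun E (fun u => g u * sublevel_integral u).
Proof.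
have := measurable_fun_Rintegral2 (m2 := leb) mD mE Dfin Efin mK bK.
apply: eq_measurable_fun => u; rewrite inE => Eu /=.
rewrite sublevel_integralE -RintegralZl//.
  by apply: eq_Rintegral => p _; rewrite /K/=; ring.
apply: (@bounded_integrable _ _ _ _ _ _ C) => //.
  apply: measurable_funM => //.
  apply: measurable_fun_bool_natr.
  by apply: measurable_fun_ler => //.
move=> p Dp; exact: le_trans (normr_mul_bool_le _ _) (brho Dp).
Qed.

Lemma Rintegral_sublevel_integralM :
  \int[leb]_(u in E) (g u * sublevel_integral u) =
  \int[mu]_(p in D) (rho p * \int[leb]_(u in E) (g u * (dist p <= u)%R%:R)).
Proof.
transitivity (\int[leb]_(u in E) \int[mu]_(p in D) K (p, u)).
  apply: eq_Rintegral => u; rewrite inE => Eu.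
  rewrite sublevel_integralE -RintegralZl//.
    by apply: eq_Rintegral => p _; rewrite /K/=; ring.
  apply: (@bounded_integrable _ _ _ _ _ _ C) => //.
    apply: measurable_funM => //.
    apply: measurable_fun_bool_natr.
    by apply: measurable_fun_ler => //.
  move=> p Dp; exact: le_trans (normr_mul_bool_le _ _) (brho Dp).
rewrite -(Rintegral_Fubini (m2 := leb) mD mE Dfin Efin mK bK).
apply: eq_Rintegral => p; rewrite inE => Dp; rewrite -RintegralZl//.
apply: (@bounded_integrable _ _ _ _ _ _ Cg) => //.
  apply: measurable_funM => //.
  apply: measurable_fun_bool_natr.
  by apply: measurable_fun_ler => //; exact: measurable_id.
move=> u Eu; exact: le_trans (normr_mul_bool_le _ _) (bg Eu).
Qed.

End Kernel.

Lemma measurable_fun_sublevel_integral (E : set R) : measurable E ->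
  (leb E < +oo)%E -> measurable_fun E sublevel_integral.
Proof.
move=> mE Efin.
have b1 u : E u -> `|cst 1 u : R| <= 1 by rewrite normr1.
have := measurable_fun_sublevel_integralM mE Efin (measurable_cst (1 : R)) b1.
by apply: eq_measurable_fun => u _ /=; rewrite mul1r.
Qed.

Lemma layer_cake (f f' : R -> R) (e M : R) : 0 < e -> e <= M ->
  (forall p, D p -> dist p <= M) ->
  (forall u : R, 0 < u -> is_derive u 1 f (f' u)) ->
  (forall u : R, 0 < u -> {for u, continuous f'}) ->
  \int[mu]_(p in D `&` [set p | e < dist p]) (f (dist p) * rho p) =
  f M * sublevel_integral M - f e * sublevel_integral e -
  \int[leb]_(u in `[e, M]) (f' u * sublevel_integral u).
Proof.
move=> e0 eM dM df cf'0.
have cf' x : e <= x <= M -> {for x, continuous f'}.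
  by move=> /andP[ex _]; apply: cf'0; exact: lt_le_trans ex.
have [Cg bg] := continuous_at_bounded cf'.
have lebfin : (leb `[e, M] < +oo)%E.
  exact: lebesgue_itv_lty.
rewrite (@Rintegral_sublevel_integralM _ _ Cg)//; last exact: continuous_at_measurable.
(* Integrating f' over the heights u >= dist p in [e, M] gives f M - f (m p). The truncation at e
   stays away from a singularity of f at 0, and where dist p <= e it yields the boundary term f
   e. *)
pose m p := Num.max (dist p) e.
have em p : e <= m p by rewrite /m le_max lexx orbT.
have mM p : D p -> m p <= M by move=> Dp; rewrite /m ge_max dM.
have inner p : D p ->
    \int[leb]_(u in `[e, M]) (f' u * (dist p <= u)%R%:R) = f M - f (m p).
  move=> Dp.
  transitivity (\int[leb]_(u in `[m p, M]) f' u).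
    rewrite (_ : `[m p, M]%classic = `[e, M]%classic `&` [set u | dist p <= u]); last first.
      apply/seteqP; split => u /=; rewrite !in_itv/= /m ge_max.
        by move=> /andP[/andP[-> ->] ->].
      by move=> [/andP[-> ->] ->].
    rewrite Rintegral_mkcondr; apply: eq_Rintegral => u _.
    rewrite patchE; case: ifPn => [|].
      by rewrite inE/= => ->; rewrite mulr1.
    by rewrite notin_setE/= => /negP/negbTE ->; rewrite mulr0.
  apply: Rintegral_FTC2 => [|x /andP[mx xM]|x /andP[mx xM]]; first exact: mM.
    by apply: df; apply: lt_le_trans mx; exact: lt_le_trans (em p).
  by apply: cf'; rewrite xM andbT (le_trans (em p)).
have cf x : e <= x <= M -> {for x, continuous f}.
  move=> /andP[ex _]; have [dx _] := df _ (lt_le_trans e0 ex).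
  by apply: differentiable_continuous; exact/derivable1_diffP.
have [Cf bf] := continuous_at_bounded cf.
have mfm : measurable_fun D (fun p => f (m p)).
  apply: (@measurable_comp _ _ _ _ _ _ `[e, M]%classic f) => //.
  - by move=> _ [p Dp <-] /=; rewrite in_itv/= em mM.
  - exact: continuous_at_measurable.
  - exact: measurable_maxr.
have bfm p : D p -> `|f (m p)| <= Cf by move=> Dp; apply: bf; rewrite em mM.
have brhofm p : D p -> `|rho p * f (m p)| <= C * Cf.
  by move=> Dp; rewrite normrM; apply: ler_pM => //; [exact: brho|exact: bfm].
have irhofm : mu.-integrable D (EFin \o (fun p => rho p * f (m p))).
  by apply: bounded_integrable brhofm => //; exact: measurable_funM.
transitivity (f M * sublevel_integral M - f e * sublevel_integral e -
    \int[mu]_(p in D) (rho p * f M - rho p * f (m p))); last first.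
  congr (_ - _); apply: eq_Rintegral => p; rewrite inE => Dp.
  by rewrite inner// mulrBr.
rewrite RintegralB//; last first.
  apply: (@bounded_integrable _ _ _ _ _ _ (C * `|f M|)) => //.
    exact: measurable_funM.
  by move=> p Dp; rewrite normrM ler_wpM2r// brho.
rewrite RintegralZr//.
have -> : sublevel_integral M = \int[mu]_(p in D) rho p.
  by rewrite /sublevel_integral setIidl.
have DU : D = (D `&` [set p | dist p <= e]) `|` (D `&` [set p | e < dist p]).
  rewrite -setIUr; apply/esym/setIidl => p _ /=.
  by have [|] := leP (dist p) e; [left|right].
rewrite {4}DU Rintegral_setU//; last 2 first.
  by rewrite -DU.
  apply/disj_setPS => p [[_ /= h1] [_ /=]]; rewrite ltNge; by rewrite h1.
have -> : \int[mu]_(x in D `&` [set p | dist p <= e]) (rho x * f (m x)) =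
    f e * sublevel_integral e.
  rewrite mulrC -RintegralZr//; last exact: integrableS irho.
  apply: eq_Rintegral => p; rewrite inE => -[Dp /= pe].
  by rewrite /m max_r.
have -> : \int[mu]_(x in D `&` [set p | e < dist p]) (rho x * f (m x)) =
    \int[mu]_(p in D `&` [set p | e < dist p]) (f (dist p) * rho p).
  apply: eq_Rintegral => p; rewrite inE => -[Dp /= pe].
  by rewrite /m max_l ?(ltW pe)// mulrC.
rewrite (mulrC (\int[mu]_(_ in D) _)); ring.
Qed.

End LayerCake.

(** * Mean value theorem and elementary inequalities for sine, cosine and exponential *)

Section RealDerivatives.
Variable R : realType.
Implicit Types (f df : R -> R) (x y : R).

Lemma is_derive_continuous f x l : is_derive x 1 f l -> {for x, continuous f}.
Proof. by move=> [dx _]; apply: differentiable_continuous; exact/derivable1_diffP. Qed.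

Lemma MVT_between f df x y :
  (forall z, Num.min x y <= z <= Num.max x y -> is_derive z 1 f (df z)) ->
  exists2 c, Num.min x y <= c <= Num.max x y & f y - f x = df c * (y - x).
Proof.
wlog xy : x y / x <= y => [H|].
  case: (orP (le_total x y)) => [/H //|yx].
  rewrite minC maxC => d; have [c ? E] := H _ _ yx d; exists c => //.
  by rewrite -opprB E -mulrN opprB.
rewrite min_l// max_r// => d.
have [||c cxy E] := @MVT_segment R f df x y xy.
- by move=> z; rewrite in_itv/= => /andP[/ltW xz /ltW zy]; apply: d; rewrite xz.
- apply: continuous_in_subspaceT => z; rewrite inE/= in_itv/= => /d.
  exact: is_derive_continuous.
by exists c.
Qed.

Lemma normr_between x y c : Num.min x y <= c <= Num.max x y -> `|c - x| <= `|y - x|.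
Proof.
have [xy|/ltW yx] := leP x y; move=> /andP[h1 h2].
  by rewrite !ger0_norm ?subr_ge0// lerD2r.
by rewrite !ler0_norm ?subr_le0// !opprB lerD2l lerN2.
Qed.

Lemma normr_sin_le x : `|sin x| <= `|x|.
Proof.
have [c _] := @MVT_between sin cos 0 x (fun z _ => is_derive_sin z).
by rewrite sin0 !subr0 => ->; rewrite normrM ler_piMl// cos_max.
Qed.

Lemma normr_cosB1_le x : `|cos x - 1| <= `|x|.
Proof.
have [c _] := @MVT_between cos (fun z => - sin z) 0 x (fun z _ => is_derive_cos z).
by rewrite cos0 !subr0 => ->; rewrite normrM normrN ler_piMl// sin_max.
Qed.

Lemma normr_cosB1_le_sqr x : `|cos x - 1| <= `|x| ^+ 2.
Proof.
have [c cx] := @MVT_between cos (fun z => - sin z) 0 x (fun z _ => is_derive_cos z).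
rewrite cos0 !subr0 => ->; rewrite normrM normrN expr2 ler_wpM2r//.
apply: le_trans (normr_sin_le c) _.
by have := normr_between cx; rewrite !subr0.
Qed.

Lemma normr_sinB_le_sqr x : `|sin x - x| <= `|x| ^+ 2.
Proof.
have d (z : R) : is_derive z 1 (fun z => sin z - z) (cos z - 1) by apply: is_deriveB.
have [c cx] := @MVT_between (fun z => sin z - z) (fun z => cos z - 1) 0 x (fun z _ => d z).
rewrite sin0 !subr0 => ->; rewrite normrM expr2 ler_wpM2r//.
apply: le_trans (normr_cosB1_le c) _.
by have := normr_between cx; rewrite !subr0.
Qed.

Lemma normr_expRB1_le x : `|expR x - 1| <= `|x| * expR `|x|.
Proof.
have [x0|x0] := leP 0 x.
  have e1 : 1 <= expR x by rewrite -expR0 ler_expR.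
  rewrite !ger0_norm ?subr_ge0//.
  have := expR_ge1Dx (- x) => h.
  have : expR x * (1 - x) <= 1.
    by have := ler_wpM2l (expR_ge0 x) h; rewrite expRxMexpNx_1.
  lra.
have e1 : expR x <= 1 by rewrite -expR0 ler_expR ltW.
rewrite !ler0_norm ?subr_le0// ?(ltW x0)//.
have h := expR_ge1Dx x.
have : 1 <= expR (- x) by rewrite -expR0 ler_expR oppr_ge0 ltW.
nra.
Qed.

(** From 1 - x <= exp(-x) one gets exp x - 1 <= x exp x, hence exp x - 1 - x <= x (exp x - 1). For x
    < 0 the last factor is at least x by 1 + x <= exp x, so the product is at most x^2. *)
Lemma normr_expRB1D_le x : `|expR x - 1 - x| <= `|x| ^+ 2 * expR `|x|.
Proof.
have h := expR_ge1Dx x.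
rewrite ger0_norm; last by rewrite -addrA -opprD subr_ge0.
have [|x0] := leP 0 x.
  move=> x0; rewrite !ger0_norm//.
  have : expR x * (1 - x) <= 1.
    by have := ler_wpM2l (expR_ge0 x) (expR_ge1Dx (- x)); rewrite expRxMexpNx_1.
  have : 1 <= expR x by rewrite -expR0 ler_expR.
  nra.
rewrite ltr0_norm//.
have : expR x * (1 - x) <= 1.
  by have := ler_wpM2l (expR_ge0 x) (expR_ge1Dx (- x)); rewrite expRxMexpNx_1.
have : 1 <= expR (- x) by rewrite -expR0 ler_expR oppr_ge0 ltW.
have : expR x <= 1 by rewrite -expR0 ler_expR ltW.
rewrite sqrrN.
nra.
Qed.

Lemma expR_ge_sqr x : 0 <= x -> x ^+ 2 / 2 <= expR x.
Proof.
by move=> x0; have := expR_ge1Dxn 1 x0; rewrite (_ : 2`! = 2)%N//; lra.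
Qed.

(** The left side is the larger of u and 1/u. Thus any logarithmic factor absorbed into exp |ln u|
    costs at most one power of u in either direction. *)
Lemma expR_norm_ln_le (u : R) : 0 < u -> expR `|ln u| <= u + u^-1.
Proof.
move=> u0; have ui0 : 0 < u^-1 by rewrite invr_gt0.
have [l0|l0] := leP 0 (ln u).
  by rewrite ger0_norm// lnK ?posrE// lerDl ltW.
by rewrite ltr0_norm// -lnV ?posrE// lnK ?posrE// lerDr ltW.
Qed.

End RealDerivatives.

(** * Complex differentiability *)

Section ComplexModulus.
Variable R : realType.
Implicit Types (x y : R) (z w : R[i]).
Notation Re := complex.Re.
Notation Im := complex.Im.
Notation nc := (@Normc.normc R).

(** The norm of R[i] is itself complex-valued; the estimates below are made with the real-valued
    modulus [nc]. *)
Lemma normcE_modulus z : `|z| = (nc z)%:C%C.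
Proof. by case: z. Qed.

Lemma modulus_ge0 z : 0 <= nc z.
Proof. by case: z => a b; exact: sqrtr_ge0. Qed.

Lemma modulusD z w : nc (z + w) <= nc z + nc w.
Proof. by rewrite -lecR rmorphD/= -!normcE_modulus ler_normD. Qed.

Lemma modulusN z : nc (- z) = nc z.
Proof. by apply: complexI; rewrite -!normcE_modulus normrN. Qed.

Lemma modulusB z w : nc (z - w) <= nc z + nc w.
Proof. by rewrite -(modulusN w) modulusD. Qed.

Lemma modulus_eq0 z : (nc z == 0) = (z == 0).
Proof.
apply/eqP/eqP => [|->]; last exact: Normc.normc0.
exact: Normc.eq0_normc.
Qed.

Lemma modulus_gt0 z : (0 < nc z) = (z != 0).
Proof. by rewrite lt_neqAle modulus_ge0 andbT eq_sym modulus_eq0. Qed.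

Lemma modulus_real x : nc x%:C%C = `|x|.
Proof. by rewrite /= expr0n/= addr0 sqrtr_sqr. Qed.

Lemma normr_Re_le z : `|Re z| <= nc z.
Proof. by case: z => a b /=; rewrite -sqrtr_sqr ler_wsqrtr// lerDl sqr_ge0. Qed.

Lemma normr_Im_le z : `|Im z| <= nc z.
Proof. by case: z => a b /=; rewrite -sqrtr_sqr ler_wsqrtr// lerDr sqr_ge0. Qed.

Lemma modulus_le_ReIm z : nc z <= `|Re z| + `|Im z|.
Proof.
case: z => a b /=; rewrite -[leRHS]ger0_norm ?addr_ge0// -sqrtr_sqr ler_wsqrtr//.
rewrite sqrrD !real_normK ?num_real// [leRHS]addrAC lerDl.
by rewrite mulrn_wge0// mulr_ge0.
Qed.

Lemma ReM z w : Re (z * w) = Re z * Re w - Im z * Im w.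
Proof. by case: z; case: w. Qed.

Lemma ImM z w : Im (z * w) = Re z * Im w + Im z * Re w.
Proof. by case: z => a b; case: w => c d /=; rewrite [b * c]mulrC addrC mulrC. Qed.

Lemma ReD z w : Re (z + w) = Re z + Re w.
Proof. by case: z; case: w. Qed.

Lemma ImD z w : Im (z + w) = Im z + Im w.
Proof. by case: z; case: w. Qed.

Lemma ReN z : Re (- z) = - Re z. Proof. by case: z. Qed.

Lemma ImN z : Im (- z) = - Im z. Proof. by case: z. Qed.

Lemma Re_nat n : Re (n%:R : R[i]) = n%:R.
Proof. by elim: n => // n IH; rewrite -!natr1 ReD IH. Qed.

Lemma eq_ReIm z w : Re z = Re w -> Im z = Im w -> z = w.
Proof. by case: z => a b; case: w => c d /= -> ->. Qed.

Lemma dnbhs_modulus (P : set R[i]) (z : R[i]) (r : R) : 0 < r ->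
  (forall h, h != 0 -> nc h < r -> P (z + h)) -> z^' P.
Proof.
move=> r0 H; suff : (z : (R[i])^o)^' P by [].
apply/nbhs_ballP; exists r%:C%C; first by rewrite /= ltcR.
move=> w /=; rewrite -ball_normE /= => zw wz.
have : `|w - z| < r%:C%C by rewrite distrC.
rewrite normcE_modulus ltcR => h1.
by have := H (w - z); rewrite (addrC z) subrK; apply => //; rewrite subr_eq0.
Qed.

Lemma cvg_dnbhs_modulus (f : R[i] -> R[i]) (z l : R[i]) (K r : R) : 0 < r ->
  (forall h, h != 0 -> nc h < r -> nc (f (z + h) - l) <= K * nc h) ->
  f @ z^' --> l.
Proof.
move=> r0 H.
suff : (f : (R[i])^o -> (R[i])^o) @ (z : (R[i])^o)^' --> (l : (R[i])^o) by [].
(* A positive element of R[i] has zero imaginary part, so eps may be replaced by its real part. *)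
apply/cvgrPdistC_lt => eps; rewrite ltcE/= => /andP[/eqP ie e0].
have -> : eps = (Re eps)%:C%C by apply: eq_ReIm.
set e := Re eps in e0 *.
have K1 : 0 < `|K| + 1 by rewrite ltr_pwDr.
have mr : 0 < Num.min r (e / (`|K| + 1)) by rewrite lt_min r0 divr_gt0.
apply: (dnbhs_modulus mr) => h h0; rewrite lt_min => /andP[h1 h2].
rewrite normcE_modulus ltcR; apply: le_lt_trans (H _ h0 h1) _.
apply: (@le_lt_trans _ _ ((`|K| + 1) * nc h)).
  apply: ler_wpM2r; first exact: modulus_ge0.
  by apply: le_trans (ler_norm K) _; rewrite lerDl.
by rewrite mulrC -ltr_pdivlMr.
Qed.

End ComplexModulus.

Section QuadraticDerivative.
Variable R : realType.
Implicit Types (z w h D : R[i]) (f g : R[i] -> R[i]).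
Notation Re := complex.Re.
Notation Im := complex.Im.
Notation nc := (@Normc.normc R).

(* A quadratic remainder makes products and sums provable from the modulus alone,
   without any manipulation of filters. *)
Definition hol2 f z D := exists K r : R, [/\ 0 <= K, 0 < r &
  forall h, nc h < r -> nc (f (z + h) - f z - h * D) <= K * nc h ^+ 2].

Lemma hol2_ext f g z D r : 0 < r -> (forall h, nc h < r -> f (z + h) = g (z + h)) ->
  hol2 f z D -> hol2 g z D.
Proof.
move=> r0 fg [K [s [K0 s0 H]]]; exists K, (Num.min r s); split => //.
  by rewrite lt_min r0.
move=> h; rewrite lt_min => /andP[hr hs]; rewrite -fg//.
by rewrite -[z in g z]addr0 -fg ?addr0 ?Normc.normc0//; exact: H.
Qed.

Lemma hol2_cst c z : hol2 (fun=> c) z 0.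
Proof.
exists 0, 1; split => // h _.
by rewrite subrr mulr0 subrr Normc.normc0 mul0r.
Qed.

Lemma hol2_id z : hol2 id z 1.
Proof.
exists 0, 1; split => // h _.
by rewrite /= (_ : _ - _ - _ = 0); [rewrite Normc.normc0 mul0r|ring].
Qed.

Lemma hol2D f g z D E : hol2 f z D -> hol2 g z E ->
  hol2 (fun w => f w + g w) z (D + E).
Proof.
move=> [K [r [K0 r0 H]]] [L [s [L0 s0 G]]].
exists (K + L), (Num.min r s); split; rewrite ?addr_ge0 ?lt_min ?r0//.
move=> h; rewrite lt_min => /andP[/H Hh /G Gh].
rewrite (_ : _ - _ - _ = (f (z + h) - f z - h * D) + (g (z + h) - g z - h * E)); last ring.
by apply: le_trans (modulusD _ _) _; rewrite mulrDl lerD.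
Qed.

Lemma hol2N f z D : hol2 f z D -> hol2 (fun w => - f w) z (- D).
Proof.
move=> [K [r [K0 r0 H]]]; exists K, r; split => // h /H.
by rewrite -modulusN; congr (nc _ <= _); ring.
Qed.

Lemma hol2B f g z D E : hol2 f z D -> hol2 g z E ->
  hol2 (fun w => f w - g w) z (D - E).
Proof. by move=> hf hg; apply: hol2D => //; exact: hol2N. Qed.

Lemma hol2_lip f z D : hol2 f z D -> exists K r : R, [/\ 0 <= K, 0 < r &
  forall h, nc h < r -> nc (f (z + h) - f z) <= K * nc h].
Proof.
move=> [K [r [K0 r0 H]]].
exists (K * r + nc D), r; split => //.
  by rewrite addr_ge0 ?mulr_ge0 ?modulus_ge0// ltW.
move=> h hr; rewrite -[X in nc X](subrK (h * D)).
apply: le_trans (modulusD _ _) _; rewrite mulrDl lerD//.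
  apply: le_trans (H h hr) _; rewrite expr2 mulrA ler_wpM2r ?modulus_ge0//.
  by rewrite ler_wpM2l// ltW.
by rewrite Normc.normcM mulrC.
Qed.

Lemma hol2M f g z D E : hol2 f z D -> hol2 g z E ->
  hol2 (fun w => f w * g w) z (D * g z + f z * E).
Proof.
move=> hf hg.
have [Kf [rf [Kf0 rf0 Hf]]] := hol2_lip hf.
have [Kg [rg [Kg0 rg0 Hg]]] := hol2_lip hg.
case: hf => [K [r [K0 r0 H]]]; case: hg => [L [s [L0 s0 G]]].
exists (K * nc (g z) + nc (f z) * L + Kf * Kg), (Num.min (Num.min r s) (Num.min rf rg)).
split.
- by rewrite !addr_ge0 ?mulr_ge0 ?modulus_ge0.
- by rewrite !lt_min r0 s0 rf0 rg0.
move=> h; rewrite !lt_min => /andP[/andP[/H h1 /G h2] /andP[/Hf h3 /Hg h4]].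
(* Besides the two first-order errors there is the product of the increments, which is quadratic in
   h by the two Lipschitz bounds. *)
rewrite (_ : _ - _ - _ = (f (z + h) - f z - h * D) * g z +
  f z * (g (z + h) - g z - h * E) + (f (z + h) - f z) * (g (z + h) - g z)); last ring.
apply: le_trans (modulusD _ _) _.
rewrite [leRHS]mulrDl; apply: lerD.
  apply: le_trans (modulusD _ _) _; rewrite [leRHS]mulrDl !Normc.normcM; apply: lerD.
    by rewrite mulrAC ler_wpM2r ?modulus_ge0.
  by rewrite -mulrA ler_wpM2l ?modulus_ge0.
rewrite Normc.normcM expr2 mulrACA; apply: ler_pM => //; exact: modulus_ge0.
Qed.

Lemma hol2_sum (I : Type) (s : seq I) (F : I -> R[i] -> R[i]) z :
  (forall i, exists D, hol2 (F i) z D) -> exists D, hol2 (fun w => \sum_(i <- s) F i w) z D.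
Proof.
move=> H; elim: s => [|i s [D HD]].
  by exists 0; under eq_fun do rewrite big_nil; exact: hol2_cst.
have [E HE] := H i; exists (E + D).
by under eq_fun do rewrite big_cons; exact: hol2D.
Qed.

(** With b = z + a the remainder is exactly h^2 / ((b + h) b^2). For |h| < |b|/2 one has |b + h| >=
    |b|/2, whence the constant 2 / |b|^3. *)
Lemma hol2_inv z a : z + a != 0 -> hol2 (fun w => (w + a)^-1) z (- (z + a)^-2).
Proof.
set b := z + a => b0; have nb0 : 0 < nc b by rewrite modulus_gt0.
exists (2 * (nc b)^-1 ^+ 3), (nc b / 2); split.
- by rewrite mulr_ge0// exprn_ge0// invr_ge0 ltW.
- by rewrite divr_gt0.
move=> h hb.
have bh : nc b / 2 <= nc (b + h).
  have := modulusB (b + h) h; rewrite addrK => ?; lra.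
have bh0 : b + h != 0 by rewrite -modulus_gt0; apply: lt_le_trans bh; rewrite divr_gt0.
have E : (z + h + a)^-1 - (z + a)^-1 - h * - (z + a)^-2 =
    h ^+ 2 * ((b + h)^-1 * b^-1 ^+ 2).
  rewrite (_ : z + h + a = b + h); last by rewrite /b; ring.
  by rewrite -/b; clearbody b; field; rewrite b0 bh0.
rewrite E.
rewrite expr2 !Normc.normcM -expr2 mulrC ler_wpM2r ?sqr_ge0//.
rewrite !Normc.normcV exprS expr2 !mulrA !ler_wpM2r ?invr_ge0 ?modulus_ge0//.
rewrite -[2]invrK -invfM lef_pV2 ?posrE//.
- by rewrite mulrC.
- by rewrite modulus_gt0.
- by rewrite mulr_gt0// invr_gt0.
Qed.

Lemma hol2_holomorphic f z D : hol2 f z D -> holomorphic_at f z.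
Proof.
move=> [K [r [K0 r0 H]]]; apply/cvg_ex; exists D.
apply: (cvg_dnbhs_modulus (K := K) r0) => h h0 hr; rewrite add0r.
rewrite (_ : _ - D = (f (z + h) - f z - h * D) / h); last by field.
rewrite Normc.normcM Normc.normcV ler_pdivrMr ?modulus_gt0//.
by rewrite -mulrA -expr2 H.
Qed.

Lemma hol2_cvg f z D : hol2 f z D -> f @ z^' --> f z.
Proof.
move=> /hol2_lip[K [r [K0 r0 H]]].
by apply: (cvg_dnbhs_modulus (K := K) r0) => h h0 hr; exact: H.
Qed.

Lemma cvg_dnbhs_eq (F G : R[i] -> R[i]) (z l : R[i]) (r : R) : 0 < r ->
  (forall h, h != 0 -> nc h < r -> F (z + h) = G (z + h)) ->
  F @ z^' --> l -> G @ z^' --> l.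
Proof.
move=> r0 FG H A /H; have : z^' [set w | F w = G w] by exact: (dnbhs_modulus r0).
by apply: filterS2 => w /= ->.
Qed.

Section SimplePole.
Variables (A B F : R[i] -> R[i]) (z D E : R[i]) (r : R).
Hypotheses (hA : hol2 A z D) (hB : hol2 B z E) (r0 : 0 < r).
Hypothesis HF : forall h, h != 0 -> nc h < r -> F (z + h) = A (z + h) + B (z + h) / h.

Lemma simple_pole_residue : (fun w => (w - z) * F w) @ z^' --> B z.
Proof.
have H : hol2 (fun w => (w - z) * A w + B w) z ((1 - 0) * A z + (z - z) * D + E).
  apply: hol2D => //; apply: (@hol2M (fun w => w - z) A) => //.
  by apply: hol2B; [exact: hol2_id|exact: hol2_cst].
have := hol2_cvg H; rewrite subrr mul0r add0r; apply: (cvg_dnbhs_eq r0).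
move=> h h0 hr; rewrite HF//; field; exact: h0.
Qed.

(** To first order, B (z + h) / h = B z / h + E + O(h): the derivative of the numerator contributes
    to the constant term. *)
Lemma simple_pole_constant_term :
  (fun w => F w - B z / (w - z)) @ z^' --> A z + E.
Proof.
have [KA [rA [KA0 rA0 HA]]] := hol2_lip hA.
have [K [rB [K0 rB0 HB]]] := hB.
apply: (@cvg_dnbhs_modulus _ _ _ _ (KA + K) (Num.min r (Num.min rA rB))).
  by rewrite !lt_min r0 rA0 rB0.
move=> h h0; rewrite !lt_min => /andP[hr /andP[/HA h1 /HB h2]].
rewrite HF// (_ : _ - _ = (A (z + h) - A z) + (B (z + h) - B z - h * E) / h); last first.
  by field; exact: h0.
apply: le_trans (modulusD _ _) _; rewrite [leRHS]mulrDl lerD//.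
rewrite Normc.normcM Normc.normcV ler_pdivrMr ?modulus_gt0//.
by rewrite -mulrA -expr2.
Qed.

End SimplePole.

End QuadraticDerivative.

(** * Complex powers of a positive base *)

Section ComplexPower.
Variable R : realType.
Implicit Types (x y u : R) (z w h : R[i]).
Notation Re := complex.Re.
Notation Im := complex.Im.
Notation nc := (@Normc.normc R).

Lemma modulus_cpow u z : nc (cpow u z) = u `^ Re z.
Proof.
rewrite /cpow /= !exprMn -mulrDr cos2Dsin2 mulr1 sqrtr_sqr ger0_norm//.
exact: powR_ge0.
Qed.

Lemma cpowD u z w : 0 < u -> cpow u (z + w) = cpow u z * cpow u w.
Proof.
move=> u0; rewrite /cpow ReD ImD powRD; last by rewrite (lt0r_neq0 u0) implybT.
rewrite mulrDl cosD sinD; apply: eq_ReIm; rewrite ?ReM ?ImM /=; ring.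
Qed.

Lemma cpow_real u x : cpow u x%:C%C = (u `^ x)%:C%C.
Proof. by rewrite /cpow /= mul0r cos0 sin0 mulr1 mulr0. Qed.

Lemma cpow0 u : cpow u 0 = 1.
Proof. by rewrite (_ : 0 = 0%:C%C)// cpow_real powRr0. Qed.

Lemma cpow_nat u n : 0 < u -> cpow u n%:R = (u ^+ n)%:C%C.
Proof.
by move=> u0; rewrite -(rmorph_nat (real_complex R)) cpow_real powR_mulrn// ltW.
Qed.

Lemma cpow1 u : 0 < u -> cpow u 1 = u%:C%C.
Proof. by move=> u0; rewrite (cpow_nat 1 u0) expr1. Qed.

Lemma cpowN1 u : 0 < u -> cpow u (- 1) = (u^-1)%:C%C.
Proof.
move=> u0; rewrite -(rmorph1 (real_complex R)) -rmorphN cpow_real powR_inv1//.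
exact: ltW.
Qed.

Lemma cpowB1 u z : 0 < u -> cpow u (z - 1) = cpow u z * (u^-1)%:C%C.
Proof. by move=> u0; rewrite cpowD// cpowN1. Qed.

Lemma is_derive_cpow_Re z u : 0 < u ->
  is_derive u 1 (fun u => Re (cpow u z)) (Re (z * cpow u (z - 1))).
Proof.
move=> u0; rewrite /cpow /= ReM ReD ReN ImD ImN /= subr0.
have dl : is_derive u 1 (fun u => Im z * ln u) (Im z / u).
  have := @is_deriveZ _ _ _ (@ln R) (Im z) u 1 _ (is_derive1_ln u0); exact.
have dc := @is_derive1_comp _ cos (fun u => Im z * ln u) u _ _ (is_derive_cos _) dl.
have := is_deriveM (is_derive1_powR (Re z) u0) dc.
move/is_derive_eq; apply.
rewrite /GRing.scale /= powRB ?powRr1 ?(ltW u0)//; last by rewrite (lt0r_neq0 u0) implybT.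
by field; rewrite gt_eqF.
Qed.

Lemma is_derive_cpow_Im z u : 0 < u ->
  is_derive u 1 (fun u => Im (cpow u z)) (Im (z * cpow u (z - 1))).
Proof.
move=> u0; rewrite /cpow /= ImM ReD ReN ImD ImN /= subr0.
have dl : is_derive u 1 (fun u => Im z * ln u) (Im z / u).
  have := @is_deriveZ _ _ _ (@ln R) (Im z) u 1 _ (is_derive1_ln u0); exact.
have dc := @is_derive1_comp _ sin (fun u => Im z * ln u) u _ _ (is_derive_sin _) dl.
have := is_deriveM (is_derive1_powR (Re z) u0) dc.
move/is_derive_eq; apply.
rewrite /GRing.scale /= powRB ?powRr1 ?(ltW u0)//; last by rewrite (lt0r_neq0 u0) implybT.
by field; rewrite gt_eqF.
Qed.

Lemma continuous_cpow_Re z u : 0 < u -> {for u, continuous (fun u => Re (cpow u z))}.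
Proof. by move=> u0; exact: is_derive_continuous (is_derive_cpow_Re z u0). Qed.

Lemma continuous_cpow_Im z u : 0 < u -> {for u, continuous (fun u => Im (cpow u z))}.
Proof. by move=> u0; exact: is_derive_continuous (is_derive_cpow_Im z u0). Qed.

Lemma modulus_cpow_quad u h : 0 < u ->
  nc (cpow u h - 1 - h * (ln u)%:C%C) <=
  5 * (`|ln u| * nc h) ^+ 2 * expR (`|ln u| * nc h).
Proof.
move=> u0; set l := ln u; set X := `|l| * nc h.
have aX : `|Re h * l| <= X by rewrite normrM mulrC ler_wpM2l// normr_Re_le.
have bX : `|Im h * l| <= X by rewrite normrM mulrC ler_wpM2l// normr_Im_le.
have X0 : 0 <= X by rewrite mulr_ge0// modulus_ge0.
set a := Re h * l in aX *; set b := Im h * l in bX *.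
have e1 : 1 <= expR X by rewrite -expR0 ler_expR.
have ea : expR `|a| <= expR X by rewrite ler_expR.
have ea' : expR a <= expR X by rewrite ler_expR (le_trans (ler_norm _)).
have uE : u `^ Re h = expR a by rewrite /powR gt_eqF.
have a2 : `|a| ^+ 2 <= X ^+ 2 by rewrite ler_sqr ?nnegrE.
have b2 : `|b| ^+ 2 <= X ^+ 2 by rewrite ler_sqr ?nnegrE.
have X2 : 0 <= X ^+ 2 by exact: sqr_ge0.
have B1 : `|expR a - 1 - a| <= X ^+ 2 * expR X.
  by apply: le_trans (normr_expRB1D_le a) _; rewrite ler_pM ?sqr_ge0 ?expR_ge0.
have B2 : `|expR a * (cos b - 1)| <= X ^+ 2 * expR X.
  rewrite normrM (ger0_norm (expR_ge0 _)) mulrC ler_pM ?expR_ge0//.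
  exact: le_trans (normr_cosB1_le_sqr b) b2.
have B3 : `|expR a * (sin b - b)| <= X ^+ 2 * expR X.
  rewrite normrM (ger0_norm (expR_ge0 _)) mulrC ler_pM ?expR_ge0//.
  exact: le_trans (normr_sinB_le_sqr b) b2.
have B4 : `|b * (expR a - 1)| <= X ^+ 2 * expR X.
  rewrite normrM expr2 -mulrA ler_pM//.
  apply: le_trans (normr_expRB1_le a) _.
  by rewrite ler_pM ?expR_ge0.
apply: le_trans (modulus_le_ReIm _) _.
rewrite !ReD !ReN !ImD !ImN ReM ImM /= uE -/l -/a -/b mulr0 subr0 oppr0 !addr0 mulr0 add0r.
(* With h ln u = a + ib, the real and imaginary parts split into four pieces, each at most X^2 exp X
   by [B1] to [B4]; the constant 5 leaves room for one more. *)
rewrite [X in `|X| + _](_ : _ = (expR a - 1 - a) + expR a * (cos b - 1)); last by rewrite /a; ring.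
rewrite [X in _ + `|X|](_ : _ = expR a * (sin b - b) + b * (expR a - 1)); last by rewrite /b; ring.
have := ler_normD (expR a - 1 - a) (expR a * (cos b - 1)).
have := ler_normD (expR a * (sin b - b)) (b * (expR a - 1)).
have : 0 <= X ^+ 2 * expR X by rewrite mulr_ge0 ?expR_ge0.
lra.
Qed.

Lemma hol2_cpow u z a : 0 < u ->
  hol2 (fun w => cpow u (w + a)) z (cpow u (z + a) * (ln u)%:C%C).
Proof.
move=> u0.
exists (nc (cpow u (z + a)) * (5 * `|ln u| ^+ 2 * expR `|ln u|)), 1; split => //.
  by rewrite !mulr_ge0 ?modulus_ge0 ?sqr_ge0 ?expR_ge0.
move=> h h1; rewrite (_ : z + h + a = (z + a) + h); last ring.
rewrite (cpowD (z + a) h u0).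
rewrite (_ : _ - _ - _ = cpow u (z + a) * (cpow u h - 1 - h * (ln u)%:C%C)); last ring.
rewrite Normc.normcM -[leRHS]mulrA ler_wpM2l ?modulus_ge0//.
apply: le_trans (modulus_cpow_quad _ u0) _.
rewrite [leRHS]mulrAC -[X in _ <= X * _]mulrA -exprMn ler_wpM2l//.
  by rewrite mulr_ge0 ?sqr_ge0.
by rewrite ler_expR ler_piMr// ltW.
Qed.

End ComplexPower.

(** * Mellin continuation of an odd expansion *)

Section ComplexIntegral.
Context d (T : measurableType d) (R : realType).
Variable mu : {measure set T -> \bar R}.
Implicit Types (D : set T) (f g : T -> R[i]).
Notation Re := complex.Re.
Notation Im := complex.Im.
Notation nc := (@Normc.normc R).

(** Version of [cintegral] for any measure and any set; [cint] is likewise the general form of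
    [cintegrable]. On the torus they unfold to the same terms. *)
Definition cRint D f : R[i] :=
  Complex (\int[mu]_(x in D) Re (f x)) (\int[mu]_(x in D) Im (f x)).

Definition cint D f := mu.-integrable D (EFin \o (fun x => Re (f x))) /\
  mu.-integrable D (EFin \o (fun x => Im (f x))).

Definition cmeas D f := measurable_fun D (fun x => Re (f x)) /\
  measurable_fun D (fun x => Im (f x)).

Lemma eq_cRint D f g : (forall x, D x -> f x = g x) -> cRint D f = cRint D g.
Proof.
by move=> fg; rewrite /cRint; congr Complex; apply: eq_Rintegral => x;
  rewrite inE => /fg ->.
Qed.

Lemma Re_cRint D f : Re (cRint D f) = \int[mu]_(x in D) Re (f x). Proof. by []. Qed.

Lemma Im_cRint D f : Im (cRint D f) = \int[mu]_(x in D) Im (f x). Proof. by []. Qed.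

Lemma eq_cint D f g : (forall x, D x -> f x = g x) -> measurable D ->
  cint D f -> cint D g.
Proof.
move=> fg mD [h1 h2]; split; [move: h1|move: h2]; apply: eq_integrable => // x;
by rewrite inE /= => /fg ->.
Qed.

Lemma cmeasM D f g : cmeas D f -> cmeas D g -> cmeas D (fun x => f x * g x).
Proof.
move=> [f1 f2] [g1 g2]; split.
  under eq_fun do rewrite ReM.
  by apply: measurable_funB; apply: measurable_funM.
under eq_fun do rewrite ImM.
by apply: measurable_funD; apply: measurable_funM.
Qed.

Lemma cmeas_cst D c : cmeas D (fun=> c).
Proof. by split; exact: measurable_cst. Qed.

Lemma cmeas_real D (f : T -> R) : measurable_fun D f -> cmeas D (fun x => (f x)%:C%C).
Proof. by move=> mf; split => //; exact: measurable_cst. Qed.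

Lemma cint_bounded D f C : measurable D -> (mu D < +oo)%E -> cmeas D f ->
  (forall x, D x -> nc (f x) <= C) -> cint D f.
Proof.
move=> mD Dfin [m1 m2] bf; split; apply: (@bounded_integrable _ _ _ _ _ _ C) => //.
  by move=> x /bf; apply: le_trans; exact: normr_Re_le.
by move=> x /bf; apply: le_trans; exact: normr_Im_le.
Qed.

(** Real and imaginary parts are bounded separately, which costs the factor 2. *)
Lemma modulus_cRint_le D f C : measurable D -> (mu D < +oo)%E -> cmeas D f ->
  (forall x, D x -> nc (f x) <= C) -> nc (cRint D f) <= 2 * C * fine (mu D).
Proof.
move=> mD Dfin [m1 m2] bf; apply: le_trans (modulus_le_ReIm _) _ => /=.
have h1 : `|\int[mu]_(x in D) Re (f x)| <= C * fine (mu D).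
  apply: normr_Rintegral_le => // x /bf; apply: le_trans; exact: normr_Re_le.
have h2 : `|\int[mu]_(x in D) Im (f x)| <= C * fine (mu D).
  apply: normr_Rintegral_le => // x /bf; apply: le_trans; exact: normr_Im_le.
lra.
Qed.

Lemma cintZ D f c : measurable D -> cint D f -> cint D (fun x => c * f x).
Proof.
move=> mD [f1 f2]; split.
  have := integrableB mD (integrableZl mD (Re c) f1) (integrableZl mD (Im c) f2).
  by apply: eq_integrable => // x _ /=; rewrite ReM EFinB !EFinM.
have := integrableD mD (integrableZl mD (Re c) f2) (integrableZl mD (Im c) f1).
by apply: eq_integrable => // x _ /=; rewrite ImM EFinD !EFinM.
Qed.

Lemma cintD D f g : measurable D -> cint D f -> cint D g -> cint D (fun x => f x + g x).
Proof.
move=> mD [f1 f2] [g1 g2]; split.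
  have := integrableD mD f1 g1.
  by apply: eq_integrable => // x _ /=; rewrite ReD EFinD.
have := integrableD mD f2 g2.
by apply: eq_integrable => // x _ /=; rewrite ImD EFinD.
Qed.

Lemma cintB D f g : measurable D -> cint D f -> cint D g -> cint D (fun x => f x - g x).
Proof.
move=> mD cf cg; have := cintD mD cf (cintZ (-1) mD cg).
by apply: eq_cint => // x _; rewrite mulN1r.
Qed.

Lemma cmeasB D f g : cmeas D f -> cmeas D g -> cmeas D (fun x => f x - g x).
Proof.
move=> [f1 f2] [g1 g2]; split.
  by under eq_fun do rewrite ReD ReN; apply: measurable_funB.
by under eq_fun do rewrite ImD ImN; apply: measurable_funB.
Qed.

Lemma cRintZ D f c : measurable D -> cint D f -> cRint D (fun x => c * f x) = c * cRint D f.
Proof.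
move=> mD [f1 f2]; apply: eq_ReIm; rewrite ?ReM ?ImM /=.
  under eq_Rintegral do rewrite ReM.
  by rewrite RintegralB// ?RintegralZl//; [exact: (integrableZl mD (Re c) f1)|exact: (integrableZl mD (Im c) f2)].
under eq_Rintegral do rewrite ImM.
by rewrite RintegralD// ?RintegralZl//; [exact: (integrableZl mD (Re c) f2)|exact: (integrableZl mD (Im c) f1)].
Qed.

Lemma cRintD D f g : measurable D -> cint D f -> cint D g ->
  cRint D (fun x => f x + g x) = cRint D f + cRint D g.
Proof.
move=> mD [f1 f2] [g1 g2]; apply: eq_ReIm; rewrite ?ReD ?ImD /=.
  by under eq_Rintegral do rewrite ReD; rewrite RintegralD.
by under eq_Rintegral do rewrite ImD; rewrite RintegralD.
Qed.

Lemma cRintB D f g : measurable D -> cint D f -> cint D g ->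
  cRint D (fun x => f x - g x) = cRint D f - cRint D g.
Proof.
move=> mD cf cg; rewrite -[in RHS]mulN1r -cRintZ// -cRintD//.
  by apply: eq_cRint => x _; rewrite mulN1r.
exact: cintZ.
Qed.

Lemma cRint_setU A B f : measurable A -> measurable B -> cint (A `|` B) f ->
  [disjoint A & B] -> cRint (A `|` B) f = cRint A f + cRint B f.
Proof.
by move=> mA mB [f1 f2] AB; rewrite /cRint !Rintegral_setU//.
Qed.

End ComplexIntegral.

(** * Integrals of complex powers on an interval *)

Section PowerIntegral.
Variable R : realType.
Notation mu := (@lebesgue_measure R).
Implicit Types (u M e : R) (z w h : R[i]).
Notation Re := complex.Re.
Notation Im := complex.Im.
Notation nc := (@Normc.normc R).

Lemma cmeas_cpow (D : set R) z : measurable D -> D `<=` [set u | 0 < u] ->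
  cmeas D (fun u => cpow u z).
Proof.
move=> mD Dpos; have opos : open [set u : R | 0 < u] by exact: open_gt.
split; apply: (@measurable_funS _ _ _ _ [set u : R | 0 < u]) => //.
- exact: open_measurable.
- apply: open_continuous_measurable_fun => // u; rewrite inE => u0.
  exact: continuous_cpow_Re.
- exact: open_measurable.
- apply: open_continuous_measurable_fun => // u; rewrite inE => u0.
  exact: continuous_cpow_Im.
Qed.

Lemma cRint_cpow_FTC e M w : 0 < e -> e <= M -> w + 1 != 0 ->
  cRint mu `[e, M] (fun u => cpow u w) = (cpow M (w + 1) - cpow e (w + 1)) / (w + 1).
Proof.
move=> e0 eM w0.
have mD : measurable (`[e, M]%classic : set R) by exact: measurable_itv.
have pos u : e <= u <= M -> 0 < u by move=> /andP[eu _]; exact: lt_le_trans eu.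
have ci : cint mu `[e, M] (fun u => cpow u w).
  split; apply: continuous_itv_integrable => u /pos u0.
    exact: continuous_cpow_Re.
  exact: continuous_cpow_Im.
(* After multiplication by w + 1 the integrand is the derivative of u^(w+1), in real and imaginary
   parts. *)
apply: (mulfI w0); rewrite mulrC -mulrC -cRintZ// [RHS]mulrC divfK//.
have E u : (w + 1) * cpow u w = (w + 1) * cpow u (w + 1 - 1) by rewrite addrK.
have sc u : 0 < u -> {for u, continuous (fun u => Re ((w + 1) * cpow u w))} /\
    {for u, continuous (fun u => Im ((w + 1) * cpow u w))}.
  move=> u0; split.
    have -> : (fun u => Re ((w + 1) * cpow u w)) =
        (fun u => Re (w + 1) * Re (cpow u w) - Im (w + 1) * Im (cpow u w)).
      by apply/funext => v; rewrite ReM.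
    apply: continuousB; apply: continuousM; do ?exact: cvg_cst.
      exact: continuous_cpow_Re.
    exact: continuous_cpow_Im.
  have -> : (fun u => Im ((w + 1) * cpow u w)) =
      (fun u => Re (w + 1) * Im (cpow u w) + Im (w + 1) * Re (cpow u w)).
    by apply/funext => v; rewrite ImM.
  apply: continuousD; apply: continuousM; do ?exact: cvg_cst.
    exact: continuous_cpow_Im.
  exact: continuous_cpow_Re.
apply: eq_ReIm; rewrite ?Re_cRint ?Im_cRint ?ReD ?ImD ?ReN ?ImN.
  apply: (@Rintegral_FTC2 _ _ (fun u => Re (cpow u (w + 1)))) => // u /pos u0.
    by rewrite E; exact: is_derive_cpow_Re.
  by case: (sc u u0).
apply: (@Rintegral_FTC2 _ _ (fun u => Im (cpow u (w + 1)))) => // u /pos u0.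
  by rewrite E; exact: is_derive_cpow_Im.
by case: (sc u u0).
Qed.

Lemma cRint_right_approx (f : R -> R[i]) C M e : 0 < e -> e <= M ->
  cmeas `]0, M] f -> (forall u, 0 < u <= M -> nc (f u) <= C) ->
  nc (cRint mu `]0, M] f - cRint mu `[e, M] f) <= 2 * C * e.
Proof.
move=> e0 eM mf bf.
have E : `]0, M]%classic = `]0, e[%classic `|` `[e, M]%classic :> set R.
  by rewrite -itv_bndbnd_setU// bnd_simp.
rewrite [X in cRint mu X _ - _]E cRint_setU ?addrK//.
- have : nc (cRint mu `]0, e[ f) <= 2 * C * fine (mu `]0, e[).
    apply: modulus_cRint_le => //; first exact: lebesgue_itv_lty.
      by case: mf => m1 m2; split; [apply: measurable_funS m1|apply: measurable_funS m2] => // u;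
        rewrite E; left.
    move=> u /=; rewrite in_itv/= => /andP[u0 ue]; apply: bf.
    by rewrite u0 (le_trans (ltW ue)).
  by rewrite lebesgue_measure_itv/= lte_fin e0 -EFinB subr0.
- rewrite -E; apply: (@cint_bounded _ _ _ _ _ _ C) => //.
  exact: lebesgue_itv_lty.
- apply/disj_setPS => x [] /=; rewrite !in_itv/= => /andP[_ xb] /andP[bx _].
  by have := lt_le_trans xb bx; rewrite ltxx.
Qed.

(** Positivity of Re w makes the integrand bounded on ]0, M], so the integral is within O(e) of the
    one over [e, M], for which the closed formula is known. *)
Lemma cRint_cpow M w : 0 < M -> 0 < Re w ->
  cRint mu `]0, M] (fun u => cpow u w) = cpow M (w + 1) / (w + 1).
Proof.
move=> M0 w0.
have w1 : w + 1 != 0.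
  apply/eqP => /(congr1 (@complex.Re R)) /=; rewrite ReD /= => h.
  lra.
have mono u r : 0 <= r -> 0 < u <= M -> u `^ r <= M `^ r.
  by move=> r0 /andP[u0 uM]; apply: ge0_ler_powR; rewrite ?nnegrE ?(ltW u0) ?(ltW M0).
have mf : cmeas `]0, M] (fun u => cpow u w).
  by apply: cmeas_cpow => // u /=; rewrite in_itv/= => /andP[].
have bf u : 0 < u <= M -> nc (cpow u w) <= M `^ Re w.
  by move=> uM; rewrite modulus_cpow; apply: mono => //; exact: ltW.
(* The first summand pays for the piece ]0, e[, the second for the lower boundary term e^(w+1) / (w
   + 1). *)
pose K := 2 * M `^ Re w + M `^ Re w * nc (w + 1)^-1.
have K0 : 0 <= K.
  by rewrite addr_ge0// mulr_ge0 ?powR_ge0 ?modulus_ge0.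
have H e : 0 < e -> e <= M ->
    nc (cRint mu `]0, M] (fun u => cpow u w) - cpow M (w + 1) / (w + 1)) <= K * e.
  move=> e0 eM; have := cRint_right_approx e0 eM mf bf.
  rewrite cRint_cpow_FTC// => h.
  rewrite (_ : _ - _ = (cRint mu `]0, M] (fun u => cpow u w) -
    (cpow M (w + 1) - cpow e (w + 1)) / (w + 1)) - cpow e (w + 1) / (w + 1)); last by field.
  apply: le_trans (modulusB _ _) _; rewrite /K [leRHS]mulrDl lerD//.
  rewrite Normc.normcM [leRHS]mulrAC ler_wpM2r ?modulus_ge0// cpowD// Normc.normcM.
  rewrite (cpow_nat 1 e0) modulus_real expr1 (ger0_norm (ltW e0)) ler_wpM2r ?(ltW e0)//.
  by apply: bf; rewrite e0.
apply/eqP; rewrite -subr_eq0 -modulus_eq0 eq_le modulus_ge0 andbT.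
apply/ler_addgt0Pr => eps eps0; rewrite add0r.
pose e := Num.min M (eps / (K + 1)).
have K1 : 0 < K + 1 by rewrite ltr_pwDr.
have e0 : 0 < e by rewrite lt_min M0 divr_gt0.
apply: le_trans (H e e0 _) _; first by rewrite ge_min lexx.
apply: (@le_trans _ _ ((K + 1) * e)); first by rewrite ler_wpM2r ?(ltW e0)// lerDl.
by rewrite mulrC -ler_pdivlMr// ge_min lexx orbT.
Qed.

End PowerIntegral.

Section MellinContinuation.
Variable R : realType.
Notation leb := (@lebesgue_measure R).
Notation Re := complex.Re.
Notation Im := complex.Im.
Notation nc := (@Normc.normc R).
Variables (M : R) (Phi : R -> R) (c : nat -> R).

Definition odd_partial_sum N u := \sum_(j < N) c j * u ^+ j.*2.+1.

Definition odd_remainder N u := Phi u - odd_partial_sum N u.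

Definition remainder_mellin N (z : R[i]) :=
  cRint leb `]0, M] (fun u => (odd_remainder N u)%:C%C * cpow u (z - 1)).

(* [int_0^M u^z dPhi(u)] integrated by parts, with the first [N] odd terms of [Phi]
   integrated exactly; this exact part carries the poles. *)
Definition continuation_at N (z : R[i]) : R[i] :=
  cpow M z * (Phi M)%:C%C -
  z * (\sum_(j < N) (c j)%:C%C * (cpow M (z + j.*2.+1%:R) / (z + j.*2.+1%:R)) +
       remainder_mellin N z).

(* [continuation_at N z] does not depend on [N] once the remainder integral converges,
   so [N] is allowed to jump with [z]. *)
Definition continuation_order (z : R[i]) : nat := (Num.truncn `|Re z|).+1.

Definition continuation z := continuation_at (continuation_order z) z.

Hypotheses (M0 : 0 < M) (mPhi : measurable_fun `]0, M] Phi).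
Hypothesis Phi_expansion : forall N, exists C : R, forall u : R, 0 < u <= M ->
  `|odd_remainder N u| <= C * u ^+ N.*2.+1.

Lemma odd_remainder_bound N : exists C : R, 0 <= C /\ forall u : R, 0 < u <= M ->
  `|odd_remainder N u| <= C * u ^+ N.*2.+1.
Proof.
have [C H] := Phi_expansion N; exists `|C|; split => // u uM.
apply: le_trans (H _ uM) _; rewrite ler_wpM2r ?ler_norm// exprn_ge0// ltW//.
by case/andP: uM.
Qed.

Lemma odd_remainderS N u :
  odd_remainder N u = odd_remainder N.+1 u + c N * u ^+ N.*2.+1.
Proof. by rewrite /odd_remainder /odd_partial_sum big_ord_recr /=; ring. Qed.

Let mD : measurable (`]0, M]%classic : set R). Proof. exact: measurable_itv. Qed.

Let itvP0 (u : R) : `]0, M]%classic u -> 0 < u <= M.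
Proof. by rewrite /= in_itv. Qed.

Let lebD : (leb `]0%R, M] < +oo)%E. Proof. exact: lebesgue_itv_lty. Qed.

Let lebDE : fine (leb `]0%R, M]) = M.
Proof. by rewrite lebesgue_measure_itv/= lte_fin M0 -EFinB subr0. Qed.

Let Dpos : `]0, M]%classic `<=` [set u : R | 0 < u].
Proof. by move=> u /=; rewrite in_itv/= => /andP[]. Qed.

Lemma measurable_odd_remainder N : measurable_fun `]0, M] (odd_remainder N).
Proof.
apply: measurable_funB => //; apply: measurable_sum => j.
apply: measurable_funM; first exact: measurable_cst.
apply: measurable_funTS; exact: exprn_measurable.
Qed.

Lemma cmeas_remainder_kernel N z : cmeas `]0, M]
  (fun u => (odd_remainder N u)%:C%C * cpow u z).
Proof.
apply: cmeasM; first by apply: cmeas_real; exact: measurable_odd_remainder.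
exact: cmeas_cpow.
Qed.

Let powM (u r : R) : 0 <= r -> 0 < u <= M -> u `^ r <= M `^ r.
Proof.
by move=> r0 /andP[u0 uM]; apply: ge0_ler_powR; rewrite ?nnegrE ?(ltW u0) ?(ltW M0).
Qed.

Let kernel_pow (u : R) (N : nat) (x : R) : 0 < u ->
  u ^+ N.*2.+1 * u `^ (x - 1) = u `^ (x + N.*2%:R).
Proof.
move=> u0; rewrite -powR_mulrn ?(ltW u0)// -powRD; last by rewrite (lt0r_neq0 u0) implybT.
by congr (_ `^ _); rewrite -natr1; ring.
Qed.

Lemma modulus_remainder_kernel_le N C z u : 0 <= C ->
  (forall u, 0 < u <= M -> `|odd_remainder N u| <= C * u ^+ N.*2.+1) ->
  0 < u <= M ->
  nc ((odd_remainder N u)%:C%C * cpow u (z - 1)) <= C * u `^ (Re z + N.*2%:R).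
Proof.
move=> C0 HC uM; have u0 : 0 < u by case/andP: uM.
rewrite Normc.normcM modulus_real modulus_cpow ReD ReN /=.
rewrite -kernel_pow// mulrA ler_wpM2r ?powR_ge0//; exact: HC.
Qed.

Lemma remainder_kernel_bounded N z : 0 <= Re z + N.*2%:R -> exists C, forall u,
  0 < u <= M -> nc ((odd_remainder N u)%:C%C * cpow u (z - 1)) <= C.
Proof.
move=> zN; have [C [C0 HC]] := odd_remainder_bound N.
exists (C * M `^ (Re z + N.*2%:R)) => u uM.
apply: le_trans (modulus_remainder_kernel_le z C0 HC uM) _.
by rewrite ler_wpM2l// powM.
Qed.

Lemma cint_remainder_kernel N z : 0 <= Re z + N.*2%:R ->
  cint leb `]0, M] (fun u => (odd_remainder N u)%:C%C * cpow u (z - 1)).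
Proof.
move=> /remainder_kernel_bounded[C HC].
apply: (cint_bounded (C := C)) => //; exact: cmeas_remainder_kernel.
Qed.

(** One more odd term is split off the remainder and integrated exactly, as u^w with w = z + 2N;
    this converges because Re w > 0. *)
Lemma remainder_mellinS N z : 0 < Re z + N.*2%:R ->
  remainder_mellin N z = remainder_mellin N.+1 z +
    (c N)%:C%C * (cpow M (z + N.*2.+1%:R) / (z + N.*2.+1%:R)).
Proof.
move=> zN.
have w0 : 0 < Re (z + N.*2%:R) by rewrite ReD Re_nat.
have zNS : 0 <= Re z + N.+1.*2%:R.
  by apply: le_trans (ltW zN) _; rewrite lerD2l ler_nat leq_double.
have -> : z + N.*2.+1%:R = z + N.*2%:R + 1 by rewrite -natr1 addrA.
rewrite -cRint_cpow// -cRintZ//; last first.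
  apply: (cint_bounded (C := M `^ Re (z + N.*2%:R))) => //; first exact: cmeas_cpow.
  move=> u /itvP0 uM; rewrite modulus_cpow; apply: powM => //.
  exact: ltW.
rewrite -cRintD//; first last.
- apply: cintZ => //.
  apply: (cint_bounded (C := M `^ Re (z + N.*2%:R))) => //; first exact: cmeas_cpow.
  move=> u /itvP0 uM; rewrite modulus_cpow; apply: powM => //.
  exact: ltW.
- exact: cint_remainder_kernel.
apply: eq_cRint => u /itvP0/andP[u0 _].
rewrite odd_remainderS rmorphD rmorphM/= mulrDl; congr (_ + _).
rewrite -mulrA -cpow_nat// -cpowD//; congr (_ * cpow u _).
by rewrite -natr1; ring.
Qed.

Lemma continuation_atS N z : 0 < Re z + N.*2%:R ->
  continuation_at N z = continuation_at N.+1 z.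
Proof.
move=> zN; rewrite /continuation_at big_ord_recr /= remainder_mellinS//.
by congr (_ - _ * _); ring.
Qed.

(** Both orders can be raised one step at a time without changing the value, up to their sum. *)
Lemma continuation_atE N z : 1 <= Re z + N.*2%:R ->
  continuation z = continuation_at N z.
Proof.
have up m k w : 1 <= Re w + m.*2%:R -> continuation_at m w = continuation_at (m + k) w.
  move=> wm; elim: k => [|k ->]; first by rewrite addn0.
  rewrite addnS; apply: continuation_atS; apply: lt_le_trans ltr01 _.
  by apply: le_trans wm _; rewrite lerD2l ler_nat leq_double leq_addr.
(* The order is a natural number m >= 1 above |Re z|, so Re z + 2m >= Re z + m + 1 > 1. *)
have ord : 1 <= Re z + (continuation_order z).*2%:R.
  rewrite /continuation_order; set n := Num.truncn _.
  have h : `|Re z| < n.+1%:R by apply: truncnS_gt; rewrite ?num_real.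
  have : (n.+1 + 1)%:R <= n.+1.*2%:R :> R by rewrite ler_nat -addnn leq_add2l.
  have := ler_norm (- Re z); rewrite normrN natrD; lra.
move=> zN; rewrite /continuation (up _ N _ ord) (up _ (continuation_order z) _ zN).
by rewrite addnC.
Qed.

(** Differentiation under the integral sign, with the quadratic remainder in h bounded uniformly in
    u. The exponent b = Re z + 2N >= 1 leaves one power of u to absorb the logarithms of the
    derivative. *)
Lemma hol2_remainder_mellin N z : 1 <= Re z + N.*2%:R ->
  exists D, hol2 (remainder_mellin N) z D.
Proof.
move=> zN; have [C [C0 HC]] := odd_remainder_bound N.
set b := Re z + N.*2%:R in zN.
pose S := M `^ (b + 1) + M `^ (b - 1).
have S0 : 0 <= S by rewrite addr_ge0 ?powR_ge0.
have bS u : 0 < u <= M -> u `^ b * expR `|ln u| <= S.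
  move=> uM; have u0 : 0 < u by case/andP: uM.
  apply: (@le_trans _ _ (u `^ b * (u + u^-1))).
    by rewrite ler_wpM2l ?powR_ge0// expR_norm_ln_le.
  have -> : u `^ b * (u + u^-1) = u `^ (b + 1) + u `^ (b - 1).
    rewrite !powRD ?(lt0r_neq0 u0) ?implybT// powRr1 ?(ltW u0)// powR_inv1 ?(ltW u0)//.
    by rewrite mulrDr.
  by apply: lerD; apply: powM => //; lra.
pose k1 u := (odd_remainder N u)%:C%C * cpow u (z - 1) * (ln u)%:C%C.
have mln : measurable_fun (`]0, M]%classic : set R) (@ln R).
  by apply: measurable_funTS; exact: measurable_ln.
have mk1 : cmeas `]0, M] k1.
  by apply: cmeasM; [exact: cmeas_remainder_kernel|exact: cmeas_real].
have ck1 : cint leb `]0, M] k1.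
  apply: (cint_bounded (C := C * S)) => // u /itvP0 uM.
  rewrite Normc.normcM modulus_real.
  apply: (@le_trans _ _ (C * u `^ b * expR `|ln u|)); last first.
    by rewrite -mulrA ler_wpM2l// bS.
  apply: ler_pM => //; first exact: modulus_ge0.
    exact: modulus_remainder_kernel_le.
  by apply: le_trans (expR_ge1Dx _); rewrite lerDr.
(* The constant 40 is 5 from [modulus_cpow_quad] times 8 from l^2 <= 8 exp(l/2) with l = |ln u|. For
   |h| < 1/2 one also has exp(l |h|) <= exp(l/2), and the two half exponentials make up the exp l
   controlled by [bS]. *)
exists (cRint leb `]0, M] k1), (2 * (40 * (C * S)) * M), 2^-1; split => //.
  by rewrite !mulr_ge0// ltW.
move=> h hh.
(* This keeps Re (z + h) + 2N nonnegative, so that the kernel at z + h is still integrable. *)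
have ReH : - 2^-1 <= Re h.
  rewrite lerNl; apply: le_trans (ltW hh); rewrite -modulusN -ReN.
  exact: le_trans (ler_norm _) (normr_Re_le _).
have ch : cint leb `]0, M] (fun u => (odd_remainder N u)%:C%C * cpow u (z + h - 1)).
  apply: cint_remainder_kernel; rewrite ReD; rewrite /b in zN; lra.
have cz : cint leb `]0, M] (fun u => (odd_remainder N u)%:C%C * cpow u (z - 1)).
  apply: cint_remainder_kernel; rewrite /b in zN; lra.
rewrite /remainder_mellin -cRintB// -cRintZ// -cRintB//; do ?[exact: cintB|exact: cintZ].
rewrite [leRHS](_ : _ = 2 * (40 * (C * S) * nc h ^+ 2) * fine (leb `]0, M])); last first.
  by rewrite lebDE; ring.
apply: modulus_cRint_le => //.
  apply: cmeasB; first by apply: cmeasB; exact: cmeas_remainder_kernel.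
  by apply: cmeasM => //; exact: cmeas_cst.
move=> u /itvP0 uM; have u0 : 0 < u by case/andP: uM.
rewrite (_ : z + h - 1 = z - 1 + h); last by ring.
rewrite (cpowD (z - 1) h u0) /k1.
rewrite (_ : _ - _ - _ = (odd_remainder N u)%:C%C * cpow u (z - 1) *
  (cpow u h - 1 - h * (ln u)%:C%C)); last by ring.
rewrite Normc.normcM.
apply: (@le_trans _ _ (C * u `^ b * (40 * nc h ^+ 2 * expR `|ln u|))); last first.
  have := bS _ uM => /(ler_wpM2l C0) le1.
  rewrite (_ : C * u `^ b * _ = C * (u `^ b * expR `|ln u|) * (40 * nc h ^+ 2)); last by ring.
  rewrite (_ : 40 * _ * _ = C * S * (40 * nc h ^+ 2)); last by ring.
  by rewrite ler_wpM2r// mulr_ge0// sqr_ge0.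
apply: ler_pM; rewrite ?modulus_ge0//.
  exact: modulus_remainder_kernel_le.
apply: le_trans (modulus_cpow_quad _ u0) _.
set l := `|ln u|; have l0 : 0 <= l by exact: normr_ge0.
have h1 : expR (l * nc h) <= expR (l / 2) by rewrite ler_expR ler_wpM2l// ltW.
have h2 : l ^+ 2 <= 8 * expR (l / 2).
  by have := @expR_ge_sqr R (l / 2) (divr_ge0 l0 (ler0n R 2)); lra.
have h3 : expR l = expR (l / 2) * expR (l / 2) by rewrite -expRD -splitr.
rewrite exprMn [X in X * _]mulrA h3.
apply: (@le_trans _ _ (5 * l ^+ 2 * nc h ^+ 2 * expR (l / 2))).
  by rewrite ler_wpM2l// !mulr_ge0 ?modulus_ge0.
rewrite (_ : 40 * _ * _ = 5 * (8 * expR (l / 2)) * nc h ^+ 2 * expR (l / 2)); last by ring.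
by rewrite ler_wpM2r ?expR_ge0// ler_wpM2r ?sqr_ge0// ler_wpM2l.
Qed.

End MellinContinuation.

(** * Poles, residues and constant terms of the continuation *)

Section MellinPoles.
Variable R : realType.
Notation leb := (@lebesgue_measure R).
Notation Re := complex.Re.
Notation Im := complex.Im.
Notation nc := (@Normc.normc R).
Implicit Types (z w h : R[i]).
Variables (M : R) (Phi : R -> R) (c : nat -> R).
Hypotheses (M0 : 0 < M) (mPhi : measurable_fun `]0, M] Phi).
Hypothesis Phi_expansion : forall N, exists C : R, forall u : R, 0 < u <= M ->
  `|odd_remainder Phi c N u| <= C * u ^+ N.*2.+1.

Notation F := (continuation M Phi c).
Notation J := (remainder_mellin M Phi c).
Notation term := (fun j w => (c j)%:C%C * (cpow M (w + j.*2.+1%:R) / (w + j.*2.+1%:R))).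

(** The order used by [continuation] jumps with its argument. The margin 2 lets one fixed N serve
    the whole unit disc about z, where derivatives can then be taken. *)
Lemma continuation_near N z h : 2 <= Re z + N.*2%:R -> nc h < 1 ->
  F (z + h) = continuation_at M Phi c N (z + h).
Proof.
move=> zN h1; apply: continuation_atE => //; rewrite ReD.
have : - Re h <= nc h by rewrite -ReN -modulusN; apply: le_trans (ler_norm _) (normr_Re_le _).
lra.
Qed.

Lemma exists_continuation_order (k : nat) z :
  exists N : nat, (k < N)%N /\ 2 <= Re z + N.*2%:R.
Proof.
exists (k + (Num.truncn `|Re z|).+2)%N; split; first by rewrite -addSnnS leq_addr.
set n := Num.truncn _.
have h : `|Re z| < n.+1%:R by apply: truncnS_gt; rewrite ?num_real.
have : (n.+1 + 2)%:R <= (k + n.+2).*2%:R :> R.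
  by rewrite ler_nat -addnn; apply: leq_add; apply: leq_trans (leq_addl _ _).
have := ler_norm (- Re z); rewrite normrN natrD; lra.
Qed.

Lemma hol2_cpow_id z : exists D, hol2 (cpow M) z D.
Proof.
exists (cpow M (z + 0) * (ln M)%:C%C); have := hol2_cpow z 0 M0.
by apply: (hol2_ext ltr01) => h _; rewrite addr0.
Qed.

Lemma hol2_term z j : z + j.*2.+1%:R != 0 -> exists D, hol2 (term j) z D.
Proof.
move=> zj; have := hol2M (hol2_cst (c j)%:C%C z)
  (hol2M (hol2_cpow z j.*2.+1%:R M0) (hol2_inv zj)).
by move=> H; eexists; exact: H.
Qed.

Lemma hol2_continuation z : ~ neg_odd_int z -> exists D, hol2 F z D.
Proof.
move=> zodd; have [N [_ zN]] := exists_continuation_order 0 z.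
have zN1 : 1 <= Re z + N.*2%:R by lra.
have [D1 H1] := hol2_cpow_id z.
have [D2 H2] := hol2_remainder_mellin M0 mPhi Phi_expansion zN1.
have [|D3 H3] := @hol2_sum R 'I_N (index_enum _) (fun j => term j) z.
  move=> j; apply: hol2_term; apply/eqP => zj; apply: zodd; exists j.
  by apply/eqP; rewrite -subr_eq0 opprK zj.
have := hol2B (hol2M H1 (hol2_cst (Phi M)%:C%C z)) (hol2M (hol2_id z) (hol2D H3 H2)).
move=> H; eexists; apply: (hol2_ext ltr01 _ H) => h h1.
by rewrite (continuation_near zN h1).
Qed.

Section Pole.
Variable k : nat.
Let z : R[i] := - (k.*2.+1)%:R.

(** At z + h the denominator of the k-th term is exactly h, so this term equals B (z + h) / h; A
    gathers everything that is regular at z. *)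
Let B w : R[i] := (- w) * ((c k)%:C%C * cpow M (w + k.*2.+1%:R)).

Let A N w : R[i] := cpow M w * (Phi M)%:C%C -
  w * (\sum_(j < N | j != k :> nat) term j w + J N w).

Let hB : hol2 B z (- (c k)%:C%C - z * ((c k)%:C%C * (ln M)%:C%C)).
Proof.
have := hol2M (hol2N (hol2_id z))
  (hol2M (hol2_cst (c k)%:C%C z) (hol2_cpow z k.*2.+1%:R M0)).
rewrite /z addNr cpow0.
by congr hol2; ring.
Qed.

Let Bz : B z = - z * (c k)%:C%C.
Proof. by rewrite /B /z addNr cpow0 mulr1. Qed.

Let hA N : 2 <= Re z + N.*2%:R -> exists D, hol2 (A N) z D.
Proof.
move=> zN; have zN1 : 1 <= Re z + N.*2%:R by lra.
have [D1 H1] := hol2_cpow_id z.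
have [D2 H2] := hol2_remainder_mellin M0 mPhi Phi_expansion zN1.
(* The singular index is kept in the sum as the zero function, so that every summand is
   differentiable at z. *)
have [|D3 H3] := @hol2_sum R 'I_N (index_enum _)
    (fun j w => if j != k :> nat then term j w else 0) z.
  move=> j; case: (boolP (j != k :> nat)) => jk; last by exists 0; exact: hol2_cst.
  apply: hol2_term; apply: contra jk; rewrite /z (addrC (- _)) subr_eq0 eqr_nat.
  by rewrite eqSS -!muln2 eqn_pmul2r.
have := hol2B (hol2M H1 (hol2_cst (Phi M)%:C%C z)) (hol2M (hol2_id z) (hol2D H3 H2)).
move=> H; eexists; apply: (hol2_ext ltr01 _ H) => h h1.
by rewrite /A [in RHS]big_mkcond.
Qed.

Let FE N : (k < N)%N -> 2 <= Re z + N.*2%:R ->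
  forall h, h != 0 -> nc h < 1 -> F (z + h) = A N (z + h) + B (z + h) / h.
Proof.
move=> kN zN h h0 h1; rewrite (continuation_near zN h1) /continuation_at /A.
rewrite (bigD1 (Ordinal kN)) //= /B.
have E : z + h + k.*2.+1%:R = h by rewrite /z; ring.
by rewrite E; field; exact: h0.
Qed.

Lemma continuation_residue : (fun w => (w - z) * F w) @ z^' --> - z * (c k)%:C%C.
Proof.
have [N [kN zN]] := exists_continuation_order k z.
have [D hD] := hA zN; rewrite -Bz.
exact: (simple_pole_residue hD hB ltr01 (FE kN zN)).
Qed.

Lemma continuation_constant_term_aux N : (k < N)%N -> 2 <= Re z + N.*2%:R ->
  (fun w => F w - (- z * (c k)%:C%C) / (w - z)) @ z^' -->
  A N z + (- (c k)%:C%C - z * ((c k)%:C%C * (ln M)%:C%C)).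
Proof.
move=> kN zN; have [D hD] := hA zN; rewrite -Bz.
exact: (simple_pole_constant_term hD hB ltr01 (FE kN zN)).
Qed.

End Pole.

Lemma continuation_residueN1 : (fun w => (w + 1) * F w) @ (-1 : R[i])^' --> (c 0)%:C%C.
Proof. by have := @continuation_residue 0; rewrite !opprK mul1r. Qed.

Lemma continuation_constant_termN1 :
  (fun w => F w - (c 0)%:C%C / (w + 1)) @ (-1 : R[i])^' -->
  (Phi M / M + c 0 * (ln M - 1))%:C%C + J 1 (-1).
Proof.
have z2 : 2 <= Re (- 1%:R : R[i]) + 2.*2%:R by rewrite ReN /= -addnn natrD; lra.
have := @continuation_constant_term_aux 0 2 isT z2; rewrite !opprK !mul1r.
congr (_ --> _).
(* The margin 2 requires order 2 at z = -1. Expanding the order 1 remainder shows that the regular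
   term j = 1 is the difference between the two orders. *)
rewrite (remainder_mellinS M0 mPhi Phi_expansion (N := 1)); last first.
  by rewrite ReN /= -addnn natrD; lra.
rewrite big_mkcond !big_ord_recr big_ord0 /= cpowN1// !rmorphD/= !rmorphM/= rmorphB/= rmorph1.
rewrite -addnn /=; ring.
Qed.

End MellinPoles.

(** * Regularized integrals of a power of the distance *)

Lemma cvg_at_right_harmonic (R : realType) (A : set R) : (0 : R)^'+ A ->
  \forall n \near \oo, A (n.+1%:R^-1).
Proof.
move=> HA.
have : \forall n \near \oo, ((0 : R) < n.+1%:R^-1 -> A (n.+1%:R^-1)) by exact: (@cvg_harmonic R _ HA).
by apply: filterS => n; apply; rewrite invr_gt0 ltr0n.
Qed.

Section Exhaustion.
Context d (T : measurableType d) (R : realType).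
Variable mu : {measure set T -> \bar R}.
Variables (D : set T) (dist : T -> R).
Hypotheses (mD : measurable D) (mdist : measurable_fun D dist).

Lemma measurable_superlevel u : measurable (D `&` [set p | u < dist p]).
Proof.
have := mdist mD (measurable_itv `]u, +oo[); congr measurable; congr (_ `&` _).
by apply/seteqP; split => x /=; rewrite in_itv/= andbT.
Qed.

Lemma measurable_sublevel u : measurable (D `&` [set p | dist p <= u]).
Proof. exact: (mdist mD (measurable_itv `]-oo, u])). Qed.

(** A countable increasing exhaustion of {dist > 0}, on which negative powers of the distance are
    bounded and monotone convergence is available. *)
Let S (n : nat) := D `&` [set p | n.+1%:R^-1 < dist p].

Let D' := D `&` [set p | 0 < dist p].

Let mS n : measurable (S n). Proof. exact: measurable_superlevel. Qed.

Let SU : \bigcup_n S n = D'.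
Proof.
apply/seteqP; split => p.
  by move=> [n _ [Dp /= np]]; split => //=; apply: (lt_trans _ np); rewrite invr_gt0 ltr0n.
move=> [Dp /= p0].
have A : (0 : R)^'+ [set u | u < dist p] by exact: nbhs_right_lt.
have [N _ HN] := cvg_at_right_harmonic A.
by exists N => //; split => //=; exact: (HN N (leqnn N)).
Qed.

Let ndS : nondecreasing_seq S.
Proof.
move=> m n mn; apply/subsetPset => p [Dp /= mp]; split => //=.
apply: le_lt_trans mp; rewrite lef_pV2 ?posrE ?ltr0n//.
by rewrite ler_nat.
Qed.

Let SD' n : S n `<=` D'.
Proof. by rewrite -SU => p Sp; exists n. Qed.

Let cvgS (g : T -> R) : measurable_fun D g -> (forall p, D p -> 0 <= g p) ->
  (\int[mu]_(p in S n) (g p)%:E @[n --> \oo] --> \int[mu]_(p in D') (g p)%:E)%E.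
Proof.
move=> mg g0; rewrite -SU; apply: ge0_nondecreasing_set_cvg_integral => //.
- by move=> n; apply/measurable_EFinP; apply: measurable_funS mg => // p [].
- by move=> n p [Dp _]; rewrite lee_fin g0.
Qed.

(** By monotone convergence the bound B, uniform in n, passes to the integral over {dist > 0}. *)
Lemma superlevel_integrable (g : T -> R) B : measurable_fun D g ->
  (forall p, D p -> 0 <= g p) ->
  (forall n, mu.-integrable (S n) (EFin \o g)) ->
  (forall n, \int[mu]_(p in S n) g p <= B) ->
  mu.-integrable D' (EFin \o g).
Proof.
move=> mg g0 ig Bg; apply/integrableP; split.
  apply/measurable_EFinP; apply: measurable_funS mg => //.
  by move=> p [].
have -> : (\int[mu]_(x in D') `|(EFin \o g) x| = \int[mu]_(x in D') (g x)%:E)%E.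
  by apply: eq_integral => p; rewrite inE => -[Dp _] /=; rewrite ger0_norm ?g0.
apply: (@le_lt_trans _ _ B%:E); last exact: ltry.
rewrite -(cvg_lim _ (cvgS mg g0))//.
apply: lime_le; first by apply/cvg_ex; eexists; exact: cvgS.
apply: nearW => n; rewrite -[leLHS]fineK; last exact: integrable_fin_num.
by rewrite lee_fin Bg.
Qed.

(** For signed g the missing tail is dominated by the tail of |g|, which tends to 0 by monotone
    convergence. *)
Lemma superlevel_Rintegral_cvg (g : T -> R) : measurable_fun D g ->
  mu.-integrable D' (EFin \o g) ->
  (\int[mu]_(p in S n) g p) @[n --> \oo] --> \int[mu]_(p in D') g p.
Proof.
move=> mg ig.
have mD' : measurable D' by exact: measurable_superlevel.
have ign : mu.-integrable D' (EFin \o (fun p => `|g p|)).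
  exact: (integrable_norm ig).
have H : (\int[mu]_(p in S n) `|g p|) @[n --> \oo] --> \int[mu]_(p in D') `|g p|.
  apply: fine_cvg; rewrite fineK; last exact: integrable_fin_num.
  apply: cvgS => //; exact: measurableT_comp.
apply/cvgrPdist_lt => e e0; move/cvgrPdist_lt : H => /(_ e e0).
apply: filterS => n; apply: le_lt_trans.
have E : D' = S n `|` (D' `\` S n) by rewrite setDUK//; exact: SD'.
have mDS : measurable (D' `\` S n) by exact: measurableD.
have disj : [disjoint S n & D' `\` S n] by apply/disj_setPS => p [h1 [_ h2]].
rewrite [in leLHS]E Rintegral_setU -?E//.
rewrite [in leRHS]E Rintegral_setU -?E//.
have aux (x y : R) : x + y - x = y by ring.
rewrite !aux.
apply: le_trans (le_normr_Rintegral mDS _) _.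
  by apply: integrableS ig => //; exact: subDsetl.
exact: ler_norm.
Qed.

End Exhaustion.

Section RegularizedIntegrals.
Context d (T : measurableType d) (R : realType).
Variable mu : {sigma_finite_measure set T -> \bar R}.
Notation leb := (@lebesgue_measure R).
Notation Re := complex.Re.
Notation Im := complex.Im.
Notation nc := (@Normc.normc R).
Variables (D : set T) (dist rho : T -> R) (M : R) (c : nat -> R) (K0 : R).
Implicit Types (z w h : R[i]).
Hypotheses (mD : measurable D) (Dfin : (mu D < +oo)%E).
Hypotheses (mdist : measurable_fun D dist) (mrho : measurable_fun D rho).
Hypothesis brho : forall p, D p -> `|rho p| <= 1.
Hypotheses (M0 : 0 < M) (distM : forall p, D p -> dist p <= M).
Hypothesis dist0 : forall p, D p -> 0 <= dist p.
(** Linear volume growth makes {dist = 0} a null set and [dist p ^ x] integrable for every x >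
    -1. *)
Hypothesis volume_sublevel : forall u : R, 0 < u <= M ->
  fine (mu (D `&` [set p | dist p <= u])) <= K0 * u.

Notation Phi := (sublevel_integral mu D dist rho).

Hypothesis Phi_expansion : forall N, exists C : R, forall u : R, 0 < u <= M ->
  `|odd_remainder Phi c N u| <= C * u ^+ N.*2.+1.

Notation F := (continuation M Phi c).
Notation J := (remainder_mellin M Phi c).

Let mgt u : measurable (D `&` [set p | u < dist p]).
Proof. exact: measurable_superlevel. Qed.

Let mle u : measurable (D `&` [set p | dist p <= u]).
Proof. exact: measurable_sublevel. Qed.

Let fin_sub A : measurable A -> A `<=` D -> (mu A < +oo)%E.
Proof. by move=> mA AD; apply: le_lt_trans Dfin; apply: le_measure; rewrite ?inE. Qed.

Let mPhi (E : set R) : measurable E -> (leb E < +oo)%E -> measurable_fun E Phi.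
Proof. by move=> mE Efin; exact: (measurable_fun_sublevel_integral mD Dfin mdist mrho brho). Qed.

Let mPhiM : measurable_fun (`]0, M]%classic : set R) Phi.
Proof. by apply: mPhi => //; exact: lebesgue_itv_lty. Qed.

Let K1 : R := `|K0| + 1.

Let K1_gt0 : 0 < K1. Proof. by rewrite ltr_pwDr. Qed.

Let Phi_le u : 0 < u <= M -> `|Phi u| <= K1 * u.
Proof.
move=> uM; have u0 : 0 < u by case/andP: uM.
have : `|Phi u| <= 1 * fine (mu (D `&` [set p | dist p <= u])).
  apply: normr_Rintegral_le => //; first by apply: fin_sub => //; exact: subIsetl.
    by apply: measurable_funS mrho => // p [].
  by move=> p [Dp _]; exact: brho.
rewrite mul1r => /le_trans; apply; apply: le_trans (volume_sublevel uM) _.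
rewrite ler_wpM2r ?(ltW u0)// /K1.
by apply: le_trans (ler_norm _) _; rewrite lerDl.
Qed.

Let kernel z (p : T) : R[i] := cpow (dist p) z * (rho p)%:C%C.

Lemma superlevel_bounded_integrable e : 0 < e ->
  mu.-integrable (D `&` [set p | e < dist p]) (fun p => (rho p / dist p)%:E).
Proof.
move=> e0.
apply: (@bounded_integrable _ _ _ mu _ (fun p => rho p / dist p) e^-1) => //.
- by apply: fin_sub => //; exact: subIsetl.
- apply: measurable_funM; first by apply: measurable_funS mrho => // p [].
  apply: (@measurable_comp _ _ _ _ _ _ `]e, +oo[%classic (fun x : R => x^-1)) => //.
  + by move=> _ [p [Dp /= ep] <-] /=; rewrite in_itv/= ep.
  + apply: open_continuous_measurable_fun; first exact: interval_open.
    move=> x; rewrite inE/= in_itv/= andbT => ex.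
    by apply: inv_continuous; rewrite gt_eqF// (lt_trans e0).
  + by apply: measurable_funS mdist => // p [].
- move=> p [Dp /= ep]; have d0 : 0 < dist p by exact: lt_trans ep.
  rewrite normrM normfV (gtr0_norm d0); apply: (@le_trans _ _ (1 * (dist p)^-1)).
    by apply: ler_wpM2r; [rewrite invr_ge0 ltW|exact: brho].
  by rewrite mul1r lef_pV2 ?posrE// ltW.
Qed.

Lemma cmeas_kernel_superlevel z e : 0 <= e ->
  cmeas (D `&` [set p | e < dist p]) (kernel z).
Proof.
move=> e0; apply: cmeasM; last first.
  by apply: cmeas_real; apply: measurable_funS mrho => // p [].
have sub : dist @` (D `&` [set p | e < dist p]) `<=` `]e, +oo[.
  by move=> _ [p [Dp /= ep] <-] /=; rewrite in_itv/= ep.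
have md : measurable_fun (D `&` [set p | e < dist p]) dist.
  by apply: measurable_funS mdist => // p [].
have [|m1 m2] := @cmeas_cpow R `]e, +oo[%classic z (measurable_itv _).
  by move=> u /=; rewrite in_itv/= andbT; exact: le_lt_trans.
split.
  exact: (@measurable_comp _ _ _ _ _ _ `]e, +oo[%classic (fun u => Re (cpow u z))).
exact: (@measurable_comp _ _ _ _ _ _ `]e, +oo[%classic (fun u => Im (cpow u z))).
Qed.

Let cPhi (a b : R) w : 0 < a -> b <= M -> cint leb `[a, b] (fun u => (Phi u)%:C%C * cpow u w).
Proof.
move=> a0 bM.
have cw u : a <= u <= b -> {for u, continuous (fun u => Re (cpow u w))}.
  by move=> /andP[au _]; apply: continuous_cpow_Re; exact: lt_le_trans au.
have cw' u : a <= u <= b -> {for u, continuous (fun u => Im (cpow u w))}.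
  by move=> /andP[au _]; apply: continuous_cpow_Im; exact: lt_le_trans au.
have [C1 H1] := continuous_at_bounded cw.
have [C2 H2] := continuous_at_bounded cw'.
have mE : measurable (`[a, b]%classic : set R) by exact: measurable_itv.
have Efin : (leb `[a, b] < +oo)%E by exact: lebesgue_itv_lty.
apply: (cint_bounded (C := K1 * M * (C1 + C2))) => //.
- apply: cmeasM; first by apply: cmeas_real; exact: mPhi.
  apply: cmeas_cpow => // u /=; rewrite in_itv/= => /andP[au _].
  exact: lt_le_trans au.
- move=> u uab; have {}uab : a <= u <= b by move: uab; rewrite /= in_itv.
  have /andP[au ub] := uab; have u0 := lt_le_trans a0 au.
  have uM := le_trans ub bM.
  rewrite Normc.normcM modulus_real; apply: ler_pM => //; first exact: modulus_ge0.
    apply: le_trans (Phi_le _) _; first by rewrite u0.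
    by rewrite ler_wpM2l// ltW.
  apply: le_trans (modulus_le_ReIm _) _.
  by apply: lerD; [exact: H1|exact: H2].
Qed.

Lemma truncated_layer_cake z e : 0 < e -> e <= M ->
  cRint mu (D `&` [set p | e < dist p]) (kernel z) =
  cpow M z * (Phi M)%:C%C - cpow e z * (Phi e)%:C%C -
  z * cRint leb `[e, M] (fun u => (Phi u)%:C%C * cpow u (z - 1)).
Proof.
move=> e0 eM; rewrite -cRintZ//; last exact: cPhi.
have cd w (u : R) : 0 < u -> {for u, continuous (fun u => Re (w * cpow u (w - 1)))}.
  move=> u0.
  have -> : (fun u => Re (w * cpow u (w - 1))) =
      (fun u => Re w * Re (cpow u (w - 1)) - Im w * Im (cpow u (w - 1))).
    by apply/funext => v; rewrite ReM.
  apply: continuousB; apply: continuousM; do ?exact: cvg_cst.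
    exact: continuous_cpow_Re.
  exact: continuous_cpow_Im.
have cd' w (u : R) : 0 < u -> {for u, continuous (fun u => Im (w * cpow u (w - 1)))}.
  move=> u0.
  have -> : (fun u => Im (w * cpow u (w - 1))) =
      (fun u => Re w * Im (cpow u (w - 1)) + Im w * Re (cpow u (w - 1))).
    by apply/funext => v; rewrite ImM.
  apply: continuousD; apply: continuousM; do ?exact: cvg_cst.
    exact: continuous_cpow_Im.
  exact: continuous_cpow_Re.
have ReMr (x : R[i]) (r : R) : Re (x * r%:C%C) = Re x * r by rewrite ReM mulr0 subr0.
have ImMr (x : R[i]) (r : R) : Im (x * r%:C%C) = Im x * r by rewrite ImM mulr0 add0r.
apply: eq_ReIm.
  rewrite Re_cRint ReD ReN ReD ReN !ReMr Re_cRint.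
  under eq_Rintegral do rewrite /kernel ReMr.
  rewrite (layer_cake mD Dfin mdist mrho brho e0 eM distM
    (fun u u0 => is_derive_cpow_Re z u0) (cd z)).
  by congr (_ - _); apply: eq_Rintegral => u _; rewrite [(Phi u)%:C%C * _]mulrC mulrA ReMr.
rewrite Im_cRint ImD ImN ImD ImN !ImMr Im_cRint.
under eq_Rintegral do rewrite /kernel ImMr.
rewrite (layer_cake mD Dfin mdist mrho brho e0 eM distM
  (fun u u0 => is_derive_cpow_Im z u0) (cd' z)).
by congr (_ - _); apply: eq_Rintegral => u _; rewrite [(Phi u)%:C%C * _]mulrC mulrA ImMr.
Qed.

Let sub_itv e : 0 < e -> `[e, M]%classic `<=` (`]0, M]%classic : set R).
Proof.
by move=> e0 u /=; rewrite !in_itv/= => /andP[eu ->]; rewrite andbT (lt_le_trans e0).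
Qed.

Let crem (e : R) z : 0 < e -> -2 <= Re z ->
  cint leb `[e, M] (fun u => (odd_remainder Phi c 1 u)%:C%C * cpow u (z - 1)).
Proof.
move=> e0 z2; have [|i1 i2] := cint_remainder_kernel M0 mPhiM Phi_expansion (N := 1) (z := z).
  by rewrite -addnn /=; lra.
by split; [apply: integrableS i1|apply: integrableS i2] => //; exact: sub_itv.
Qed.

(** Only the linear term of Phi is split off. The rest is O(u^3), so its product with u^(z-1) is
    bounded for Re z >= -2, which covers both z = -1 and the half-plane Re z > -1. *)
Let split_kernel e z : 0 < e -> e <= M -> -2 <= Re z ->
  cRint leb `[e, M] (fun u => (Phi u)%:C%C * cpow u (z - 1)) =
  (c 0)%:C%C * cRint leb `[e, M] (fun u => cpow u z) +
  cRint leb `[e, M] (fun u => (odd_remainder Phi c 1 u)%:C%C * cpow u (z - 1)).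
Proof.
move=> e0 eM z2.
have mE : measurable (`[e, M]%classic : set R) by exact: measurable_itv.
have cp : cint leb `[e, M] (fun u => cpow u z).
  split; apply: continuous_itv_integrable => u /andP[eu _].
    by apply: continuous_cpow_Re; exact: lt_le_trans eu.
  by apply: continuous_cpow_Im; exact: lt_le_trans eu.
rewrite -cRintZ// -cRintD//; [|exact: cintZ|exact: crem].
apply: eq_cRint => u /=; rewrite in_itv/= => /andP[eu _].
have u0 := lt_le_trans e0 eu.
rewrite /odd_remainder /odd_partial_sum big_ord1 /= expr1 rmorphB rmorphM/= mulrBl.
have -> : cpow u z = u%:C%C * cpow u (z - 1).
  by have := cpowD (z - 1) 1 u0; rewrite subrK cpow1// mulrC.
by ring.
Qed.

Let remainder_approx z : -2 <= Re z -> exists C, forall e : R, 0 < e -> e <= M ->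
  nc (J 1 z - cRint leb `[e, M] (fun u => (odd_remainder Phi c 1 u)%:C%C * cpow u (z - 1)))
  <= C * e.
Proof.
move=> z2; have [|C HC] := remainder_kernel_bounded M0 Phi_expansion (N := 1) (z := z).
  by rewrite -addnn /=; lra.
exists (2 * C) => e e0 eM; apply: cRint_right_approx => //.
exact: cmeas_remainder_kernel.
Qed.

(** The summand -c 0 is the limit of the boundary term -Phi(e)/e of the truncated integral; in the
    continuation it comes from differentiating the factor -w of the polar numerator. *)
Definition regularized_limit : R :=
  Phi M / M + c 0 * (ln M - 1) + Re (J 1 (-1)).

Let constant_real :
  (Phi M / M + c 0 * (ln M - 1))%:C%C + J 1 (-1) = regularized_limit%:C%C.
Proof.
apply: eq_ReIm; first by rewrite ReD.
have E u : u \in (`]0, M]%classic : set R) ->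
    Im ((odd_remainder Phi c 1 u)%:C%C * cpow u (-1 - 1)) = cst 0 u.
  rewrite inE => Hu; have {Hu} /andP[u0 _] : 0 < u <= M by move: Hu; rewrite /= in_itv.
  by rewrite cpowB1// cpowN1// -!rmorphM.
rewrite ImD Im_cRint [X in _ + X](_ : _ = \int[leb]_(u in `]0, M]) cst 0 u).
  by rewrite Rintegral_cst// mul0r addr0.
exact: eq_Rintegral.
Qed.

(** The exponent excluded from [cRint_cpow_FTC], and the source of the logarithmic divergence. *)
Let cRint_cpowN1 e : 0 < e -> e <= M ->
  cRint leb `[e, M] (fun u => cpow u (-1)) = (ln M - ln e)%:C%C.
Proof.
move=> e0 eM; have pos u : e <= u <= M -> 0 < u.
  by move=> /andP[eu _]; exact: lt_le_trans eu.
have E u : u \in (`[e, M]%classic : set R) -> cpow u (-1) = (u^-1)%:C%C.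
  by rewrite inE /= in_itv /= => /pos u0; rewrite cpowN1.
apply: eq_ReIm.
  rewrite Re_cRint; transitivity (\int[leb]_(u in `[e, M]) u^-1).
    by apply: eq_Rintegral => u /E ->.
  apply: (@Rintegral_FTC2 _ _ (@ln R)) => // u /pos u0.
    exact: is_derive1_ln.
  by apply: inv_continuous; rewrite gt_eqF.
rewrite Im_cRint (@eq_Rintegral _ _ _ _ _ (cst 0)) ?Rintegral_cst ?mul0r//.
by move=> u /E ->.
Qed.

Lemma regularized_integral_cvg :
  (fun e : R => \int[mu]_(p in D `&` [set p | e < dist p]) (rho p / dist p) + c 0 * ln e)
    @ 0^'+ --> regularized_limit.
Proof.
have z2 : -2 <= Re (-1 : R[i]) by rewrite ReN /=; lra.
have [C HC] := remainder_approx z2.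
have [C1 [C10 HC1]] := odd_remainder_bound Phi_expansion 1.
(* The error is the boundary term, at most C1 e^2 <= C1 M e, plus the part of the remainder integral
   below e, at most C e. *)
pose K := C + C1 * M.
have key (e : R) : 0 < e -> e <= M ->
    `|\int[mu]_(p in D `&` [set p | e < dist p]) (rho p / dist p) + c 0 * ln e -
      regularized_limit| <= K * e.
  move=> e0 eM; have := truncated_layer_cake (-1) e0 eM.
  rewrite split_kernel// cRint_cpowN1// !cpowN1// => /(congr1 (@complex.Re R)).
  rewrite Re_cRint (@eq_Rintegral _ _ _ _ _ (fun p => rho p / dist p)); last first.
    move=> p; rewrite inE => -[_ ep]; have d0 : 0 < dist p by exact: lt_trans ep.
    by rewrite /kernel cpowN1// ReM /= mulr0 subr0 mulrC.
  set I := \int[mu]_(_ in _) _ => IE.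
  have -> : I + c 0 * ln e - regularized_limit =
      Re (- ((odd_remainder Phi c 1 e / e)%:C%C) - (J 1 (-1) -
        cRint leb `[e, M] (fun u => (odd_remainder Phi c 1 u)%:C%C * cpow u (-1 - 1)))).
    rewrite IE /regularized_limit.
    rewrite !(ReD, ReN, ReM, ImD, ImN, ImM) /= !(mulr0, mul0r, subr0, oppr0, addr0, add0r).
    rewrite /odd_remainder /odd_partial_sum big_ord1 /= expr1.
    by field; rewrite !gt_eqF.
  apply: le_trans (normr_Re_le _) _; apply: le_trans (modulusB _ _) _.
  rewrite modulusN modulus_real /K [leRHS]mulrDl addrC; apply: lerD; first exact: HC.
  rewrite normrM normfV (gtr0_norm e0) ler_pdivrMr//.
  have eM' : 0 < e <= M by rewrite e0.
  apply: le_trans (HC1 _ eM') _.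
  have -> : e ^+ 1.*2.+1 = e * e * e by rewrite (_ : 1.*2.+1 = 3)%N// !exprS expr0; ring.
  rewrite -(mulrA C1) -mulrA -(mulrA C1); apply: ler_wpM2l => //.
  by rewrite !mulrA !ler_wpM2r// ltW.
apply/cvgrPdistC_lt => eps eps0.
have K0' : 0 < `|K| + 1 by rewrite ltr_pwDr.
near=> e.
have e0 : 0 < e by near: e; exact: nbhs_right_gt.
have eM : e <= M by near: e; exact: nbhs_right_le.
apply: le_lt_trans (key e e0 eM) _.
apply: (@le_lt_trans _ _ ((`|K| + 1) * e)).
  by rewrite ler_wpM2r ?(ltW e0)//; apply: le_trans (ler_norm _) _; rewrite lerDl.
rewrite mulrC -ltr_pdivlMr//; near: e; apply: nbhs_right_lt.
by rewrite divr_gt0.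
Unshelve. all: by end_near. Qed.

Lemma continuation_constant_term_regularized :
  (fun w => F w - (c 0)%:C%C / (w + 1)) @ (-1 : R[i])^' --> regularized_limit%:C%C.
Proof.
by rewrite -constant_real; exact: (continuation_constant_termN1 M0 mPhiM Phi_expansion).
Qed.

(** The boundary terms at e, namely e^z Phi(e) and a multiple of e^(z+1), are O(e^(Re z + 1)); the
    remainder integral over ]0, e[ is O(e). *)
Let truncated_error z : -1 < Re z -> exists K, 0 <= K /\ forall e : R, 0 < e -> e <= M ->
  nc (cRint mu (D `&` [set p | e < dist p]) (kernel z) - F z) <= K * (e `^ (Re z + 1) + e).
Proof.
move=> z1; have z2 : -2 <= Re z by lra.
have [C HC] := remainder_approx z2.
have w0 : z + 1 != 0.
  by apply/eqP => /(congr1 (@complex.Re R)) /=; rewrite ReD /=; lra.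
exists (K1 + nc (z * ((c 0)%:C%C / (z + 1))) + nc z * `|C|); split.
  by rewrite !addr_ge0 ?mulr_ge0 ?modulus_ge0// ltW.
move=> e e0 eM; rewrite truncated_layer_cake// split_kernel// cRint_cpow_FTC//.
rewrite (continuation_atE M0 mPhiM Phi_expansion (N := 1)); last by rewrite -addnn /=; lra.
rewrite /continuation_at big_ord1 (_ : z + _.*2.+1%:R = z + 1)//.
have := HC e e0 eM.
set Je := cRint leb `[e, M] _ => {}HC.
rewrite (_ : _ - _ = - (cpow e z * (Phi e)%:C%C) +
  z * ((c 0)%:C%C / (z + 1)) * cpow e (z + 1) + z * (J 1 z - Je)); last by field.
have p0 : 0 <= e `^ (Re z + 1) by exact: powR_ge0.
apply: le_trans (modulusD _ _) _.
rewrite [leRHS]mulrDl; apply: lerD.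
  apply: le_trans (modulusD _ _) _; rewrite [leRHS]mulrDl; apply: lerD.
    rewrite modulusN Normc.normcM modulus_cpow modulus_real.
    apply: (@le_trans _ _ (K1 * e `^ (Re z + 1))); last by rewrite ler_wpM2l ?(ltW K1_gt0)// lerDl ltW.
    rewrite powRD ?(lt0r_neq0 e0) ?implybT// powRr1 ?(ltW e0)// mulrCA.
    by rewrite ler_wpM2l ?powR_ge0// Phi_le// e0.
  rewrite Normc.normcM modulus_cpow ReD /= ler_wpM2l ?modulus_ge0// lerDl ltW//.
rewrite Normc.normcM -mulrA ler_wpM2l ?modulus_ge0//; apply: le_trans HC _.
apply: (@le_trans _ _ (`|C| * e)); first by rewrite ler_wpM2r ?ler_norm// ltW.
by rewrite ler_wpM2l// lerDr.
Qed.

Let mkernel z : cmeas (D `&` [set p | 0 < dist p]) (kernel z).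
Proof. exact: cmeas_kernel_superlevel. Qed.

Let null_diagonal : mu (D `&` [set p | dist p <= 0]) = 0%E.
Proof.
have fm : mu (D `&` [set p | dist p <= 0]) \is a fin_num.
  by rewrite ge0_fin_numE//; apply: fin_sub => //; exact: subIsetl.
rewrite -(fineK fm); congr EFin; apply/eqP; rewrite eq_le fine_ge0// andbT.
apply/ler_addgt0Pr => eps eps0; rewrite add0r.
pose u := Num.min M (eps / K1).
have u0 : 0 < u by rewrite lt_min M0 divr_gt0.
have uM : 0 < u <= M by rewrite u0 ge_min lexx.
have fu : mu (D `&` [set p | dist p <= u]) \is a fin_num.
  by rewrite ge0_fin_numE//; apply: fin_sub => //; exact: subIsetl.
apply: (@le_trans _ _ (fine (mu (D `&` [set p | dist p <= u])))).
  rewrite fine_le//; apply: le_measure; rewrite ?inE// => p [Dp /= p0]; split => //=.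
  exact: le_trans p0 (ltW u0).
apply: le_trans (volume_sublevel uM) _; apply: (@le_trans _ _ (K1 * u)).
  by rewrite ler_wpM2r ?(ltW u0)//; apply: le_trans (ler_norm _) _; rewrite lerDl.
by rewrite mulrC -ler_pdivlMr// ge_min lexx orbT.
Qed.

Let V := sublevel_integral mu D dist (cst 1).

Let V_bound u : 0 < u <= M -> 0 <= V u <= K1 * u.
Proof.
move=> uM; have u0 : 0 < u by case/andP: uM.
rewrite /V /sublevel_integral Rintegral_cst// mul1r fine_ge0//=.
apply: le_trans (volume_sublevel uM) _.
by rewrite ler_wpM2r ?(ltW u0)//; apply: le_trans (ler_norm _) _; rewrite lerDl.
Qed.

(** Layer cake for the density 1. The boundary term at e has a favourable sign, and V(u) <= K1 u
    leaves an integral of u^x that stays bounded as e -> 0 because x + 1 > 0. *)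
Let dist_power_bound x e : -1 < x -> 0 < e -> e <= M ->
  \int[mu]_(p in D `&` [set p | e < dist p]) (dist p `^ x) <=
  M `^ x * (K1 * M) + `|x| * K1 * (M `^ (x + 1) / (x + 1)).
Proof.
move=> x1 e0 eM.
have b1 p : D p -> `|cst 1 p : R| <= 1 by move=> _ /=; rewrite normr1.
have x10 : 0 < x + 1 by lra.
have df (y u : R) : 0 < u -> is_derive u 1 (fun v : R => v `^ y) (y * u `^ (y - 1)).
  by move=> u0; exact: is_derive1_powR.
have cf (y u : R) : 0 < u -> {for u, continuous (fun v : R => v `^ y)}.
  by move=> u0; exact: is_derive_continuous (df y u u0).
have cf' (u : R) : 0 < u -> {for u, continuous (fun u => x * u `^ (x - 1))}.
  by move=> u0; apply: continuousM; [exact: cvg_cst|exact: cf].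
have := layer_cake mD Dfin mdist (measurable_cst (1 : R)) b1 e0 eM distM (df x) cf'.
rewrite (@eq_Rintegral _ _ _ _ _ (fun p => dist p `^ x)); last by move=> p _; rewrite mulr1.
rewrite -/V => ->.
have eMi : 0 < e <= M by rewrite e0.
have MMi : 0 < M <= M by rewrite M0 lexx.
have /andP[VM0 VM] := V_bound MMi; have /andP[Ve0 _] := V_bound eMi.
have mE : measurable (`[e, M]%classic : set R) by exact: measurable_itv.
have cx u : e <= u <= M -> {for u, continuous (fun v : R => v `^ x)}.
  by move=> /andP[eu _]; apply: cf; exact: lt_le_trans eu.
have ipow : leb.-integrable `[e, M] (EFin \o (fun u => u `^ x)).
  exact: continuous_itv_integrable.
have ipowK : leb.-integrable `[e, M] (EFin \o (fun u => `|x| * K1 * u `^ x)).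
  apply: continuous_itv_integrable => u uM; apply: continuousM; first exact: cvg_cst.
  exact: cx.
have mV : measurable_fun (`[e, M]%classic : set R) V.
  apply: (measurable_fun_sublevel_integral mD Dfin mdist (measurable_cst (1 : R)) b1) => //.
  exact: lebesgue_itv_lty.
have kb u : e <= u <= M -> `|x * u `^ (x - 1) * V u| <= `|x| * K1 * u `^ x.
  move=> /andP[eu uM]; have u0 := lt_le_trans e0 eu.
  have uMi : 0 < u <= M by rewrite u0.
  have /andP[Vu0 Vu] := V_bound uMi.
  rewrite !normrM (ger0_norm (powR_ge0 _ _)) (ger0_norm Vu0) -!mulrA ler_wpM2l//.
  have -> : u `^ x = u * u `^ (x - 1).
    by rewrite powRB ?(lt0r_neq0 u0) ?implybT// powRr1 ?(ltW u0)// mulrC divfK// gt_eqF.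
  by rewrite mulrA mulrC ler_wpM2r ?powR_ge0.
have mk : measurable_fun (`[e, M]%classic : set R) (fun u => x * u `^ (x - 1) * V u).
  apply: measurable_funM => //; apply: continuous_at_measurable => u /andP[eu _].
  by apply: cf'; exact: lt_le_trans eu.
have ik : leb.-integrable `[e, M] (EFin \o (fun u => x * u `^ (x - 1) * V u)).
  apply: le_integrable ipowK => //; first exact/measurable_EFinP.
  move=> u /=; rewrite in_itv/= lee_fin => /kb/le_trans; apply; exact: ler_norm.
have h1 : `|\int[leb]_(u in `[e, M]) (x * u `^ (x - 1) * V u)| <=
    `|x| * K1 * (M `^ (x + 1) / (x + 1)).
  apply: le_trans (le_normr_Rintegral (mu := leb) (measurable_itv _) ik) _.
  apply: (@le_trans _ _ (\int[leb]_(u in `[e, M]) (`|x| * K1 * u `^ x))).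
    by apply: le_Rintegral => //; exact: (integrable_norm ik).
  rewrite RintegralZl// ler_wpM2l ?mulr_ge0 ?(ltW K1_gt0)//.
  have -> : \int[leb]_(u in `[e, M]) (u `^ x) = M `^ (x + 1) / (x + 1) - e `^ (x + 1) / (x + 1).
    apply: (@Rintegral_FTC2 _ _ (fun u => u `^ (x + 1) / (x + 1))) => // u /andP[eu _].
    have u0 := lt_le_trans e0 eu.
    have := @is_deriveM R R (fun v => v `^ (x + 1)) (cst (x + 1)^-1) u 1 _ _
      (df (x + 1) u u0) (is_derive_cst _ _ _).
    move/is_derive_eq; apply.
    by rewrite /= addrK scaler0 add0r /GRing.scale /= mulrA mulVf ?mul1r// gt_eqF.
  by rewrite gerBl divr_ge0 ?powR_ge0// ltW.
have h2 : M `^ x * V M <= M `^ x * (K1 * M) by rewrite ler_wpM2l ?powR_ge0.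
have h3 : 0 <= e `^ x * V e by rewrite mulr_ge0 ?powR_ge0.
have := ler_norm (- \int[leb]_(u in `[e, M]) (x * u `^ (x - 1) * V u)).
rewrite normrN; lra.
Qed.

Let measurable_dist_pow x : measurable_fun D (fun p => dist p `^ x).
Proof. by apply: (measurableT_comp (f := fun v : R => v `^ x)) => //; exact: measurable_powR. Qed.

Let dist_pow_integrable x : -1 < x ->
  mu.-integrable (D `&` [set p | 0 < dist p]) (EFin \o (fun p => dist p `^ x)).
Proof.
move=> x1; set B := M `^ x * (K1 * M) + `|x| * K1 * (M `^ (x + 1) / (x + 1)).
have B0 : 0 <= B.
  rewrite /B addr_ge0 ?mulr_ge0 ?powR_ge0 ?invr_ge0 ?(ltW K1_gt0) ?(ltW M0)//; lra.
apply: (superlevel_integrable mD mdist (B := B)) => // [p _|n|n]; first exact: powR_ge0.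
  have n0 : 0 < n.+1%:R^-1 :> R by rewrite invr_gt0 ltr0n.
  have cx u : n.+1%:R^-1 <= u <= M -> {for u, continuous (fun v : R => v `^ x)}.
    move=> /andP[eu _]; apply: is_derive_continuous; apply: is_derive1_powR.
    exact: lt_le_trans eu.
  have [C HC] := continuous_at_bounded cx.
  apply: (bounded_integrable (C := C)) => //.
  - by apply: fin_sub => //; exact: subIsetl.
  - by apply: measurable_funS (measurable_dist_pow x) => // p [].
  - by move=> p [Dp /= np]; apply: HC; rewrite ltW// distM.
have [nM|Mn] := leP (n.+1%:R^-1) M.
  by apply: dist_power_bound => //; rewrite invr_gt0 ltr0n.
rewrite (_ : D `&` _ = set0) ?Rintegral_set0//.
apply/seteqP; split => // p [Dp /= np].
by have := lt_trans np (le_lt_trans (distM Dp) Mn); rewrite ltxx.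
Qed.

Let cint_positive z : -1 < Re z -> cint mu (D `&` [set p | 0 < dist p]) (kernel z).
Proof.
move=> z1; have [m1 m2] := mkernel z; have ip := dist_pow_integrable z1.
have mD' := mgt 0.
have kb p : D p -> nc (kernel z p) <= dist p `^ Re z.
  move=> Dp; rewrite Normc.normcM modulus_cpow modulus_real ler_piMr ?powR_ge0//.
  exact: brho.
split; (apply: le_integrable ip => //; first exact/measurable_EFinP);
  move=> p [Dp _]; rewrite lee_fin (ger0_norm (powR_ge0 _ _)).
  exact: le_trans (normr_Re_le _) (kb _ Dp).
exact: le_trans (normr_Im_le _) (kb _ Dp).
Qed.

Let DnullE : D `\` (D `&` [set p | dist p <= 0]) = D `&` [set p | 0 < dist p].
Proof.
apply/seteqP; split => p.
  by move=> [Dp h]; split => //=; rewrite ltNge; apply/negP => p0; apply: h.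
by move=> [Dp /= p0]; split => // -[_ /=]; rewrite leNgt p0.
Qed.

(** On {dist = 0} the power takes the default value [cpow 0 z], a constant, so measurability extends
    to all of D. *)
Let mkernelD z : cmeas D (kernel z).
Proof.
have DU : D = (D `&` [set p | 0 < dist p]) `|` (D `&` [set p | dist p <= 0]).
  rewrite -setIUr; apply/esym/setIidl => p _ /=.
  by have [|] := leP (dist p) 0; [right|left].
have [m1 m2] := mkernel z.
have E p : p \in D `&` [set p | dist p <= 0] -> cpow 0 z * (rho p)%:C%C = kernel z p.
  rewrite inE => -[Dp /= p0]; rewrite /kernel (_ : dist p = 0)//.
  by apply/eqP; rewrite eq_le p0 dist0.
have [m3 m4] : cmeas (D `&` [set p | dist p <= 0]) (fun p => cpow 0 z * (rho p)%:C%C).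
  apply: cmeasM; first exact: cmeas_cst.
  by apply: cmeas_real; apply: measurable_funS mrho => // p [].
split; rewrite DU; apply/measurable_funU => //; split => //.
  by apply: eq_measurable_fun m3 => p /E ->.
by apply: eq_measurable_fun m4 => p /E ->.
Qed.

Theorem kernel_integrable z : -1 < Re z -> cint mu D (kernel z).
Proof.
move=> z1; have [i1 i2] := cint_positive z1; have [m1 m2] := mkernelD z.
split; apply/(negligible_integrable (mle 0) mD _ null_diagonal); rewrite ?DnullE//;
  exact/measurable_EFinP.
Qed.

(** Along e = 1/(n+1) the truncated integrals tend to the full integral by exhaustion and to F z by
    [truncated_error]. *)
Theorem kernel_integral_continuation z : -1 < Re z -> cRint mu D (kernel z) = F z.
Proof.
move=> z1; have [i1 i2] := kernel_integrable z1.
have [j1 j2] := cint_positive z1; have [m1 m2] := mkernelD z.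
have [K [K0' HK]] := truncated_error z1.
have x0 : 0 < Re z + 1 by lra.
have lim0 : (fun e : R => K * (e `^ (Re z + 1) + e)) @ 0^'+ --> (0 : R).
  have h1 : (fun e : R => e) @ 0^'+ --> (0 : R) by apply: cvg_at_right_filter; exact: cvg_id.
  have h2 : (fun e : R => e `^ (Re z + 1)) @ 0^'+ --> (0 : R) by exact: powR_cvg0.
  have : (fun e : R => K * (e `^ (Re z + 1) + e)) @ 0^'+ --> K * (0 + 0).
    by apply: cvgM; [exact: cvg_cst|exact: cvgD].
  by rewrite addr0 mulr0.
have near_err eps : 0 < eps -> \forall n \near \oo,
    nc (cRint mu (D `&` [set p | n.+1%:R^-1 < dist p]) (kernel z) - F z) < eps.
  move=> eps0; apply: (@cvg_at_right_harmonic R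
    [set e | nc (cRint mu (D `&` [set p | e < dist p]) (kernel z) - F z) < eps]).
  near=> e.
  have e0 : 0 < e by near: e; exact: nbhs_right_gt.
  have eM : e <= M by near: e; exact: nbhs_right_le.
  apply: le_lt_trans (HK e e0 eM) _.
  apply: le_lt_trans (ler_norm _) _; rewrite -[X in `|X|]subr0.
  near: e; by move/cvgrPdistC_lt : lim0; apply.
have fin (g : T -> R) (l : R) : measurable_fun D g -> mu.-integrable D (EFin \o g) ->
    mu.-integrable (D `&` [set p | 0 < dist p]) (EFin \o g) ->
    (forall eps : R, 0 < eps -> \forall n \near \oo,
      `|\int[mu]_(p in D `&` [set p | n.+1%:R^-1 < dist p]) g p - l| < eps) ->
    \int[mu]_(p in D) g p = l.
  move=> mg ig ig' H.
  have -> : \int[mu]_(p in D) g p = \int[mu]_(p in D `&` [set p | 0 < dist p]) g p.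
    by rewrite /Rintegral (negligible_integral (mle 0) mD ig null_diagonal) DnullE.
  have c1 := superlevel_Rintegral_cvg mD mdist mg ig'.
  have c2 : (\int[mu]_(p in D `&` [set p | n.+1%:R^-1 < dist p]) g p) @[n --> \oo] --> l.
    by apply/cvgrPdistC_lt.
  exact: (cvg_unique _ c1 c2).
apply: eq_ReIm.
  apply: fin => // eps eps0; have := near_err eps eps0; apply: filterS => n.
  apply: le_lt_trans; apply: le_trans (normr_Re_le _).
  by rewrite [in leRHS]ReD [in leRHS]ReN.
apply: fin => // eps eps0; have := near_err eps eps0; apply: filterS => n.
apply: le_lt_trans; apply: le_trans (normr_Im_le _).
by rewrite [in leRHS]ImD [in leRHS]ImN.
Unshelve. all: by end_near. Qed.

End RegularizedIntegrals.

(** * Uniform expansions near the diagonal *)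

Section UniformExpansions.
Variable R : realType.
Variables (L a : R).
Implicit Types (s t : R) (p q : R -> {poly R}) (f w : R -> R -> R) (N : nat).

(** Common bounds on degree and coefficients make error constants uniform in s; measurability allows
    coefficientwise integration over s. *)
Definition coef_bounded p := exists (n : nat) (C : R), 0 <= C /\
  (forall s, (size (p s) <= n)%N) /\
  (forall k s, 0 <= s < L -> `|(p s)`_k| <= C) /\
  (forall k, measurable_fun `[0, L[ (fun s => (p s)`_k)).

(* [f (s, t) = p_s(w (s, t)) + O(|w (s, t)|^N)] uniformly in [s]; [t = 0] is excluded because
   difference quotients and [rhoW] take junk values on the diagonal. *)
Definition expands w f N := exists p, coef_bounded p /\ exists C : R, 0 <= C /\
  forall s t, 0 <= s < L -> 0 < `|t| <= a -> `|f s t - (p s).[w s t]| <= C * `|w s t| ^+ N.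

Lemma coef_boundedC (c : R -> R) C : measurable_fun `[0, L[ c ->
  (forall s, 0 <= s < L -> `|c s| <= C) -> coef_bounded (fun s => (c s)%:P).
Proof.
move=> mc bc; exists 1%N, `|C|; split => //; split; first by move=> s; exact: size_polyC_leq1.
split.
  move=> k s sL; rewrite coefC; case: eqP => _; last by rewrite normr0.
  by apply: le_trans (bc s sL) _; exact: ler_norm.
move=> k; apply: (eq_measurable_fun (fun s => if k == 0%N then c s else 0)).
  by move=> s _; rewrite coefC.
by case: (k == 0)%N => //; exact: measurable_cst.
Qed.

Lemma coef_boundedX : coef_bounded (fun=> 'X).
Proof.
exists 2%N, 1; split => //; split; first by move=> s; rewrite size_polyX.
split => [k s _|k]; last exact: measurable_cst.
by rewrite coefX; case: eqP; rewrite ?normr1 ?normr0.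
Qed.

Lemma coef_boundedD p q : coef_bounded p -> coef_bounded q ->
  coef_bounded (fun s => p s + q s).
Proof.
move=> [n [C [C0 [sp [bp mp]]]]] [m [E [E0 [sq [bq mq]]]]].
exists (maxn n m), (C + E); split; first exact: addr_ge0.
split; first by move=> s; apply: leq_trans (size_polyD _ _) _; rewrite geq_max !leq_max sp sq orbT.
split => [k s sL|k].
  by rewrite coefD; apply: le_trans (ler_normD _ _) _; rewrite lerD ?bp ?bq.
apply: (eq_measurable_fun (fun s => (p s)`_k + (q s)`_k)).
  by move=> s _; rewrite coefD.
exact: measurable_funD.
Qed.

Lemma coef_boundedM p q : coef_bounded p -> coef_bounded q ->
  coef_bounded (fun s => p s * q s).
Proof.
move=> [n [C [C0 [sp [bp mp]]]]] [m [E [E0 [sq [bq mq]]]]].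
have spq s : (size (p s * q s)%R <= n + m)%N.
  apply: leq_trans (size_polyMleq _ _) _; apply: leq_trans (leq_pred _) _.
  by rewrite leq_add.
exists (n + m)%N, (C * E *+ (n + m)); split; first by rewrite mulrn_wge0// mulr_ge0.
split => //; split => [k s sL|k]; last first.
  apply: (eq_measurable_fun (fun s => \sum_(j < k.+1) (p s)`_j * (q s)`_(k - j))).
    by move=> s _; rewrite coefM.
  apply: measurable_sum => j.
  exact: measurable_funM.
have [kn|nk] := ltnP k (n + m); last first.
  by rewrite nth_default ?normr0 ?mulrn_wge0 ?mulr_ge0// (leq_trans (spq s)).
rewrite coefM; apply: le_trans (ler_norm_sum _ _ _) _.
apply: (@le_trans _ _ (\sum_(j < k.+1) C * E)).
  by apply: ler_sum => j _; rewrite normrM ler_pM ?bp ?bq.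
by rewrite sumr_const card_ord; apply: ler_wpMn2l; rewrite ?mulr_ge0.
Qed.

Lemma horner_coef_bounded p W : coef_bounded p -> exists B, 0 <= B /\
  forall s x, 0 <= s < L -> `|x| <= W -> `|(p s).[x]| <= B.
Proof.
move=> [n [C [C0 [sp [bp mp]]]]].
exists (\sum_(i < n) C * `|W| ^+ i); split.
  by rewrite sumr_ge0// => i _; rewrite mulr_ge0// exprn_ge0.
move=> s x sL xW; rewrite (horner_coef_wide _ (sp s)).
apply: le_trans (ler_norm_sum _ _ _) _; apply: ler_sum => i _.
rewrite normrM normrX ler_pM ?bp ?exprn_ge0//.
by rewrite lerXn2r ?nnegrE// (le_trans xW)// ler_norm.
Qed.

Section Closure.
Variables (w : R -> R -> R) (W : R).
Hypothesis wW : forall s t, 0 <= s < L -> 0 < `|t| <= a -> `|w s t| <= W.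

Lemma expands_bounded f N : expands w f N -> exists B, 0 <= B /\
  forall s t, 0 <= s < L -> 0 < `|t| <= a -> `|f s t| <= B.
Proof.
move=> [p [cp [C [C0 H]]]]; have [B [B0 HB]] := horner_coef_bounded W cp.
exists (C * `|W| ^+ N + B); split; first by rewrite addr_ge0 ?mulr_ge0 ?exprn_ge0.
move=> s t sL ta; rewrite -(subrK (p s).[w s t] (f s t)).
apply: le_trans (ler_normD _ _) _; apply: lerD; last by apply: HB => //; exact: wW.
apply: le_trans (H s t sL ta) _; rewrite ler_wpM2l// lerXn2r ?nnegrE//.
by apply: le_trans (wW sL ta) _; exact: ler_norm.
Qed.

Lemma expands_near f h N C : expands w h N ->
  (forall s t, 0 <= s < L -> 0 < `|t| <= a -> `|f s t - h s t| <= C * `|w s t| ^+ N) ->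
  expands w f N.
Proof.
move=> [p [cp [E [E0 H]]]] fh; exists p; split => //.
exists (`|C| + E); split; first exact: addr_ge0.
move=> s t sL ta; rewrite -(subrK (h s t) (f s t)) -addrA.
apply: le_trans (ler_normD _ _) _; rewrite [leRHS]mulrDl lerD//; last exact: H.
by apply: le_trans (fh s t sL ta) _; rewrite ler_wpM2r ?exprn_ge0// ler_norm.
Qed.

Lemma expands_ext f h N : expands w h N ->
  (forall s t, 0 <= s < L -> 0 < `|t| <= a -> f s t = h s t) -> expands w f N.
Proof.
move=> eh fh; apply: (@expands_near _ _ _ 0 eh) => s t sL ta.
by rewrite fh// subrr normr0 mul0r.
Qed.

Lemma expands_poly p N : coef_bounded p -> expands w (fun s t => (p s).[w s t]) N.
Proof.
move=> cp; exists p; split => //; exists 0; split => // s t _ _.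
by rewrite subrr normr0 mul0r.
Qed.

Lemma expands_coef (c : R -> R) C N : measurable_fun `[0, L[ c ->
  (forall s, 0 <= s < L -> `|c s| <= C) -> expands w (fun s t => c s) N.
Proof.
move=> mc bc; apply: expands_ext (expands_poly N (coef_boundedC mc bc)) _.
by move=> s t _ _; rewrite hornerC.
Qed.

Lemma expands_cst (c : R) N : expands w (fun _ _ => c) N.
Proof. by apply: (@expands_coef _ `|c|) => //; exact: measurable_cst. Qed.

Lemma expandsD f h N : expands w f N -> expands w h N ->
  expands w (fun s t => f s t + h s t) N.
Proof.
move=> [p [cp [C [C0 H]]]] [q [cq [E [E0 G]]]].
exists (fun s => p s + q s); split; first exact: coef_boundedD.
exists (C + E); split; first exact: addr_ge0.
move=> s t sL ta; rewrite hornerD.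
rewrite (_ : _ - _ = (f s t - (p s).[w s t]) + (h s t - (q s).[w s t])); last by ring.
by apply: le_trans (ler_normD _ _) _; rewrite [leRHS]mulrDl lerD ?H ?G.
Qed.

Lemma expandsM f h N : expands w f N -> expands w h N ->
  expands w (fun s t => f s t * h s t) N.
Proof.
move=> ef eh; have [B [B0 HB]] := expands_bounded eh.
case: ef => [p [cp [C [C0 H]]]]; case: eh => [q [cq [E [E0 G]]]].
have [A [A0 HA]] := horner_coef_bounded W cp.
exists (fun s => p s * q s); split; first exact: coef_boundedM.
exists (C * B + A * E); split; first by rewrite addr_ge0 ?mulr_ge0.
move=> s t sL ta; rewrite hornerM.
rewrite (_ : _ - _ = (f s t - (p s).[w s t]) * h s t +
  (p s).[w s t] * (h s t - (q s).[w s t])); last by ring.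
apply: le_trans (ler_normD _ _) _; rewrite [leRHS]mulrDl !normrM; apply: lerD.
  by rewrite mulrAC; apply: ler_pM => //; [exact: H|exact: HB].
rewrite -mulrA; apply: ler_pM => //; last exact: G.
by apply: HA => //; exact: wW.
Qed.

Lemma expandsX f (n : nat) N : expands w f N -> expands w (fun s t => f s t ^+ n) N.
Proof.
move=> ef; elim: n => [|n IH].
  by under eq_fun do under eq_fun do rewrite expr0; exact: expands_cst.
by under eq_fun do under eq_fun do rewrite exprS; exact: expandsM.
Qed.

Lemma expands_sum (n : nat) (F : 'I_n -> R -> R -> R) N :
  (forall i, expands w (F i) N) -> expands w (fun s t => \sum_(i < n) F i s t) N.
Proof.
elim: n F => [|n IH] F eF.
  by under eq_fun do under eq_fun do rewrite big_ord0; exact: expands_cst.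
by under eq_fun do under eq_fun do rewrite big_ord_recr; apply: expandsD => //; exact: IH.
Qed.

(** The gain of one order drives the induction in [expands_inverse]. *)
Lemma expands_mulw f N : expands w f N -> expands w (fun s t => w s t * f s t) N.+1.
Proof.
move=> [p [cp [C [C0 H]]]]; exists (fun s => 'X * p s); split.
  by apply: coef_boundedM => //; exact: coef_boundedX.
exists C; split => // s t sL ta; rewrite hornerM hornerX -mulrBr normrM exprS mulrCA.
by rewrite ler_wpM2l// H.
Qed.

(** Change of variable: t is replaced by its expansion in w inside the polynomial, and |t| <= B |w|
    converts O(t^N) into O(w^N). *)
Lemma expands_comp f B N : expands (fun _ t => t) f N -> expands w (fun _ t => t) N ->
  (forall s t, 0 <= s < L -> 0 < `|t| <= a -> `|t| <= B * `|w s t|) ->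
  expands w f N.
Proof.
move=> [p [[n [A [A0 [sp [bp mp]]]]] [C [C0 H]]]] et tB.
apply: (@expands_near _ (fun s t => (p s).[t]) _ (C * `|B| ^+ N)); last first.
  move=> s t sL ta; apply: le_trans (H s t sL ta) _.
  rewrite -mulrA -exprMn ler_wpM2l// lerXn2r ?nnegrE ?mulr_ge0//.
  by apply: le_trans (tB s t sL ta) _; rewrite ler_wpM2r// ler_norm.
apply: (@expands_ext _ (fun s t => \sum_(i < n) (p s)`_i * t ^+ i)); last first.
  by move=> s t _ _; rewrite (horner_coef_wide _ (sp s)).
apply: (@expands_sum n (fun (i : 'I_n) s t => (p s)`_i * t ^+ i)) => i.
apply: expandsM; last exact: expandsX.
by apply: (@expands_coef _ A) => // s; exact: bp.
Qed.

End Closure.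

Hypothesis a0 : 0 < a.

Let tW (s t : R) : 0 <= s < L -> 0 < `|t| <= a -> `|t| <= a.
Proof. by move=> _ /andP[]. Qed.

(* Newton's iteration for q = h^(-1/2): the error q - r is multiplied by
   1 - h (q + r) / 2 = O(t) when r is replaced by r + (1 - h r^2) / 2. *)
Lemma expands_inv_sqrt (h q : R -> R -> R) C :
  (forall N, expands (fun _ t => t) h N) ->
  (forall s t, 0 <= s < L -> 0 < `|t| <= a -> q s t ^+ 2 * h s t = 1) ->
  (forall s t, 0 <= s < L -> 0 < `|t| <= a -> `|h s t - 1| <= C * `|t|) ->
  (forall s t, 0 <= s < L -> 0 < `|t| <= a -> `|q s t - 1| <= C * `|t|) ->
  forall N, expands (fun _ t => t) q N.+1.
Proof.
move=> eh qh h1 q1; elim=> [|N [p [cp [E [E0 H]]]]].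
  apply: (@expands_near _ _ (fun _ _ => 1) _ C); first exact: expands_cst.
  by move=> s t sL ta; rewrite expr1 q1.
have [B [B0 HB]] := expands_bounded tW (eh 0%N).
pose r s t := (p s).[t].
have er K : expands (fun _ t => t) r K by exact: (expands_poly (fun _ t => t)).
apply: (@expands_near _ _ (fun s t => r s t + 2^-1 * (1 + (-1) * (h s t * r s t ^+ 2))) _
  (E * (C + B * C + B * (E * a ^+ N)))).
  apply: expandsD => //; apply: (expandsM tW); first exact: expands_cst.
  apply: expandsD; first exact: expands_cst.
  apply: (expandsM tW); first exact: expands_cst.
  by apply: (expandsM tW) => //; exact: (expandsX tW).
move=> s t sL ta; have t0 : 0 <= `|t| by [].
have /andP[_ tle] := ta.
(* The second factor is 1 - h (q + r) / 2, rearranged so that each summand is visibly O(t). *)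
have -> : q s t - (r s t + 2^-1 * (1 + (-1) * (h s t * r s t ^+ 2))) =
    (q s t - r s t) * ((1 - h s t) - h s t * (q s t - 1) + 2^-1 * (h s t * (q s t - r s t))).
  rewrite [X in 2^-1 * (X + _)](esym (qh s t sL ta)); by field.
rewrite normrM exprS [leRHS](_ : _ = (E * `|t| ^+ N.+1) *
  ((C + B * C + B * (E * a ^+ N)) * `|t|)); last by rewrite !exprS; ring.
have Hr : `|q s t - r s t| <= E * `|t| ^+ N.+1 by exact: H.
have hB : `|h s t| <= B by exact: HB.
apply: ler_pM => //.
apply: le_trans (ler_normD _ _) _; rewrite [leRHS]mulrDl; apply: lerD.
  apply: le_trans (ler_normB _ _) _; rewrite [leRHS]mulrDl; apply: lerD.
    by rewrite distrC h1.
  by rewrite normrM -mulrA ler_pM// q1.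
rewrite !normrM.
have i2 : `|2^-1 : R| <= 1 by rewrite ger0_norm//; lra.
apply: (@le_trans _ _ (1 * (B * (E * `|t| ^+ N.+1)))).
  by rewrite ler_pM ?mulr_ge0// ler_pM.
rewrite mul1r -mulrA ler_wpM2l// -mulrA ler_wpM2l// exprSr ler_wpM2r//.
by rewrite lerXn2r ?nnegrE// ltW.
Qed.

(** Bootstrapping of the implicit equation t = w q(s, t): an expansion of t in w to order N gives
    one of q to order N, hence one of t = w q to order N + 1. *)
Lemma expands_inverse w W (q : R -> R -> R) B :
  (forall s t, 0 <= s < L -> 0 < `|t| <= a -> `|w s t| <= W) ->
  (forall s t, 0 <= s < L -> 0 < `|t| <= a -> t = w s t * q s t) ->
  (forall s t, 0 <= s < L -> 0 < `|t| <= a -> `|t| <= B * `|w s t|) ->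
  (forall N, expands (fun _ t => t) q N) ->
  forall N, expands w (fun _ t => t) N.
Proof.
move=> wW tq tB eq; elim=> [|N IH].
  apply: (@expands_near _ _ (fun _ _ => 0) _ a); first exact: expands_cst.
  by move=> s t sL /andP[_ ta]; rewrite subr0 expr0 mulr1.
apply: (expands_ext (expands_mulw (expands_comp wW (eq N) IH tB))) => s t sL ta.
exact: tq.
Qed.

End UniformExpansions.

(** * Taylor expansions, uniform in the base point *)

Section SmoothFunctions.
Variable R : realType.
Implicit Types (f : R -> R) (s t x : R).

Lemma smooth_is_derive f n x : smooth_fun f ->
  is_derive x 1 (derive1n n f) (derive1n n.+1 f x).
Proof. by move=> sf; split; [exact: sf|rewrite derive1nS derive1E]. Qed.

Lemma smooth_is_derive1 f x : smooth_fun f -> is_derive x 1 f (derive1 f x).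
Proof. by move=> sf; exact: (smooth_is_derive 0 x sf). Qed.

Lemma smooth_derive1 f : smooth_fun f -> smooth_fun (derive1 f).
Proof. by move=> sf n x; rewrite -derive1Sn; exact: sf. Qed.

Lemma smooth_continuous f : smooth_fun f -> continuous f.
Proof. by move=> sf x; exact: is_derive_continuous (smooth_is_derive1 x sf). Qed.

Lemma derive1_periodic f L : smooth_fun f -> (forall x, f (x + L) = f x) ->
  forall x, derive1 f (x + L) = derive1 f x.
Proof.
move=> sf pf x.
have d1 : is_derive x 1 (fun y => y + L) 1.
  have := @is_deriveD _ _ _ (@id R) (cst L) x 1 1 0 (is_derive_id _ _) (is_derive_cst _ _ _).
  by move/is_derive_eq; apply; rewrite addr0.
have := @is_derive1_comp _ f (fun y => y + L) x _ _ (smooth_is_derive1 (x + L) sf) d1.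
rewrite (_ : f \o _ = f); last by apply/funext => y /=.
by rewrite scale1r || rewrite mulr1; move=> [_ h]; rewrite -h derive1E.
Qed.

Definition taylor_poly (N : nat) f s : {poly R} :=
  \poly_(k < N) (derive1n k f s / k`!%:R).

Lemma deriv_taylor_poly N f s :
  (taylor_poly N.+1 f s)^`() = taylor_poly N (derive1 f) s.
Proof.
apply/polyP => k; rewrite coef_deriv !coef_poly ltnS; case: ifP => _; last by rewrite mul0rn.
have X0 : k.+1%:R != 0 :> R by rewrite pnatr_eq0.
have F0 : k`!%:R != 0 :> R by rewrite pnatr_eq0 -lt0n fact_gt0.
rewrite -derive1Sn factS natrM -[LHS]mulr_natr.
move: (k.+1%:R) (k`!%:R) X0 F0 => X Y X0 F0.
by field; rewrite X0 F0.
Qed.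

(** Induction on N through the derivative: the mean value theorem multiplies the bound for f' by |t|
    and keeps the same constant. *)
Lemma taylor_poly_bound N f A B : smooth_fun f -> exists C, 0 <= C /\
  forall s t, A <= s <= B -> A <= s + t <= B ->
  `|f (s + t) - (taylor_poly N f s).[t]| <= C * `|t| ^+ N.
Proof.
elim: N f => [|N IH] f sf.
  have [C HC] := @continuous_at_bounded R f A B (fun x _ => smooth_continuous sf (x:=x)).
  exists `|C|; split => // s t _ st.
  rewrite /taylor_poly poly_def big_ord0 horner0 subr0 expr0 mulr1.
  by apply: le_trans (HC _ st) _; exact: ler_norm.
have [C [C0 HC]] := IH _ (smooth_derive1 sf).
exists C; split => // s t sAB stAB.
have d x : is_derive x 1 (fun x => f (s + x) - (taylor_poly N.+1 f s).[x])
    (derive1 f (s + x) - (taylor_poly N (derive1 f) s).[x]).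
  have d1 : is_derive x 1 (fun y => s + y) 1.
    have := @is_deriveD _ _ _ (cst s) (@id R) x 1 0 1 (is_derive_cst _ _ _) (is_derive_id _ _).
    by move/is_derive_eq; apply; rewrite add0r.
  have h := @is_derive1_comp _ f (fun y => s + y) x _ _ (smooth_is_derive1 (s + x) sf) d1.
  rewrite -deriv_taylor_poly.
  have := is_deriveB h (is_derive_poly (taylor_poly N.+1 f s) x).
  by move/is_derive_eq; apply; rewrite ?scale1r ?mulr1.
have [c cb E] := @MVT_between R _ _ 0 t (fun z _ => d z).
have t0 : (taylor_poly N.+1 f s).[0] = f s.
  by rewrite horner_coef0 coef_poly /= divr1.
move: E; rewrite addr0 t0 subrr !subr0 => ->; rewrite normrM exprSr mulrA ler_wpM2r//.
have := normr_between cb; rewrite !subr0 => ct.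
apply: le_trans (HC s c sAB _) _.
  have /andP[c1 c2] := cb; have /andP[s1 s2] := sAB; have /andP[s3 s4] := stAB.
  by case: (leP 0 t) c1 c2 => t0' c1 c2; apply/andP; split; lra.
by rewrite ler_wpM2l// lerXn2r ?nnegrE.
Qed.

Lemma coef_bounded_taylor L N f : smooth_fun f -> coef_bounded L (taylor_poly N f).
Proof.
move=> sf.
have H k : exists C, 0 <= C /\ forall s, 0 <= s < L -> `|derive1n k f s / k`!%:R| <= C.
  have ck : continuous (derive1n k f).
    by move=> x; exact: is_derive_continuous (smooth_is_derive k x sf).
  have [C HC] := @continuous_at_bounded R _ 0 L (fun x _ => ck x).
  exists (`|C| / k`!%:R); split; first by rewrite divr_ge0.
  move=> s /andP[s0 sL]; rewrite normrM normfV normr_nat ler_wpM2r ?invr_ge0//.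
  by apply: le_trans (HC s _) (ler_norm _); rewrite s0 ltW.
have {H}[C HC] := choice H.
exists N, (\sum_(k < N) C k); split; first by rewrite sumr_ge0// => k _; case: (HC k).
split; first by move=> s; exact: size_poly.
split => [k s sL|k].
  rewrite coef_poly; case: ifP => kN; last first.
    by rewrite normr0 sumr_ge0// => j _; case: (HC j).
  rewrite (bigD1 (Ordinal kN)) //=; apply: le_trans (_ : C k <= _).
    by case: (HC k) => _; apply.
  by rewrite lerDl sumr_ge0// => j _; case: (HC j).
apply: (eq_measurable_fun (fun s => if (k < N)%N then derive1n k f s / k`!%:R else 0)).
  by move=> s _; rewrite coef_poly.
case: (k < N)%N; last exact: measurable_cst.
apply: measurable_funTS; apply: measurable_funM; last exact: measurable_cst.
apply: continuous_measurable_fun => x.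
exact: is_derive_continuous (smooth_is_derive k x sf).
Qed.

Section Expansions.
Variables (L a : R) (f : R -> R).
Hypotheses (a1 : a <= 1) (sf : smooth_fun f).

(** Since a <= 1, all points lie in the compact interval [-1, L + 1], on which the Taylor constant
    is uniform. *)
Let box (s t : R) : 0 <= s < L -> 0 < `|t| <= a ->
  (- 1 <= s <= L + 1) /\ (-1 <= s + t <= L + 1).
Proof.
move=> /andP[s0 sL] /andP[_]; rewrite ler_norml => /andP[h1 h2].
have a1' : 0 <= 1 - a by rewrite subr_ge0.
by split; apply/andP; split; lra.
Qed.

Lemma expands_smooth N : expands L a (fun _ t => t) (fun s t => f (s + t)) N.
Proof.
have [C [C0 HC]] := taylor_poly_bound N (-1) (L + 1) sf.
exists (taylor_poly N f); split; first exact: coef_bounded_taylor.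
by exists C; split => // s t sL ta; have [b1 b2] := box sL ta; exact: HC.
Qed.

Lemma expands_difference_quotient N :
  expands L a (fun _ t => t) (fun s t => (f (s + t) - f s) / t) N.
Proof.
have [C [C0 HC]] := taylor_poly_bound N.+1 (-1) (L + 1) sf.
(* The Taylor polynomial without its constant term, divided by X. One extra order is taken because
   division by t loses one. *)
pose q s := \poly_(k < N) (taylor_poly N.+1 f s)`_k.+1.
have Eq s : taylor_poly N.+1 f s = (f s)%:P + 'X * q s.
  apply/polyP => -[|k]; rewrite coefD coefC coefXM /= ?addr0.
    by rewrite coef_poly /= divr1.
  by rewrite add0r [RHS]coef_poly; case: ltnP => // Nk; rewrite coef_poly ltnS ltnNge Nk.
exists q; split.
  have [n [B [B0 [sp [bp mp]]]]] := coef_bounded_taylor L N.+1 sf.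
  exists N, B; split => //; split; first by move=> s; exact: size_poly.
  split => [k s sL|k].
    by rewrite /q coef_poly; case: (k < N)%N; [exact: bp|rewrite normr0].
  apply: (eq_measurable_fun (fun s => if (k < N)%N then (taylor_poly N.+1 f s)`_k.+1 else 0)).
    by move=> s _ /=; rewrite /q [RHS]coef_poly.
  by case: (k < N)%N; [exact: mp|exact: measurable_cst].
exists C; split => // s t sL ta; have [b1 b2] := box sL ta.
have t0 : t != 0 by rewrite -normr_gt0; case/andP: ta.
have := HC s t b1 b2; rewrite Eq hornerD hornerC hornerM hornerX => h.
rewrite (_ : _ - _ = (f (s + t) - (f s + t * (q s).[t])) / t); last by field.
by rewrite normrM normfV ler_pdivrMr ?normr_gt0// -mulrA -exprSr.
Qed.

End Expansions.
End SmoothFunctions.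

(** * The chord of a closed curve *)

Section Space.
Variable R : realType.
Implicit Types (u v : 'I_3 -> R).

Lemma cauchy_schwarz3 u v :
  (\sum_(i < 3) u i * v i) ^+ 2 <= (\sum_(i < 3) u i ^+ 2) * (\sum_(i < 3) v i ^+ 2).
Proof.
rewrite !big_ord_recr !big_ord0 /= !add0r.
move: (u _) (u _) (u _) (v _) (v _) (v _) => a b c x y z.
(* Lagrange's identity. *)
rewrite -subr_ge0 (_ : _ - _ = (a * y - b * x) ^+ 2 + (a * z - c * x) ^+ 2 +
  (b * z - c * y) ^+ 2); last by ring.
by rewrite !addr_ge0 ?sqr_ge0.
Qed.

Lemma ler_norm_sum3 u (C : R) : (forall i, `|u i| <= C) ->
  `|\sum_(i < 3) u i| <= 3 * C.
Proof.
move=> uC; apply: le_trans (ler_norm_sum _ _ _) _.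
apply: le_trans (ler_sum _ (fun i _ => uC i)) _.
by rewrite sumr_const card_ord mulr_natl.
Qed.

End Space.

Section CurveFormulas.
Variables (R : realType) (L : R) (g : R -> 'rV[R]_3).
Hypothesis Hg : arclength_simple_closed_curve L g.

Notation pos := (coord3 g).
Notation spd := (fun i => derive1 (coord3 g i)).

Let L0 : 0 < L. Proof. by case: Hg. Qed.
Let sg i : smooth_fun (pos i). Proof. by case: Hg. Qed.

Lemma curve_periodic i s : pos i (s + L) = pos i s.
Proof. by case: Hg => _ _ pg _ _; rewrite /coord3 pg. Qed.

Lemma speed_periodic i s : spd i (s + L) = spd i s.
Proof. by apply: derive1_periodic => // x; exact: curve_periodic. Qed.

Lemma speed_unit s : \sum_(i < 3) spd i s ^+ 2 = 1.
Proof.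
case: Hg => _ _ _ ug _; have /(congr1 (fun x => x ^+ 2)) := ug s.
rewrite /enorm3 sqr_sqrtr ?expr1n; last first.
  by rewrite /dot3 sumr_ge0// => i _; rewrite -expr2 sqr_ge0.
by rewrite /dot3 => <-; apply: eq_bigr => i _; rewrite /vel mxE expr2.
Qed.

Lemma speed_le1 i s : `|spd i s| <= 1.
Proof.
rewrite -(@ler_sqr R) ?nnegrE// expr1n real_normK ?num_real// -(speed_unit s).
by rewrite (bigD1 i)//= lerDl sumr_ge0// => j _; rewrite sqr_ge0.
Qed.

Definition sqdist p := \sum_(i < 3) (pos i p.2 - pos i p.1) ^+ 2.

Lemma sqdist_ge0 p : 0 <= sqdist p.
Proof. by rewrite sumr_ge0// => i _; rewrite sqr_ge0. Qed.

Lemma dist12E p : dist12 g p = Num.sqrt (sqdist p).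
Proof.
rewrite /dist12 /enorm3 /dot3; congr Num.sqrt; apply: eq_bigr => i _.
by rewrite !mxE /coord3; ring.
Qed.

Lemma dist12_ge0 p : 0 <= dist12 g p. Proof. by rewrite dist12E sqrtr_ge0. Qed.

Lemma sqr_dist12 p : dist12 g p ^+ 2 = sqdist p.
Proof. by rewrite dist12E sqr_sqrtr ?sqdist_ge0. Qed.

Lemma rhoNE p : rhoN g p = \sum_(i < 3) spd i p.1 * spd i p.2.
Proof. by rewrite /rhoN /dot3; apply: eq_bigr => i _; rewrite !mxE. Qed.

Lemma rhoWE p : rhoW g p = (dist12 g p)^-1 ^+ 2 *
  ((\sum_(i < 3) (pos i p.2 - pos i p.1) * spd i p.1) *
   (\sum_(i < 3) (pos i p.2 - pos i p.1) * spd i p.2)).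
Proof.
have E : enorm3 (g p.2 - g p.1) = dist12 g p.
  rewrite /dist12 /enorm3 /dot3; congr Num.sqrt; apply: eq_bigr => i _.
  by rewrite !mxE; ring.
rewrite /rhoW E /dot3; set c := (dist12 g p)^-1.
have F q : \sum_(i < 3) (c *: (g p.2 - g p.1)) ord0 i * vel g q ord0 i =
    c * \sum_(i < 3) (pos i p.2 - pos i p.1) * spd i q.
  by rewrite mulr_sumr; apply: eq_bigr => i _; rewrite !mxE /coord3; ring.
by rewrite !F; ring.
Qed.

Lemma normr_rhoN_le1 p : `|rhoN g p| <= 1.
Proof.
rewrite -(@ler_sqr R) ?nnegrE// expr1n real_normK ?num_real// rhoNE.
apply: le_trans (cauchy_schwarz3 _ _) _.
by rewrite !speed_unit mulr1.
Qed.

Lemma normr_rhoW_le1 p : `|rhoW g p| <= 1.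
Proof.
(* Where the distance vanishes, the inverse is 0 by convention and [rhoW] is 0. *)
rewrite rhoWE; have [->|d0] := eqVneq (dist12 g p) 0.
  by rewrite invr0 expr0n /= mul0r normr0.
have dp : 0 < dist12 g p by rewrite lt_neqAle eq_sym d0 dist12_ge0.
have H q : `|\sum_(i < 3) (pos i p.2 - pos i p.1) * spd i q| <= dist12 g p.
  rewrite -(@ler_sqr R) ?nnegrE ?dist12_ge0// real_normK ?num_real//.
  apply: le_trans (cauchy_schwarz3 _ _) _.
  by rewrite speed_unit mulr1 sqr_dist12.
rewrite normrM [`|_ ^+ 2|]ger0_norm ?sqr_ge0//.
apply: (@le_trans _ _ ((dist12 g p)^-1 ^+ 2 * (dist12 g p * dist12 g p))).
  by apply: ler_wpM2l; [exact: sqr_ge0|rewrite normrM; apply: ler_pM].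
by rewrite -expr2 -exprMn mulVf// expr1n.
Qed.

Lemma sqdist_periodic s t : sqdist (s, t + L) = sqdist (s, t).
Proof. by apply: eq_bigr => i _ /=; rewrite curve_periodic. Qed.

Lemma dist12_periodic s t : dist12 g (s, t + L) = dist12 g (s, t).
Proof. by rewrite !dist12E sqdist_periodic. Qed.

Lemma rhoN_periodic s t : rhoN g (s, t + L) = rhoN g (s, t).
Proof. by rewrite !rhoNE; apply: eq_bigr => i _ /=; rewrite speed_periodic. Qed.

Lemma rhoW_periodic s t : rhoW g (s, t + L) = rhoW g (s, t).
Proof.
rewrite !rhoWE dist12_periodic; congr (_ * (_ * _)); apply: eq_bigr => i _ /=;
by rewrite curve_periodic ?speed_periodic.
Qed.

(** Each coordinate varies by at most L, so the squared distance is at most 3 L^2 <= (2L)^2. This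
    crude value is the M of the Mellin part. *)
Lemma dist12_le p : torus L p -> dist12 g p <= 2 * L.
Proof.
move=> [/= /andP[p1 p1L] /andP[p2 p2L]].
have H i : (pos i p.2 - pos i p.1) ^+ 2 <= L ^+ 2.
  have [c _ ->] := @MVT_between R _ _ p.1 p.2 (fun z _ => smooth_is_derive1 z (@sg i)).
  rewrite -real_normK ?num_real// ler_sqr ?nnegrE ?(ltW L0)//.
  rewrite normrM -[leRHS]mul1r; apply: ler_pM => //; first exact: speed_le1.
  by rewrite ler_norml; apply/andP; split; lra.
rewrite -(@ler_sqr R) ?nnegrE ?dist12_ge0 ?mulr_ge0 ?(ltW L0)// sqr_dist12.
apply: (@le_trans _ _ (\sum_(i < 3) L ^+ 2)); first by apply: ler_sum => i _; exact: H.
rewrite sumr_const card_ord exprMn -[leLHS]mulr_natl; apply: ler_wpM2r; first exact: sqr_ge0.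
by rewrite expr2; lra.
Qed.

Lemma dist12_gt0 s t : 0 <= s < L -> 0 < t < L -> 0 < dist12 g (s, s + t).
Proof.
move=> /andP[s0 sL] /andP[t0 tL]; rewrite lt_neqAle dist12_ge0 andbT eq_sym.
apply/eqP => d0.
have E i : pos i (s + t) = pos i s.
  have : sqdist (s, s + t) = 0 by rewrite -sqr_dist12 d0 expr0n.
  rewrite /sqdist => /eqP; rewrite psumr_eq0; last by move=> j _; rewrite sqr_ge0.
  by move=> /allP /(_ i (mem_index_enum _)) /=; rewrite sqrf_eq0 subr_eq0 => /eqP.
have {}E : g (s + t) = g s by apply/rowP => i; exact: E.
case: Hg => _ _ pg _ inj.
have [stL|Lst] := ltP (s + t) L.
  have := inj (s + t) s; rewrite stL s0 sL E addr_ge0 ?(ltW t0)// => /(_ erefl erefl erefl).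
  lra.
have E2 : g (s + t - L) = g s by rewrite -E -{2}(subrK L (s + t)) pg.
have := inj (s + t - L) s; rewrite E2 s0 sL => h.
have : s + t - L = s by apply: h => //; apply/andP; split; lra.
lra.
Qed.


Let m1 (f : R -> R) : continuous f -> measurable_fun setT (fun p : R * R => f p.1).
Proof.
move=> cf; apply: (measurableT_comp (f := f)); last exact: measurable_fst.
exact: continuous_measurable_fun.
Qed.

Let m2 (f : R -> R) : continuous f -> measurable_fun setT (fun p : R * R => f p.2).
Proof.
move=> cf; apply: (measurableT_comp (f := f)); last exact: measurable_snd.
exact: continuous_measurable_fun.
Qed.

Let cpos i : continuous (pos i). Proof. exact: smooth_continuous. Qed.
Let cspd i : continuous (spd i).
Proof. by apply: smooth_continuous; exact: smooth_derive1. Qed.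

Let mpos i : measurable_fun setT (fun p : R * R => pos i p.2 - pos i p.1).
Proof. by apply: measurable_funB; [exact: m2|exact: m1]. Qed.

Lemma measurable_rhoN : measurable_fun setT (rhoN g).
Proof.
rewrite (_ : rhoN g = fun p => \sum_(i < 3) spd i p.1 * spd i p.2); last first.
  by apply/funext => p; exact: rhoNE.
apply: measurable_sum => i; apply: measurable_funM; first exact: (m1 (@cspd i)).
exact: (m2 (@cspd i)).
Qed.

Lemma measurable_sqdist : measurable_fun setT sqdist.
Proof. by apply: measurable_sum => i; apply: measurable_funX; exact: mpos. Qed.

Lemma measurable_dist12 : measurable_fun setT (dist12 g).
Proof.
rewrite (_ : dist12 g = Num.sqrt \o sqdist); last by apply/funext => p; exact: dist12E.
apply: measurableT_comp measurable_sqdist.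
by apply: continuous_measurable_fun; exact: sqrt_continuous.
Qed.

Lemma measurable_inv_dist12 : measurable_fun setT (fun p => (dist12 g p)^-1).
Proof.
rewrite (_ : (fun p => _) = fun p => dist12 g p `^ (-1)).
  by apply: (measurableT_comp (f := fun x : R => x `^ (-1))); [exact: measurable_powR|exact: measurable_dist12].
by apply/funext => p; rewrite powR_inv1 ?dist12_ge0.
Qed.

Lemma measurable_rhoW : measurable_fun setT (rhoW g).
Proof.
rewrite (_ : rhoW g = fun p => (dist12 g p)^-1 ^+ 2 *
  ((\sum_(i < 3) (pos i p.2 - pos i p.1) * spd i p.1) *
   (\sum_(i < 3) (pos i p.2 - pos i p.1) * spd i p.2))); last first.
  by apply/funext => p; exact: rhoWE.
apply: measurable_funM; first by apply: measurable_funX; exact: measurable_inv_dist12.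
apply: measurable_funM; apply: measurable_sum => i; apply: measurable_funM.
- exact: mpos.
- exact: (m1 (@cspd i)).
- exact: mpos.
- exact: (m2 (@cspd i)).
Qed.

(** The second derivatives are bounded on the compact interval; the sum of the three bounds serves
    every coordinate. *)
Lemma exists_speed_lipschitz : exists C, 0 <= C /\ forall i x y,
  -1 <= x <= L + 1 -> -1 <= y <= L + 1 -> `|spd i x - spd i y| <= C * `|x - y|.
Proof.
have H i : exists C, 0 <= C /\ forall x, -1 <= x <= L + 1 -> `|derive1n 2 (pos i) x| <= C.
  have c2 : continuous (derive1n 2 (pos i)).
    by move=> x; exact: is_derive_continuous (smooth_is_derive 2 x (@sg i)).
  have [C HC] := @continuous_at_bounded R _ (-1) (L + 1) (fun x _ => c2 x).
  by exists `|C|; split => // x /HC h; apply: le_trans h (ler_norm _).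
have {H}[C HC] := choice H.
exists (\sum_i C i); split; first by rewrite sumr_ge0// => i _; case: (HC i).
move=> i x y /andP[x1 x2] /andP[y1 y2].
have [c cb ->] := @MVT_between R _ _ y x (fun z _ => smooth_is_derive 1 z (@sg i)).
rewrite normrM ler_wpM2r//; have [Ci0 Ci] := HC i.
apply: (@le_trans _ _ (C i)).
  apply: Ci; move: cb => /andP[].
  rewrite ge_min le_max => /orP h1 /orP h2; apply/andP; split.
    by case: h1 => h; [exact: le_trans h|exact: le_trans h].
  by case: h2 => h; [exact: le_trans h _|exact: le_trans h _].
by rewrite (bigD1 i)//= lerDl sumr_ge0// => j _; case: (HC j).
Qed.

End CurveFormulas.

(** * Chords over short arcs *)

Section CurveLocal.
Variables (R : realType) (L : R) (g : R -> 'rV[R]_3).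
Hypothesis Hg : arclength_simple_closed_curve L g.
Variables (a C2 : R).

Notation pos := (coord3 g).
Notation spd := (fun i => derive1 (coord3 g i)).

Hypotheses (L0 : 0 < L) (a0 : 0 < a) (a1 : 0 <= 1 - a) (aL : 0 <= L - 2 * a).
(** [aC] keeps the dot products of velocities over arcs of length at most a within 1/2 of 1. *)
Hypotheses (C20 : 0 <= C2) (aC : 0 <= 2^-1 - 6 * C2 * a).
Hypothesis Hlip : forall i x y, -1 <= x <= L + 1 -> -1 <= y <= L + 1 ->
  `|spd i x - spd i y| <= C2 * `|x - y|.

Let sg i : smooth_fun (pos i). Proof. by case: Hg. Qed.

Let box (s x : R) : 0 <= s < L -> `|x - s| <= a -> -1 <= x <= L + 1.
Proof.
have a1' := a1; move=> /andP[s0 sL]; rewrite ler_norml => /andP[h1 h2].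
by apply/andP; split; lra.
Qed.

(** At x = y = s the sum is 1. Each of the 3 coordinates has 2 factors moving by at most C2 D,
    whence 6. The points depend on the coordinate because the mean value theorem is applied to each
    coordinate separately. *)
Lemma speed_dot_near s (x y : 'I_3 -> R) (D : R) : 0 <= s < L -> 0 <= D <= a ->
  (forall i, `|x i - s| <= D) -> (forall i, `|y i - s| <= D) ->
  `|\sum_(i < 3) spd i (x i) * spd i (y i) - 1| <= 6 * C2 * D.
Proof.
move=> sL /andP[D0 Da] xs ys.
have ss : -1 <= s <= L + 1 by apply: (box sL); rewrite subrr normr0 ltW.
rewrite -[X in `|_ - X|](speed_unit Hg s) -sumrB (_ : 6 * C2 * D = 3 * (2 * (C2 * D))); last by ring.
apply: ler_norm_sum3 => i.
rewrite (_ : _ - _ = (spd i (x i) - spd i s) * spd i (y i) +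
  spd i s * (spd i (y i) - spd i s)); last by ring.
have xi : -1 <= x i <= L + 1 by apply: (box sL); exact: le_trans (xs i) Da.
have yi : -1 <= y i <= L + 1 by apply: (box sL); exact: le_trans (ys i) Da.
have hx := le_trans (Hlip i xi ss) (ler_wpM2l C20 (xs i)).
have hy := le_trans (Hlip i yi ss) (ler_wpM2l C20 (ys i)).
have b1 := speed_le1 Hg i (y i); have b2 := speed_le1 Hg i s.
apply: le_trans (ler_normD _ _) _; rewrite mulr_natl mulr2n !normrM; apply: lerD.
  by rewrite -[leRHS]mulr1; apply: ler_pM.
by rewrite -[leRHS]mul1r; apply: ler_pM.
Qed.

Lemma curve_mean_value s (x y : R) : exists c : 'I_3 -> R, forall i,
  Num.min x y <= c i <= Num.max x y /\
  pos i (s + y) - pos i (s + x) = (y - x) * spd i (s + c i).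
Proof.
suff H i : exists c, Num.min x y <= c <= Num.max x y /\
    pos i (s + y) - pos i (s + x) = (y - x) * spd i (s + c).
  by have [c Hc] := choice H; exists c.
have d (z : R) : is_derive z 1 (fun z => pos i (s + z)) (spd i (s + z)).
  have d1 : is_derive z 1 (fun y => s + y) 1.
    have := @is_deriveD _ _ _ (cst s) (@id R) z 1 0 1 (is_derive_cst _ _ _) (is_derive_id _ _).
    by move/is_derive_eq; apply; rewrite add0r.
  have := @is_derive1_comp _ (pos i) (fun y => s + y) z _ _ (smooth_is_derive1 (s + z) (@sg i)) d1.
  by move/is_derive_eq; apply; rewrite ?scale1r ?mulr1.
have [c cb E] := @MVT_between R _ _ x y (fun z _ => d z).
by exists c; split => //; rewrite E mulrC.
Qed.

Let between_norm (x y c B : R) : `|x| <= B -> `|y| <= B ->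
  Num.min x y <= c <= Num.max x y -> `|c| <= B.
Proof.
rewrite !ler_norml ge_min le_max => /andP[x1 x2] /andP[y1 y2] /andP[/orP h1 /orP h2].
apply/andP; split.
  by case: h1 => h; [exact: le_trans h|exact: le_trans h].
by case: h2 => h; [exact: le_trans h _|exact: le_trans h _].
Qed.

Lemma curve_quotient s t : `|t| <= a -> exists c : 'I_3 -> R, forall i,
  `|c i - s| <= `|t| /\ pos i (s + t) - pos i s = t * spd i (c i).
Proof.
move=> ta; have [c Hc] := curve_mean_value s 0 t.
exists (fun i => s + c i) => i; have [cb E] := Hc i; split.
  by rewrite addrC addKr; apply: between_norm cb; rewrite ?normr0.
by rewrite addr0 subr0 in E.
Qed.

(** Coordinatewise difference of squares: the difference of the two chords is y - x times a
    velocity, the chords themselves are y and x times velocities, and dot products of nearby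
    velocities are at least 1/2. *)
Lemma sqdist_sub s x y : 0 <= s < L -> `|x| <= a -> `|y| <= a ->
  exists S1 S2, 2^-1 <= S1 /\ 2^-1 <= S2 /\
  sqdist g (s, s + y) - sqdist g (s, s + x) = (y - x) * (y * S1 + x * S2).
Proof.
move=> sL xa ya.
have [c Hc] := curve_mean_value s x y.
have [cx Hx] := curve_quotient s xa.
have [cy Hy] := curve_quotient s ya.
have aa : 0 <= a <= a by rewrite lexx ltW.
have cs i : `|s + c i - s| <= a.
  by rewrite addrC addKr; apply: (between_norm xa ya); case: (Hc i).
have S (z : 'I_3 -> R) : (forall i, `|z i - s| <= a) ->
    2^-1 <= \sum_(i < 3) spd i (s + c i) * spd i (z i).
  move=> zs; have := speed_dot_near sL aa cs zs.
  by have aC' := aC; rewrite ler_norml => /andP[h _]; lra.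
exists (\sum_(i < 3) spd i (s + c i) * spd i (cy i)), (\sum_(i < 3) spd i (s + c i) * spd i (cx i)).
split; first by apply: S => i; case: (Hy i) => h _; exact: le_trans ya.
split; first by apply: S => i; case: (Hx i) => h _; exact: le_trans xa.
rewrite -sumrB !mulr_sumr -big_split /= mulr_sumr; apply: eq_bigr => i _.
have [_ h1] := Hc i; have [_ h2] := Hx i; have [_ h3] := Hy i.
rewrite h2 h3; have E : y * spd i (cy i) - x * spd i (cx i) = (y - x) * spd i (s + c i).
  by rewrite -h1 -h2 -h3; ring.
rewrite subr_sqr E; ring.
Qed.

Lemma sqdist_increasing s x y : 0 <= s < L -> 0 <= x -> x < y -> y <= a ->
  sqdist g (s, s + x) < sqdist g (s, s + y) /\ sqdist g (s, s - x) < sqdist g (s, s - y).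
Proof.
move=> sL x0 xy ya; have y0 : 0 <= y by apply: le_trans x0 (ltW xy).
have xa : `|x| <= a by rewrite ger0_norm// (le_trans (ltW xy)).
have ya' : `|y| <= a by rewrite ger0_norm.
split; rewrite -subr_gt0.
  have [S1 [S2 [h1 [h2 ->]]]] := sqdist_sub sL xa ya'.
  rewrite mulr_gt0 ?subr_gt0//.
  have : 0 < y * S1 by rewrite mulr_gt0//; [exact: le_lt_trans xy|lra].
  have : 0 <= x * S2 by rewrite mulr_ge0//; lra.
  lra.
rewrite -normrN in xa; rewrite -normrN in ya'.
have [S1 [S2 [h1 [h2 ->]]]] := sqdist_sub sL xa ya'.
rewrite (_ : _ * _ = (y - x) * (y * S1 + x * S2)); last by ring.
rewrite mulr_gt0 ?subr_gt0//.
have : 0 < y * S1 by rewrite mulr_gt0//; [exact: le_lt_trans xy|lra].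
have : 0 <= x * S2 by rewrite mulr_ge0//; lra.
lra.
Qed.

(** The distance has a corner at t = 0, whereas difference quotients expand in powers of t; all
    kernels are therefore rewritten through these quotients. *)
Definition chord_quotient i s t := (pos i (s + t) - pos i s) / t.
Definition chord_ratio s t := \sum_(i < 3) chord_quotient i s t ^+ 2.
Definition chord_start s t := \sum_(i < 3) chord_quotient i s t * spd i s.
Definition chord_end s t := \sum_(i < 3) chord_quotient i s t * spd i (s + t).
Definition signed_dist s t := t * Num.sqrt (chord_ratio s t).
(** The factor q = t / sigma of the implicit equation t = sigma q. *)
Definition chord_scale s t := (Num.sqrt (chord_ratio s t))^-1.

Section Point.
Variables (s t : R).
Hypotheses (sL : 0 <= s < L) (ta : 0 < `|t| <= a).

Let t0 : t != 0. Proof. by rewrite -normr_gt0; case/andP: ta. Qed.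
Let tle : 0 <= `|t| <= a. Proof. by case/andP: ta => _ ->; rewrite normr_ge0. Qed.

Let quotientE : exists c : 'I_3 -> R, forall i,
  `|c i - s| <= `|t| /\ chord_quotient i s t = spd i (c i).
Proof.
have /andP[_ ta'] := tle; have [c Hc] := curve_quotient s ta'.
exists c => i; have [h E] := Hc i; split => //.
by rewrite /chord_quotient E mulrAC divff// mul1r.
Qed.

Lemma chord_ratio_near : `|chord_ratio s t - 1| <= 6 * C2 * `|t|.
Proof.
have [c Hc] := quotientE.
rewrite /chord_ratio (eq_bigr (fun i => spd i (c i) * spd i (c i))); last first.
  by move=> i _; case: (Hc i) => _ ->; rewrite expr2.
by apply: (speed_dot_near (s := s)) => // i; case: (Hc i).
Qed.

Lemma chord_start_near : `|chord_start s t - 1| <= 6 * C2 * `|t|.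
Proof.
have [c Hc] := quotientE.
rewrite /chord_start (eq_bigr (fun i => spd i (c i) * spd i s)); last first.
  by move=> i _; case: (Hc i) => _ ->.
apply: (speed_dot_near (s := s) (y := fun=> s)) => // i; first by case: (Hc i).
by rewrite subrr normr0.
Qed.

Lemma chord_end_near : `|chord_end s t - 1| <= 6 * C2 * `|t|.
Proof.
have [c Hc] := quotientE.
rewrite /chord_end (eq_bigr (fun i => spd i (c i) * spd i (s + t))); last first.
  by move=> i _; case: (Hc i) => _ ->.
apply: (speed_dot_near (s := s) (y := fun=> s + t)) => // i; first by case: (Hc i).
by rewrite addrC addKr.
Qed.

Lemma rhoN_near : `|rhoN g (s, s + t) - 1| <= 6 * C2 * `|t|.
Proof.
rewrite rhoNE; apply: (speed_dot_near (s := s) (x := fun=> s) (y := fun=> s + t)) => // i.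
  by rewrite subrr normr0.
by rewrite addrC addKr.
Qed.

Lemma chord_ratio_bounds : 2^-1 <= chord_ratio s t <= 2.
Proof.
have /andP[_ ta'] := tle; have := chord_ratio_near; rewrite ler_norml => /andP[h1 h2].
have aC' := aC; have h : 6 * C2 * `|t| <= 6 * C2 * a by rewrite ler_wpM2l// mulr_ge0.
by apply/andP; split; lra.
Qed.

Let r := Num.sqrt (chord_ratio s t).

Lemma sqrt_chord_ratio : [/\ r ^+ 2 = chord_ratio s t, 2^-1 <= r, r <= 2 &
  `|r - 1| <= 6 * C2 * `|t|].
Proof.
have /andP[h1 h2] := chord_ratio_bounds; have hn := chord_ratio_near.
have r0 : 0 <= r by exact: sqrtr_ge0.
have r2 : r ^+ 2 = chord_ratio s t by rewrite sqr_sqrtr//; lra.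
have rl : 2^-1 <= r by nra.
split => //; first by nra.
apply: le_trans hn; rewrite -r2 (_ : r ^+ 2 - 1 = (r - 1) * (r + 1)); last by ring.
rewrite normrM ler_peMr// ger0_norm; lra.
Qed.

Lemma dist12_chord : dist12 g (s, s + t) = `|t| * r.
Proof.
rewrite dist12E -sqrtr_sqr -sqrtrM ?sqr_ge0//; congr Num.sqrt.
rewrite /sqdist /chord_ratio mulr_sumr; apply: eq_bigr => i _ /=.
by rewrite /chord_quotient; field.
Qed.

Lemma normr_signed_dist : `|signed_dist s t| = dist12 g (s, s + t).
Proof. by rewrite dist12_chord normrM (ger0_norm (sqrtr_ge0 _)). Qed.

Lemma chord_scale_sqr : chord_scale s t ^+ 2 * chord_ratio s t = 1.
Proof.
have [r2 rl _ _] := sqrt_chord_ratio.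
rewrite /chord_scale -/r -r2 -exprMn mulVf ?expr1n// gt_eqF//; lra.
Qed.

Lemma chord_scale_near : `|chord_scale s t - 1| <= 12 * C2 * `|t|.
Proof.
have [r2 rl _ hn] := sqrt_chord_ratio.
have r0 : 0 < r by lra.
rewrite /chord_scale -/r (_ : r^-1 - 1 = - ((r - 1) / r)); last by field; rewrite gt_eqF.
rewrite normrN normrM normfV (gtr0_norm r0) ler_pdivrMr//.
apply: le_trans hn _.
rewrite (_ : 12 * C2 * `|t| * r = (6 * C2 * `|t|) * (2 * r)); last by ring.
rewrite ler_peMr// ?mulr_ge0//; lra.
Qed.

Lemma signed_dist_scale : t = signed_dist s t * chord_scale s t.
Proof.
have [r2 rl _ _] := sqrt_chord_ratio.
by rewrite /signed_dist /chord_scale -/r mulfK// gt_eqF//; lra.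
Qed.

Lemma normr_le_signed_dist : `|t| <= 2 * `|signed_dist s t|.
Proof.
have [r2 rl _ _] := sqrt_chord_ratio.
rewrite normr_signed_dist dist12_chord mulrCA ler_peMr//; lra.
Qed.

Lemma signed_dist_le : `|signed_dist s t| <= 2 * `|t|.
Proof.
have [r2 _ rl _] := sqrt_chord_ratio.
by rewrite normr_signed_dist dist12_chord mulrC ler_wpM2r.
Qed.

Lemma signed_dist_near : `|signed_dist s t - t| <= 6 * C2 * `|t| ^+ 2.
Proof.
have [_ _ _ hn] := sqrt_chord_ratio.
rewrite (_ : _ - _ = (r - 1) * t); last by rewrite /signed_dist -/r; ring.
by rewrite normrM expr2 mulrA ler_wpM2r.
Qed.

Lemma rhoW_chord : rhoW g (s, s + t) =
  chord_start s t * chord_end s t * chord_scale s t ^+ 2.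
Proof.
have [r2 rl _ _] := sqrt_chord_ratio.
have r0 : r != 0 by rewrite gt_eqF//; lra.
rewrite rhoWE dist12_chord /=.
have E (f : 'I_3 -> R) : \sum_(i < 3) (pos i (s + t) - pos i s) * f i =
    t * \sum_(i < 3) chord_quotient i s t * f i.
  rewrite mulr_sumr; apply: eq_bigr => i _; rewrite /chord_quotient; field.
  exact: t0.
rewrite !E -/(chord_start s t) -/(chord_end s t) /chord_scale -/r invfM exprMn.
rewrite -normfV real_normK ?num_real//.
by field; rewrite r0 t0.
Qed.

Lemma rhoW_near : `|rhoW g (s, s + t) - 1| <= 96 * C2 * `|t|.
Proof.
have /andP[tp ta'] := ta.
have [r2 rl rl' hn] := sqrt_chord_ratio; have r0 : 0 < r by lra.
have ca : 6 * C2 * `|t| <= 2^-1.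
  apply: (@le_trans _ _ (6 * C2 * a)); last by have aC' := aC; lra.
  by rewrite ler_wpM2l// mulr_ge0.
have X0 : 0 <= 6 * C2 * `|t| by rewrite !mulr_ge0.
have hs := chord_start_near; have he := chord_end_near; have hr := chord_ratio_near.
have /andP[hb _] := chord_ratio_bounds.
rewrite rhoW_chord.
have q2 : chord_scale s t ^+ 2 = (chord_ratio s t)^-1.
  by rewrite /chord_scale exprVn -/r r2.
(* With X = 6 C2 |t|, rhoW - 1 = (A B - h) / h has numerator at most 4X, because |B| <= 2, and h >=
   1/2. This gives 8X, and 16X is a generous bound. *)
rewrite q2 (_ : 96 * C2 * `|t| = 16 * (6 * C2 * `|t|)); last by ring.
move: (6 * C2 * `|t|) ca X0 hs he hr => X ca X0 hs he hr.
move: (chord_start s t) (chord_end s t) (chord_ratio s t) hs he hr hb => A B h hs he hr hb.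
have h0 : 0 < h by lra.
rewrite (_ : _ - 1 = ((A - 1) * B + (B - 1) + (1 - h)) / h); last by field; rewrite gt_eqF.
rewrite normrM normfV (gtr0_norm h0) ler_pdivrMr//.
have B2 : `|B| <= 2.
  rewrite -(subrK 1 B); apply: le_trans (ler_normD _ _) _; rewrite normr1; lra.
have : `|(A - 1) * B + (B - 1) + (1 - h)| <= X * 2 + X + X.
  apply: le_trans (ler_normD _ _) _; apply: lerD; last by rewrite distrC.
  apply: le_trans (ler_normD _ _) _; apply: lerD => //.
  by rewrite normrM; apply: ler_pM.
have : 16 * X * 2^-1 <= 16 * X * h by rewrite ler_wpM2l// mulr_ge0.
lra.
Qed.

End Point.

Let tW (s t : R) : 0 <= s < L -> 0 < `|t| <= a -> `|t| <= a.
Proof. by move=> _ /andP[]. Qed.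

Let a1' : a <= 1. Proof. by rewrite -subr_ge0. Qed.

Let expands_speed i N : expands L a (fun _ t => t) (fun s t => spd i (s + t)) N.
Proof. by apply: expands_smooth => //; apply: smooth_derive1; exact: sg. Qed.

Let expands_speed0 i N : expands L a (fun _ t => t) (fun s t => spd i s) N.
Proof.
apply: (@expands_coef _ _ _ _ _ 1) => [|s _]; last exact: (speed_le1 Hg).
apply: measurable_funTS; apply: continuous_measurable_fun.
by apply: smooth_continuous; apply: smooth_derive1; exact: sg.
Qed.

Let expands_quotient i N : expands L a (fun _ t => t) (chord_quotient i) N.
Proof. by apply: expands_difference_quotient => //; exact: sg. Qed.

Lemma expands_chord_ratio N : expands L a (fun _ t => t) chord_ratio N.
Proof.
apply: (@expands_sum _ _ _ _ 3 (fun i s t => chord_quotient i s t ^+ 2)) => i.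
exact: (expandsX tW).
Qed.

Lemma expands_chord_scale N : expands L a (fun _ t => t) chord_scale N.
Proof.
(* Newton's iteration yields the positive orders only; order 0 follows directly from the estimate of
   q - 1. *)
case: N => [|N]; last first.
  apply: (@expands_inv_sqrt _ L a a0 chord_ratio _ (12 * C2)).
  - exact: expands_chord_ratio.
  - exact: chord_scale_sqr.
  - move=> s t sL ta; apply: le_trans (chord_ratio_near sL ta) _.
    by have C20' := C20; rewrite ler_wpM2r// ler_wpM2r//; lra.
  - exact: chord_scale_near.
apply: (@expands_near _ _ _ _ _ (fun _ _ => 1) _ (12 * C2 * a)); first exact: expands_cst.
move=> s t sL ta; rewrite expr0 mulr1; apply: le_trans (chord_scale_near sL ta) _.
by case/andP: ta => _ ta; rewrite ler_wpM2l// mulr_ge0.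
Qed.

Lemma expands_rhoN N : expands L a (fun _ t => t) (fun s t => rhoN g (s, s + t)) N.
Proof.
apply: (@expands_ext _ _ _ _ _ (fun s t => \sum_(i < 3) spd i s * spd i (s + t))).
  apply: (@expands_sum _ _ _ _ 3 (fun i s t => spd i s * spd i (s + t))) => i.
  exact: (expandsM tW).
by move=> s t _ _; rewrite rhoNE.
Qed.

Lemma expands_rhoW N : expands L a (fun _ t => t) (fun s t => rhoW g (s, s + t)) N.
Proof.
apply: (@expands_ext _ _ _ _ _
  (fun s t => chord_start s t * chord_end s t * chord_scale s t ^+ 2)).
  apply: (expandsM tW); last by apply: (expandsX tW); exact: expands_chord_scale.
  apply: (expandsM tW).
    apply: (@expands_sum _ _ _ _ 3 (fun i s t => chord_quotient i s t * spd i s)) => i.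
    exact: (expandsM tW).
  apply: (@expands_sum _ _ _ _ 3 (fun i s t => chord_quotient i s t * spd i (s + t))) => i.
  exact: (expandsM tW).
exact: rhoW_chord.
Qed.

Lemma expands_signed_dist N : expands L a signed_dist (fun _ t => t) N.
Proof.
apply: (@expands_inverse _ L a signed_dist (2 * a) chord_scale 2).
- move=> s t sL ta; apply: le_trans (signed_dist_le sL ta) _.
  by case/andP: ta => _ ta; rewrite ler_wpM2l.
- exact: signed_dist_scale.
- exact: normr_le_signed_dist.
- exact: expands_chord_scale.
Qed.

End CurveLocal.

Lemma continuous_ord_sum (T : topologicalType) (R : realType) (n : nat)
  (F : 'I_n -> T -> R) (x : T) : (forall i, {for x, continuous (F i)}) ->
  {for x, continuous (fun p => \sum_(i < n) F i p)}.
Proof.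
elim: n F => [|n IH] F cF.
  rewrite (_ : (fun p => _) = cst 0); first exact: cvg_cst.
  by apply/funext => p; rewrite big_ord0.
rewrite (_ : (fun p => _) =
  (fun p => \sum_(i < n) F (widen_ord (leqnSn n) i) p + F ord_max p)).
  by apply: cvgD; [exact: IH|exact: cF].
by apply/funext => p; rewrite big_ord_recr.
Qed.

(** * Sublevel sets of the distance to a point of the curve *)

Section CurveArcs.
Variables (R : realType) (L : R) (g : R -> 'rV[R]_3).
Hypothesis Hg : arclength_simple_closed_curve L g.
Variables (a C2 : R).
Notation leb := (@lebesgue_measure R).
Notation pos := (coord3 g).
Notation spd := (fun i => derive1 (coord3 g i)).
Notation dist := (dist12 g).

Hypotheses (L0 : 0 < L) (a0 : 0 < a) (a1 : 0 <= 1 - a) (aL : 0 <= L - 2 * a).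
Hypotheses (C20 : 0 <= C2) (aC : 0 <= 2^-1 - 6 * C2 * a).
Hypothesis Hlip : forall i x y, -1 <= x <= L + 1 -> -1 <= y <= L + 1 ->
  `|spd i x - spd i y| <= C2 * `|x - y|.

Let sg i : smooth_fun (pos i). Proof. by case: Hg. Qed.

Lemma continuous_sqdist_shift : continuous (fun p : R * R => sqdist g (p.1, p.1 + p.2)).
Proof.
move=> p; apply: (@continuous_ord_sum _ R 3
  (fun i (p : R * R) => (pos i (p.1 + p.2) - pos i p.1) ^+ 2)) => i.
have cp := smooth_continuous (@sg i).
have h1 : {for p, continuous (fun p : R * R => pos i (p.1 + p.2))}.
  apply: (@continuous_comp _ _ _ (fun p : R * R => p.1 + p.2) (pos i)); last exact: cp.
  by apply: cvgD; [exact: cvg_fst|exact: cvg_snd].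
have h2 : {for p, continuous (fun p : R * R => pos i p.1)}.
  by apply: (@continuous_comp _ _ _ fst (pos i)); [exact: cvg_fst|exact: cp].
apply: (@continuous_comp _ _ _ (fun p : R * R => pos i (p.1 + p.2) - pos i p.1)
  (fun x => x ^+ 2)); first exact: cvgB.
exact: exprn_continuous.
Qed.

Lemma continuous_dist12_shift s : continuous (fun t => dist (s, s + t)).
Proof.
move=> t; rewrite (_ : (fun t => _) = Num.sqrt \o (fun t => sqdist g (s, s + t))); last first.
  by apply/funext => x; rewrite /= dist12E.
apply: continuous_comp; last exact: sqrt_continuous.
apply: (@continuous_ord_sum _ R 3 (fun i t => (pos i (s + t) - pos i s) ^+ 2)) => i.
have h1 : {for t, continuous (fun t => pos i (s + t))}.
  apply: (@continuous_comp _ _ _ (fun t => s + t) (pos i)).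
    by apply: cvgD; [exact: cvg_cst|exact: cvg_id].
  exact: (smooth_continuous (@sg i)).
apply: (@continuous_comp _ _ _ (fun t => pos i (s + t) - pos i s) (fun x => x ^+ 2)).
  by apply: cvgB => //; exact: cvg_cst.
exact: exprn_continuous.
Qed.

(** Simplicity of the curve makes the distance positive off the diagonal; compactness of [0, L] x
    [a, L - a] makes it uniformly so. *)
Lemma exists_chord_gap : exists D : R, 0 < D /\
  forall s t, 0 <= s < L -> a <= t <= L - a -> D <= dist (s, s + t).
Proof.
have aL' := aL; have a0' := a0; have L0' := L0.
have cK : compact (`[0, L]%classic `*` `[a, L - a]%classic : set (R * R)).
  by apply: compact_setX; exact: segment_compact.
have [||p pK pmin] := @compact_EVT_min _ R (fun p : R * R => sqdist g (p.1, p.1 + p.2)) _ _ cK.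
- exists (0, a); split; rewrite /= in_itv/= ?lexx ?(ltW L0)//.
  by apply/andP; split; lra.
- by apply: continuous_subspaceT; exact: continuous_sqdist_shift.
move: pK; rewrite inE => -[/=]; rewrite !in_itv/= => /andP[p0 pL] /andP[p1 p2].
have tL : 0 < p.2 < L by apply/andP; split; lra.
have d0 : 0 < sqdist g (p.1, p.1 + p.2).
  (* Compactness forces the closed end s = L into the domain; there the distance is the one at s = 0
     by periodicity. *)
  have [sL|Ls] := ltP p.1 L.
    rewrite -sqr_dist12 exprn_gt0//; apply: (dist12_gt0 Hg) => //.
    by rewrite p0.
  have E : p.1 = 0 + L by rewrite add0r; apply/eqP; rewrite eq_le pL Ls.
  have -> : sqdist g (p.1, p.1 + p.2) = sqdist g (0, 0 + p.2).
    apply: eq_bigr => i _ /=; rewrite {1}E addrAC !(curve_periodic Hg) {1}E.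
    by rewrite (curve_periodic Hg).
  rewrite -sqr_dist12 exprn_gt0//; apply: (dist12_gt0 Hg) => //.
  by rewrite lexx L0.
exists (Num.sqrt (sqdist g (p.1, p.1 + p.2))); split; first by rewrite sqrtr_gt0.
move=> s t /andP[s0 sL] /andP[t1 t2]; rewrite dist12E ler_wsqrtr//.
apply: (pmin (s, t)); rewrite inE /=; split; rewrite /= in_itv/=.
  by rewrite s0 ltW.
by rewrite t1.
Qed.

(** The distance increases strictly in |t| up to |t| = a and stays above the chord gap beyond. The
    intermediate value theorem gives one endpoint on each side. *)
Lemma sublevel_arc : exists u0 : R, 0 < u0 /\ forall s u, 0 <= s < L -> 0 < u <= u0 ->
  exists t1 t2, [/\ - a <= t1 < 0, 0 < t2 <= a, dist (s, s + t1) = u, dist (s, s + t2) = u &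
    forall t, t1 <= t < t1 + L -> (dist (s, s + t) <= u) = (t <= t2)].
Proof.
have [D [D0 HD]] := exists_chord_gap.
have aL' := aL; have a0' := a0; have L0' := L0.
exists (D / 2); split; first by rewrite divr_gt0.
move=> s u sL /andP[u0 uD].
have uD' : u < D by lra.
have d00 : dist (s, s) = 0.
  by rewrite dist12E /sqdist big1 ?sqrtr0// => i _ /=; rewrite subrr expr0n.
have da : D <= dist (s, s + a) by apply: HD => //; apply/andP; split; lra.
have dNa : D <= dist (s, s - a).
  rewrite -(dist12_periodic Hg s (s - a)) -addrA (addrC (- a)); apply: HD => //.
  by apply/andP; split; lra.
have IVTd (f : R -> R) : continuous f -> f 0 = 0 -> D <= f a -> exists2 c, 0 < c <= a & f c = u.
  move=> cf f0 fa.
  have [|||c ca fc] := @IVT R f 0 a u; first exact: ltW.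
  - exact: continuous_subspaceT.
  - rewrite f0 ge_min le_max (ltW u0) /=; apply/orP; right; lra.
  exists c => //; move: ca; rewrite in_itv/= => /andP[c0 ->]; rewrite andbT.
  rewrite lt_neqAle c0 andbT; apply/eqP => c0'.
  by move: fc; rewrite -c0' f0 => u0'; move: u0; rewrite -u0' ltxx.
have [t2 /andP[t20 t2a] d2] := IVTd (fun t => dist (s, s + t)) (@continuous_dist12_shift s)
  (etrans (congr1 (fun x => dist (s, x)) (addr0 s)) d00) da.
have cN : continuous (fun t => dist (s, s - t)).
  move=> t; apply: (@continuous_comp _ _ _ (fun t => - t) (fun t => dist (s, s + t))).
    exact: opp_continuous.
  exact: continuous_dist12_shift.
have [t1 /andP[t10 t1a] d1] := IVTd (fun t => dist (s, s - t)) cN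
  (etrans (congr1 (fun x => dist (s, x)) (subr0 s)) d00) dNa.
have mono x y : 0 <= x -> x < y -> y <= a ->
    dist (s, s + x) < dist (s, s + y) /\ dist (s, s - x) < dist (s, s - y).
  move=> x0 xy ya.
  have [h1 h2] := sqdist_increasing Hg a0 a1 C20 aC Hlip sL x0 xy ya.
  have sq p q : sqdist g p < sqdist g q -> dist p < dist q.
    by move=> h; rewrite -(@ltr_sqr R) ?nnegrE ?dist12_ge0// !sqr_dist12.
  by split; exact: sq.
exists (- t1), t2; split => //.
- by rewrite lerN2 t1a oppr_lt0.
- by rewrite t20.
move=> t /andP[tt1 ttL].
have [tt2|t2t] := leP t t2.
  have [t0|t0] := leP 0 t.
    move: tt2; rewrite le_eqVlt => /predU1P[->|tt2]; first by rewrite d2 lexx.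
    by have [h _] := mono t t2 t0 tt2 t2a; rewrite -d2 ltW.
  move: tt1; rewrite le_eqVlt => /predU1P[<-|tt1]; first by rewrite d1 lexx.
  have tN : 0 <= - t by rewrite oppr_ge0 ltW.
  have tNt1 : - t < t1 by rewrite ltrNl.
  by have [_ h] := mono (- t) t1 tN tNt1 t1a; rewrite opprK d1 in h; rewrite ltW.
apply/negbTE; rewrite -ltNge.
have [ta|at'] := leP t a.
  by have [h _] := mono t2 t (ltW t20) t2t ta; rewrite -d2.
have [tL|Lt] := leP t (L - a).
  by apply: lt_le_trans uD' _; apply: HD => //; rewrite tL (ltW at').
(* The end of the period wraps round to the left of s. The left endpoint is [- t1] here, and t1 < L
   - t <= a places the point beyond it. *)
have e : s + t = s - (L - t) + L by ring.
rewrite e (dist12_periodic Hg) -d1.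
have h1 : t1 < L - t by lra.
have h2 : L - t <= a by lra.
by have [_] := mono t1 (L - t) (ltW t10) h1 h2.
Qed.

(* The arc of parameters is based at [s + t1] rather than at [0]: the sublevel set
   of the distance to [g s] is then an initial segment of it. *)
Lemma Rintegral_section_shift (f : R * R -> R) C s t1 : measurable_fun setT f ->
  (forall p, `|f p| <= C) -> (forall x y, f (x, y + L) = f (x, y)) ->
  0 <= s < L -> - a <= t1 < 0 ->
  \int[leb]_(y in `[0, L[) f (s, y) = \int[leb]_(t in `[t1, t1 + L[) f (s, s + t).
Proof.
move=> mf bf pf /andP[s0 sL] /andP[t1a t10].
have aL' := aL; have a0' := a0; have L0' := L0.
have mfs : measurable_fun setT (fun y : R => f (s, y)).
  by apply: (measurableT_comp mf); exact: pair1_measurable.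
have bfs y : `|f (s, y)| <= C by exact: bf.
rewrite -(Rintegral_periodic mfs bfs (a := t1 + s) L0)//; last first.
  by rewrite ler_norml; apply/andP; split; lra.
rewrite addrAC -(Rintegral_translation mfs bfs).
by apply: eq_Rintegral => t _; rewrite addrC.
Qed.

End CurveArcs.

(** * Odd expansion of the sublevel integral of a curve *)

Section Antiderivative.
Variable R : realType.
Notation leb := (@lebesgue_measure R).
Implicit Types (p : {poly R}).

(* The constant coefficient is [p`_0 / 0 = 0]. *)
Definition antiderivative (n : nat) p := \poly_(k < n.+1) (p`_k.-1 / k%:R).

Lemma deriv_antiderivative n p : (size p <= n)%N -> (antiderivative n p)^`() = p.
Proof.
move=> sp; apply/polyP => k; rewrite coef_deriv coef_poly ltnS /=.
case: ltnP => kn; first by rewrite -[LHS]mulr_natr divfK// pnatr_eq0.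
by rewrite mul0rn nth_default// (leq_trans sp).
Qed.

Lemma coef_bounded_antiderivative L n (p : R -> {poly R}) :
  coef_bounded L p -> coef_bounded L (fun s => antiderivative n (p s)).
Proof.
move=> [m [C [C0 [sp [bp mp]]]]]; exists n.+1, C; split => //; split.
  by move=> s; exact: size_poly.
split => [k s sL|k].
  rewrite coef_poly; case: (k < n.+1)%N; last by rewrite normr0.
  case: k => [|k] /=; first by rewrite invr0 mulr0 normr0.
  rewrite normrM normfV normr_nat ler_pdivrMr ?ltr0n//.
  by apply: le_trans (bp k s sL) _; rewrite ler_peMr// ler1n.
apply: (eq_measurable_fun (fun s => if (k < n.+1)%N then (p s)`_k.-1 / k%:R else 0)).
  by move=> s _; rewrite coef_poly.
case: (k < n.+1)%N; last exact: measurable_cst.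
by apply: measurable_funM => //; exact: measurable_cst.
Qed.

Lemma continuous_horner p : continuous (fun x => p.[x]).
Proof. by move=> x; exact: is_derive_continuous (is_derive_poly p x). Qed.

Lemma Rintegral_horner n p (x y : R) : (size p <= n)%N -> x <= y ->
  \int[leb]_(t in `[x, y]) p.[t] = (antiderivative n p).[y] - (antiderivative n p).[x].
Proof.
move=> sp xy; apply: (@Rintegral_FTC2 _ _ (fun t => (antiderivative n p).[t])) => // z _.
  by rewrite -{2}(deriv_antiderivative sp); exact: is_derive_poly.
exact: continuous_horner.
Qed.

Section Approximation.
Variables (f : R -> R) (p : {poly R}) (n N : nat) (a B C : R).
Hypotheses (mf : measurable_fun setT f) (bf : forall t, `|f t| <= B).
Hypothesis sp : (size p <= n)%N.
Hypotheses (C0 : 0 <= C) (fp : forall t, 0 < `|t| <= a -> `|f t - p.[t]| <= C * `|t| ^+ N).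

Let int_f b0 b1 (x y : R) : leb.-integrable [set` Interval (BSide b0 x) (BSide b1 y)] (EFin \o f).
Proof.
apply: (bounded_integrable (C := B)) => //; first exact: lebesgue_itv_lty.
exact: measurable_funTS.
Qed.

Let int_p b0 b1 (x y : R) :
  leb.-integrable [set` Interval (BSide b0 x) (BSide b1 y)] (EFin \o (fun t => p.[t])).
Proof.
apply: (@integrableS _ _ _ leb `[x, y]) => //; last first.
  by apply: continuous_itv_integrable => t _; exact: continuous_horner.
move=> t /=; rewrite !in_itv /=.
by case: b0; case: b1 => /=; move=> /andP[h1 h2]; apply/andP; split => //; exact: ltW.
Qed.

Let approx b0 b1 (x y D : R) : x <= y -> 0 <= D <= a ->
  (forall t, t \in Interval (BSide b0 x) (BSide b1 y) -> 0 < `|t| <= D) ->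
  `|\int[leb]_(t in [set` Interval (BSide b0 x) (BSide b1 y)]) f t -
    \int[leb]_(t in [set` Interval (BSide b0 x) (BSide b1 y)]) p.[t]| <= C * D ^+ N * (y - x).
Proof.
move=> xy /andP[D0 Da] tD.
have mI : measurable [set` Interval (BSide b0 x) (BSide b1 y)] by exact: measurable_itv.
rewrite -RintegralB//.
have : `|\int[leb]_(t in [set` Interval (BSide b0 x) (BSide b1 y)]) (f t - p.[t])| <=
    C * D ^+ N * fine (leb [set` Interval (BSide b0 x) (BSide b1 y)]).
  apply: normr_Rintegral_le => //; first exact: lebesgue_itv_lty.
    apply: measurable_funB; first exact: measurable_funTS.
    apply: measurable_funTS; apply: continuous_measurable_fun; exact: continuous_horner.
  move=> t /tD /andP[t0 tle]; apply: le_trans (fp _) _; first by rewrite t0 (le_trans tle).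
  by rewrite ler_wpM2l// lerXn2r ?nnegrE.
move=> /le_trans; apply; rewrite ler_wpM2l ?mulr_ge0 ?exprn_ge0//.
rewrite lebesgue_measure_itv/= lte_fin; case: ifP => _; first by rewrite -EFinB.
by rewrite /= subr_ge0.
Qed.

Lemma Rintegral_poly_approx t1 t2 : - a <= t1 < 0 -> 0 < t2 <= a ->
  `|\int[leb]_(t in `[t1, t2]) f t - ((antiderivative n p).[t2] - (antiderivative n p).[t1])| <=
  C * `|t1| ^+ N.+1 + C * t2 ^+ N.+1.
Proof.
move=> /andP[t1a t10] /andP[t20 t2a].
(* The approximation excludes t = 0, so the arc is cut there and the null point dropped. *)
have split3 (h : R -> R) : (forall b0 b1 (x y : R),
    leb.-integrable [set` Interval (BSide b0 x) (BSide b1 y)] (EFin \o h)) ->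
    \int[leb]_(t in `[t1, t2]) h t =
    \int[leb]_(t in `[t1, 0[) h t + \int[leb]_(t in `]0, t2]) h t.
  move=> ih.
  have E : `[t1, t2]%classic = `[t1, 0[%classic `|` `[0, t2]%classic :> set R.
    by rewrite -itv_bndbnd_setU// bnd_simp ltW.
  rewrite E Rintegral_setU//.
  - congr (_ + _); rewrite Rintegral_itv_obnd_cbnd//.
  - by rewrite -E; exact: (ih true false t1 t2).
  - apply/disj_setPS => x [] /=; rewrite !in_itv/= => /andP[_ xb] /andP[bx _].
    by have := lt_le_trans xb bx; rewrite ltxx.
rewrite -Rintegral_horner ?(ltW (lt_trans t10 t20))//.
rewrite (split3 f)// (split3 (fun t => p.[t]))//.
have h1 := @approx true true t1 0 (- t1) (ltW t10).
have h2 := @approx false false 0 t2 t2 (ltW t20).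
rewrite opprD addrACA; apply: le_trans (ler_normD _ _) _; apply: lerD.
  rewrite (ltr0_norm t10) exprSr mulrA -[X in _ * X]add0r; apply: h1.
    by rewrite oppr_ge0 ltW//= lerNl.
  move=> t; rewrite in_itv/= => /andP[t1t t0].
  by rewrite ltr0_norm// oppr_gt0 t0 lerN2.
rewrite exprSr mulrA -[X in _ * X]subr0; apply: h2; first by rewrite ltW.
by move=> t; rewrite in_itv/= => /andP[t0 tt2]; rewrite gtr0_norm// t0.
Qed.

End Approximation.
End Antiderivative.

(** * Uniqueness and consistency of expansion coefficients *)

Section OddExpansion.
Variable R : realType.
Implicit Types (p q : {poly R}).

Lemma horner_bounded p (x0 : R) : exists B, 0 <= B /\ forall x, `|x| <= x0 -> `|p.[x]| <= B.
Proof.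
exists (\sum_(i < size p) `|p`_i| * `|x0| ^+ i); split.
  by rewrite sumr_ge0// => i _; rewrite mulr_ge0// exprn_ge0.
move=> x xx; rewrite horner_coef; apply: le_trans (ler_norm_sum _ _ _) _.
apply: ler_sum => i _; rewrite normrM normrX ler_wpM2l// lerXn2r ?nnegrE//.
exact: le_trans xx (ler_norm _).
Qed.

(** The constant coefficient vanishes by letting x -> 0; division by x lowers both the degree and
    the order of smallness by one. *)
Lemma poly_small_eq0 p (m : nat) (C x0 : R) : 0 < x0 -> (size p <= m)%N ->
  (forall x, 0 < x <= x0 -> `|p.[x]| <= C * x ^+ m) -> p = 0.
Proof.
move=> x00; elim: m p => [|m IH] p sp Hp.
  by apply/eqP; rewrite -size_poly_eq0 -leqn0.
have [B [B0 HB]] := horner_bounded (drop_poly 1 p) x0.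
have Ep x : p.[x] = p`_0 + (drop_poly 1 p).[x] * x.
  rewrite -{1}(poly_take_drop 1 p) hornerD hornerM hornerXn expr1; congr (_ + _).
  by rewrite /take_poly poly_def big_ord1 expr0 hornerZ hornerC mulr1.
have p0 : p`_0 = 0.
  apply/eqP; rewrite -normr_le0; apply/ler_addgt0Pr => eps eps0; rewrite add0r.
  pose K := `|C| * x0 ^+ m + B + 1.
  have K0 : 0 < K by rewrite ltr_pwDr// addr_ge0// mulr_ge0// exprn_ge0// ltW.
  pose x := Num.min x0 (eps / K).
  have xp : 0 < x by rewrite lt_min x00 divr_gt0.
  have xx0 : x <= x0 by rewrite ge_min lexx.
  have : `|p`_0| <= `|p.[x]| + `|(drop_poly 1 p).[x] * x|.
    by rewrite (_ : p`_0 = p.[x] - (drop_poly 1 p).[x] * x) ?ler_normB// Ep addrK.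
  move=> /le_trans; apply.
  apply: (@le_trans _ _ (K * x)); last by rewrite mulrC -ler_pdivlMr// ge_min lexx orbT.
  rewrite /K -addrA [leRHS]mulrDl; apply: lerD.
    apply: le_trans (Hp x _) _; first by rewrite xp.
    rewrite exprSr mulrA ler_wpM2r ?(ltW xp)//.
    apply: (@le_trans _ _ (`|C| * x ^+ m)).
      by rewrite ler_wpM2r ?ler_norm// exprn_ge0// ltW.
    by rewrite ler_wpM2l// lerXn2r ?nnegrE// ltW.
  rewrite normrM (gtr0_norm xp) ler_wpM2r ?(ltW xp)//.
  by apply: le_trans (HB _ _) _; rewrite ?gtr0_norm// lerDl.
have d0 : drop_poly 1 p = 0.
  apply: IH; first by rewrite size_drop_poly leq_subLR add1n.
  move=> x /andP[xp xx0]; have := Hp x; rewrite Ep p0 add0r xp xx0 => /(_ isT).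
  by rewrite normrM (gtr0_norm xp) exprSr mulrA ler_pM2r.
by rewrite -(poly_take_drop 1 p) d0 mul0r addr0 /take_poly poly_def big_ord1 p0 scale0r.
Qed.

Lemma horner_odd_part q x : q.[x] - q.[- x] = 2 * x * (odd_poly q).[x ^+ 2].
Proof.
by rewrite -{1 2}(poly_even_odd q) !(hornerD, hornerM, hornerX, horner_comp, hornerXn) ?sqrrN ?mulrNN -?expr2; ring.
Qed.

End OddExpansion.

(* The library's sigma-finite instance on products only fires for subprobabilities. *)
HB.instance Definition _ (R : realType) :=
  Measure.copy (@leb2 R) (@lebesgue_measure R \x @lebesgue_measure R)%E.

Lemma sigma_finite_leb2 (R : realType) : sigma_finite [set: R * R] (@leb2 R).
Proof.
exists (fun n => `[- n%:R, n%:R]%classic `*` `[- n%:R, n%:R]%classic).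
  apply/seteqP; split => // -[x y] _.
  exists (maxn (Num.bound `|x|) (Num.bound `|y|)) => //.
  split; rewrite /= in_itv/= -ler_norml.
    by rewrite (le_trans (ltW (archi_boundP (normr_ge0 x))))// ler_nat leq_maxl.
  by rewrite (le_trans (ltW (archi_boundP (normr_ge0 y))))// ler_nat leq_maxr.
move=> n; split; first by apply: measurableX; exact: measurable_itv.
rewrite /leb2 product_measure1E//; apply: lte_mul_pinfty => //; last exact: lebesgue_itv_lty.
by rewrite ge0_fin_numE//; exact: lebesgue_itv_lty.
Qed.

HB.instance Definition _ (R : realType) :=
  Measure_isSigmaFinite.Build _ _ _ (@leb2 R) (@sigma_finite_leb2 R).

Section OddCoefficients.
Variables (R : realType) (F : R -> R) (u0 : R).
Hypothesis u00 : 0 < u0.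
Hypothesis HF : forall m : nat, exists P : {poly R}, (size P <= m)%N /\
  exists C, forall u : R, 0 < u <= u0 -> `|F u - u * P.[u ^+ 2]| <= C * u ^+ m.*2.+1.

(** The polynomials for successive m are chosen independently. Uniqueness shows that each is a
    truncation of the next, so their coefficients define one sequence. *)
Lemma odd_coefficients : exists c : nat -> R, forall m, exists C, forall u : R, 0 < u <= u0 ->
  `|F u - \sum_(j < m) c j * u ^+ j.*2.+1| <= C * u ^+ m.*2.+1.
Proof.
have [P HP] := choice HF.
have sP m : (size (P m) <= m)%N by case: (HP m).
have step m : P m = take_poly m (P m.+1).
  apply/eqP; rewrite -subr_eq0; apply/eqP.
  have [_ [C1 H1]] := HP m; have [_ [C2 H2]] := HP m.+1.
  pose d := (P m.+1)`_m.
  apply: (@poly_small_eq0 R _ m (`|C1| + `|C2| * u0 ^+ 2 + `|d|) (u0 ^+ 2)).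
  - by rewrite exprn_gt0.
  - by apply: leq_trans (size_polyD _ _) _; rewrite size_polyN geq_max sP size_take_poly.
  (* The hypotheses are bounds in u, uniqueness concerns polynomials in x = u^2. The term |d| of the
     constant accounts for the top coefficient removed by truncation. *)
  move=> x /andP[x0 xu]; pose u := Num.sqrt x.
  have up : 0 < u by rewrite sqrtr_gt0.
  have ux : u ^+ 2 = x by rewrite sqr_sqrtr// ltW.
  have uu0 : u <= u0 by rewrite -(@ler_sqr R) ?nnegrE ?ux// ltW.
  have uI : 0 < u <= u0 by rewrite up.
  have h1 := H1 u uI; have h2 := H2 u uI.
  have E : P m.+1 = take_poly m (P m.+1) + d *: 'X^m.
    apply/polyP => k; rewrite coefD coefZ coefXn coef_take_poly.
    case: (ltngtP k m) => [km|mk|->] /=; rewrite ?mulr0 ?addr0 ?mulr1 ?add0r//.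
    by rewrite nth_default// (leq_trans (sP _)).
  have Ex : (P m.+1).[x] = (take_poly m (P m.+1)).[x] + d * x ^+ m.
    by rewrite {1}E hornerD hornerZ hornerXn.
  rewrite ux in h1 h2.
  rewrite hornerD hornerN -(ler_pM2l up) -{1}(gtr0_norm up) -normrM.
  rewrite (_ : u * _ = - (F u - u * (P m).[x]) + (F u - u * (P m.+1).[x]) + u * (d * x ^+ m)); last first.
    by rewrite Ex; ring.
  have um (k : nat) : u ^+ k.*2.+1 = u * x ^+ k by rewrite exprS -mul2n exprM ux.
  have p0 : 0 <= u * x ^+ m by rewrite mulr_ge0 ?exprn_ge0// ltW.
  rewrite [leRHS](_ : _ = `|C1| * (u * x ^+ m) + (`|C2| * u0 ^+ 2) * (u * x ^+ m) +
    u * (`|d| * x ^+ m)); last by ring.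
  apply: le_trans (ler_normD _ _) _; apply: lerD; last first.
    by rewrite !normrM (gtr0_norm up) normrX (gtr0_norm x0).
  apply: le_trans (ler_normD _ _) _; apply: lerD.
    rewrite normrN; apply: le_trans h1 _; rewrite um ler_wpM2r// ler_norm//.
  apply: le_trans h2 _; rewrite um exprS [leLHS](_ : _ = `|C2| * u0 ^+ 2 * (u * x ^+ m) -
    (`|C2| * u0 ^+ 2 - C2 * x) * (u * x ^+ m)); last by ring.
  rewrite gerBl mulr_ge0// subr_ge0; apply: (@le_trans _ _ (`|C2| * x)).
    by rewrite ler_wpM2r ?ler_norm// ltW.
  by rewrite ler_wpM2l.
pose c j := (P j.+1)`_j.
have cE m j : (j < m)%N -> (P m)`_j = c j.
  elim: m => // m IH; rewrite ltnS leq_eqVlt => /predU1P[->//|jm].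
  by rewrite -(IH jm) [in RHS]step coef_take_poly jm.
exists c => m; have [_ [C H]] := HP m; exists C => u uI.
have := H u uI; rewrite (horner_coef_wide _ (sP m)) mulr_sumr.
rewrite (eq_bigr (fun j : 'I_m => c j * u ^+ j.*2.+1))// => j _.
have -> : u ^+ j.*2.+1 = u * (u ^+ 2) ^+ j by rewrite exprS -mul2n exprM.
by rewrite cE// mulrCA.
Qed.

End OddCoefficients.

Lemma Rintegral_ord_sum d (T : measurableType d) (R : realType)
  (mu : {measure set T -> \bar R}) (D : set T) (n : nat) (f : 'I_n -> T -> R) :
  measurable D -> (forall i, mu.-integrable D (EFin \o f i)) ->
  mu.-integrable D (EFin \o (fun x => \sum_(i < n) f i x)) /\
  \int[mu]_(x in D) (\sum_(i < n) f i x) = \sum_(i < n) \int[mu]_(x in D) f i x.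
Proof.
move=> mD; elim: n f => [|n IH] f fi.
  have E : (fun x => \sum_(i < 0) f i x) = cst 0 by apply/funext => x; rewrite big_ord0.
  split; first by rewrite E; exact: integrable0.
  rewrite big_ord0 (eq_Rintegral _ (g := cst 0)) => [|x _]; last by rewrite big_ord0.
  by rewrite Rintegral_cst// mul0r.
have [i1 e1] := IH (fun i => f (widen_ord (leqnSn n) i)) (fun i => fi _).
have E : (fun x => \sum_(i < n.+1) f i x) =
    (fun x => \sum_(i < n) f (widen_ord (leqnSn n) i) x + f ord_max x).
  by apply/funext => x; rewrite big_ord_recr.
split.
  rewrite E; have := integrableD mD i1 (fi ord_max).
  by apply: eq_integrable => // x _ /=; rewrite EFinD.
rewrite big_ord_recr /= -e1 -RintegralD//.
by apply: eq_Rintegral => x _; rewrite big_ord_recr.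
Qed.

Lemma torusE (R : realType) (L : R) :
  torus L = `[0, L[%classic `*` `[0, L[%classic :> set (R * R).
Proof. by apply/seteqP; split => p [/=]; rewrite !in_itv. Qed.

Lemma measurable_torus (R : realType) (L : R) : measurable (torus L).
Proof. by rewrite torusE; apply: measurableX; exact: measurable_itv. Qed.

Lemma leb2_torus_lty (R : realType) (L : R) : (leb2 (torus L) < +oo)%E.
Proof.
rewrite torusE /leb2 product_measure1E//; apply: lte_mul_pinfty => //; last exact: lebesgue_itv_lty.
by rewrite ge0_fin_numE//; exact: lebesgue_itv_lty.
Qed.

(** * The inner integral over an arc and its average along the curve *)

Section CurvePhi.
Variables (R : realType) (L : R) (g : R -> 'rV[R]_3).
Hypothesis Hg : arclength_simple_closed_curve L g.
Variables (a C2 : R).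
Notation leb := (@lebesgue_measure R).
Notation spd := (fun i => derive1 (coord3 g i)).
Notation dist := (dist12 g).

Hypotheses (L0 : 0 < L) (a0 : 0 < a) (a1 : 0 <= 1 - a) (aL : 0 < L - 2 * a).
Hypotheses (C20 : 0 <= C2) (aC : 0 <= 2^-1 - 6 * C2 * a).
Hypothesis Hlip : forall i x y, -1 <= x <= L + 1 -> -1 <= y <= L + 1 ->
  `|spd i x - spd i y| <= C2 * `|x - y|.

Variable u0 : R.
Hypothesis u00 : 0 < u0.
Hypothesis Harc : forall s u, 0 <= s < L -> 0 < u <= u0 ->
  exists t1 t2, [/\ - a <= t1 < 0, 0 < t2 <= a, dist (s, s + t1) = u, dist (s, s + t2) = u &
    forall t, t1 <= t < t1 + L -> (dist (s, s + t) <= u) = (t <= t2)].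

Lemma arc_signed_dist s u t1 t2 : 0 <= s < L -> 0 < u -> - a <= t1 < 0 -> 0 < t2 <= a ->
  dist (s, s + t1) = u -> dist (s, s + t2) = u ->
  [/\ 0 < `|t1| <= a, 0 < `|t2| <= a, signed_dist g s t1 = - u & signed_dist g s t2 = u].
Proof.
move=> sL up /andP[t1a t10] /andP[t20 t2a] d1 d2.
have T1 : 0 < `|t1| <= a by rewrite normr_gt0 (lt_eqF t10) ltr0_norm// lerNl.
have T2 : 0 < `|t2| <= a by rewrite gtr0_norm// t20.
split => //.
  rewrite -d1 -(normr_signed_dist g s T1) ler0_norm ?opprK//.
  by rewrite /signed_dist mulr_le0_ge0 ?sqrtr_ge0// ltW.
rewrite -d2 -(normr_signed_dist g s T2) ger0_norm//.
by rewrite /signed_dist mulr_ge0 ?sqrtr_ge0// ltW.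
Qed.

Variable rho : R * R -> R.
Hypotheses (mrho : measurable_fun setT rho) (brho : forall p, `|rho p| <= 1).
Hypothesis prho : forall x y, rho (x, y + L) = rho (x, y).
Hypothesis erho : forall N, expands L a (fun _ t => t) (fun s t => rho (s, s + t)) N.
Variable C1 : R.
Hypothesis rho1 : forall s t, 0 <= s < L -> 0 < `|t| <= a -> `|rho (s, s + t) - 1| <= C1 * `|t|.

Let indic u (p : R * R) := rho p * (dist p <= u)%R%:R.

Definition inner_integral u s := \int[leb]_(y in `[0, L[) indic u (s, y).

Let mindic u : measurable_fun setT (indic u).
Proof.
apply: measurable_funM => //; apply: measurable_fun_bool_natr.
by apply: measurable_fun_ler => //; exact: (measurable_dist12 Hg).
Qed.

Let bindic u p : `|indic u p| <= 1.
Proof. exact: le_trans (normr_mul_bool_le _ _) (brho p). Qed.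

Let pindic u x y : indic u (x, y + L) = indic u (x, y).
Proof. by rewrite /indic prho (dist12_periodic Hg). Qed.

Lemma inner_integral_arc s u t1 t2 : 0 <= s < L -> - a <= t1 < 0 -> 0 < t2 <= a ->
  (forall t, t1 <= t < t1 + L -> (dist (s, s + t) <= u) = (t <= t2)) ->
  inner_integral u s = \int[leb]_(t in `[t1, t2]) rho (s, s + t).
Proof.
move=> sL t1I t2I H; rewrite /inner_integral.
rewrite (Rintegral_section_shift L0 a0 (ltW aL) (mindic u) (bindic u) (pindic u) sL t1I).
have /andP[t1a t10] := t1I; have /andP[t20 t2a] := t2I.
have aL' := aL; have a0' := a0; have L0' := L0.
have E : `[t1, t2]%classic = `[t1, t1 + L[%classic `&` [set t | t <= t2] :> set R.
  apply/seteqP; split => t /=; rewrite !in_itv/=.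
    move=> /andP[h1 h2]; split => //; rewrite h1 /=; lra.
  by move=> [/andP[-> _] ->].
rewrite E Rintegral_mkcondr; apply: eq_Rintegral => t; rewrite inE /= in_itv/= => tI.
rewrite /indic H// patchE; case: ifPn => [|].
  by rewrite inE/= => ->; rewrite mulr1.
by rewrite notin_setE/= => /negP/negbTE ->; rewrite mulr0.
Qed.

Let mrho_s s : measurable_fun setT (fun t : R => rho (s, s + t)).
Proof.
apply: (measurableT_comp (f := fun y => rho (s, y))).
  by apply: (measurableT_comp mrho); exact: pair1_measurable.
by apply: measurable_funD => //; exact: measurable_cst.
Qed.

(** Both arc ends satisfy |t| <= 2 |sigma| = 2u, which expresses the error in terms of u. *)
Let arc_approx s u (p : {poly R}) n N C : 0 <= s < L -> 0 < u <= u0 -> (size p <= n)%N ->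
  0 <= C -> (forall t, 0 < `|t| <= a -> `|rho (s, s + t) - p.[t]| <= C * `|t| ^+ N) ->
  exists t1 t2, [/\ 0 < `|t1| <= a, 0 < `|t2| <= a, signed_dist g s t1 = - u,
    signed_dist g s t2 = u &
    `|inner_integral u s - ((antiderivative n p).[t2] - (antiderivative n p).[t1])| <=
      2 * C * (2 * u) ^+ N.+1].
Proof.
move=> sL uI sp C0 Hp; have [t1 [t2 [T1 T2 d1 d2 H]]] := Harc sL uI.
have up : 0 < u by case/andP: uI.
have [A1 A2 S1 S2] := arc_signed_dist sL up T1 T2 d1 d2.
exists t1, t2; split => //.
rewrite (inner_integral_arc sL T1 T2 H).
apply: le_trans (Rintegral_poly_approx (mrho_s s) (fun t => brho _) sp C0 Hp T1 T2) _.
have b1 : `|t1| <= 2 * u.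
  have := normr_le_signed_dist Hg a0 a1 C20 aC Hlip sL A1.
  by rewrite S1 normrN (gtr0_norm up).
have b2 : t2 <= 2 * u.
  have := normr_le_signed_dist Hg a0 a1 C20 aC Hlip sL A2.
  by rewrite S2 (gtr0_norm up) gtr0_norm//; case/andP: T2.
have t20 : 0 <= t2 by case/andP: T2 => /ltW.
have u2 : 0 <= 2 * u by rewrite mulr_ge0// ltW.
rewrite (_ : 2 * C * _ = C * (2 * u) ^+ N.+1 + C * (2 * u) ^+ N.+1); last by ring.
by apply: lerD; rewrite ler_wpM2l// lerXn2r ?nnegrE.
Qed.

Lemma inner_integral_near : exists K, 0 <= K /\ forall s u, 0 <= s < L -> 0 < u <= u0 ->
  `|inner_integral u s - 2 * u| <= K * u ^+ 2.
Proof.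
(* The first summand is the cost of replacing rho by 1 on the arc, the second that of replacing t by
   sigma at its two ends; each 4 comes from |t| <= 2u. *)
exists (2 * `|C1| * 4 + 2 * (6 * C2 * 4)); split.
  by rewrite addr_ge0 ?mulr_ge0.
move=> s u sL uI; have up : 0 < u by case/andP: uI.
have H t : 0 < `|t| <= a -> `|rho (s, s + t) - (1 : {poly R}).[t]| <= `|C1| * `|t| ^+ 1.
  move=> ta; rewrite hornerC expr1; apply: le_trans (rho1 sL ta) _.
  by rewrite ler_wpM2r// ler_norm.
have [|t1 [t2 [A1 A2 S1 S2 B]]] := arc_approx sL uI (p := 1) (n := 1) _ (normr_ge0 C1) H.
  by rewrite size_poly1.
have E t : (antiderivative 1 (1 : {poly R})).[t] = t.
  by rewrite /antiderivative poly_def !big_ord_recr big_ord0 /= !hornerE /= coef1 /= invr0 mulr0 add0r divr1 mul1r.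
rewrite !E in B.
have near t : 0 < `|t| <= a -> `|signed_dist g s t| = u -> `|signed_dist g s t - t| <= 6 * C2 * 4 * u ^+ 2.
  move=> ta su; apply: le_trans (signed_dist_near Hg a0 a1 C20 aC Hlip sL ta) _.
  have h := normr_le_signed_dist Hg a0 a1 C20 aC Hlip sL ta; rewrite su in h.
  rewrite [leRHS](_ : _ = 6 * C2 * (2 * u) ^+ 2); last by ring.
  by rewrite ler_wpM2l ?mulr_ge0// lerXn2r ?nnegrE// mulr_ge0// ltW.
have n1 := near t1 A1; have n2 := near t2 A2.
rewrite S1 normrN (gtr0_norm up) in n1; rewrite S2 (gtr0_norm up) in n2.
have {}n1 := n1 erefl; have {}n2 := n2 erefl.
rewrite (_ : _ - 2 * u = (inner_integral u s - (t2 - t1)) + (- u - t1) - (u - t2)); last by ring.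
apply: le_trans (ler_normB _ _) _.
rewrite (_ : _ * u ^+ 2 = 2 * `|C1| * (2 * u) ^+ 2 + 6 * C2 * 4 * u ^+ 2 + 6 * C2 * 4 * u ^+ 2); last by ring.
apply: lerD => //; apply: le_trans (ler_normD _ _) _; exact: lerD.
Qed.

(** The polynomial r is the antiderivative of the expansion of rho, re-expanded in sigma. Since
    sigma is u and -u at the two arc ends, the integral becomes a difference that is odd in u. *)
Lemma inner_integral_expansion N : exists r, coef_bounded L r /\ exists K, 0 <= K /\
  forall s u, 0 <= s < L -> 0 < u <= u0 ->
  `|inner_integral u s - ((r s).[u] - (r s).[- u])| <= K * u ^+ N.+1.
Proof.
have [p [cp [C [C0 HC]]]] := erho N.
have [n [_ [_ [sp _]]]] := cp.
have wW s t : 0 <= s < L -> 0 < `|t| <= a -> `|signed_dist g s t| <= 2 * a.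
  move=> sL ta; apply: le_trans (signed_dist_le Hg a0 a1 C20 aC Hlip sL ta) _.
  by rewrite ler_wpM2l//; case/andP: ta.
have eP := expands_comp wW
  (expands_poly a (fun _ t => t) N.+1 (coef_bounded_antiderivative n cp))
  (expands_signed_dist Hg a0 a1 C20 aC Hlip N.+1)
  (fun s t sL ta => normr_le_signed_dist Hg a0 a1 C20 aC Hlip sL ta).
have [r [cr [E [E0 HE]]]] := eP.
exists r; split => //; exists (2 * C * 2 ^+ N.+1 + E + E); split.
  by rewrite !addr_ge0 ?mulr_ge0 ?exprn_ge0.
move=> s u sL uI; have up : 0 < u by case/andP: uI.
have [t1 [t2 [A1 A2 S1 S2 B]]] := arc_approx sL uI (sp s) C0 (fun t ta => HC s t sL ta).
have e1 := HE s t1 sL A1; have e2 := HE s t2 sL A2.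
rewrite S1 normrN (gtr0_norm up) in e1; rewrite S2 (gtr0_norm up) in e2.
set P := antiderivative n (p s) in B e1 e2.
rewrite (_ : _ - _ = (inner_integral u s - (P.[t2] - P.[t1])) + (P.[t2] - (r s).[u]) -
  (P.[t1] - (r s).[- u])); last by ring.
apply: le_trans (ler_normB _ _) _; rewrite [leRHS]mulrDl; apply: lerD => //.
apply: le_trans (ler_normD _ _) _; rewrite [leRHS]mulrDl; apply: lerD => //.
by apply: le_trans B _; rewrite exprMn mulrA.
Qed.

Notation Phi := (sublevel_integral (@leb2 R) (torus L) dist rho).

Let mI : measurable (`[0, L[%classic : set R). Proof. exact: measurable_itv. Qed.
Let finI : (leb `[0%R, L[ < +oo)%E. Proof. exact: lebesgue_itv_lty. Qed.
Let lebI : fine (leb `[0%R, L[) = L.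
Proof. by rewrite lebesgue_measure_itv/= lte_fin L0 -EFinB subr0. Qed.

Lemma sublevel_integral_inner u : Phi u = \int[leb]_(s in `[0, L[) inner_integral u s.
Proof.
rewrite sublevel_integralE torusE /leb2.
apply: (@Rintegral_prod12 _ _ _ _ R leb leb `[0, L[%classic `[0, L[%classic (indic u) 1) => //.
exact: measurable_funTS (mindic u).
Qed.

Lemma measurable_inner_integral u : measurable_fun `[0, L[ (inner_integral u).
Proof.
apply: (@measurable_fun_Rintegral1 _ _ _ _ R leb leb `[0, L[%classic `[0, L[%classic (indic u) 1) => //.
exact: measurable_funTS (mindic u).
Qed.

Let average_approx (h : R -> R) u K : measurable_fun `[0, L[ h ->
  (exists B, forall s, 0 <= s < L -> `|h s| <= B) ->
  (forall s, 0 <= s < L -> `|inner_integral u s - h s| <= K) ->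
  `|Phi u - \int[leb]_(s in `[0, L[) h s| <= K * L.
Proof.
move=> mh [B HB] H; rewrite sublevel_integral_inner.
have DE s : `[0, L[%classic s -> 0 <= s < L by rewrite /= in_itv.
have mi := measurable_inner_integral u.
rewrite -RintegralB//; last 2 first.
- apply: (bounded_integrable (C := K + B)) => // s /DE sL.
  rewrite -(subrK (h s) (inner_integral u s)); apply: le_trans (ler_normD _ _) _.
  by apply: lerD; [exact: H|exact: HB].
- by apply: (bounded_integrable (C := B)) => // s /DE; exact: HB.
rewrite -[X in _ <= _ * X]lebI; apply: normr_Rintegral_le => //.
exact: (measurable_funB mi mh).
Qed.

Lemma Phi_near : exists K, forall u, 0 < u <= u0 -> `|Phi u - 2 * L * u| <= K * u ^+ 2.
Proof.
have [K [K0 HK]] := inner_integral_near; exists (K * L) => u uI.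
have := @average_approx (cst (2 * u)) u (K * u ^+ 2) (measurable_cst _) _
  (fun s sL => HK s u sL uI).
rewrite Rintegral_cst// lebI (_ : 2 * u * L = 2 * L * u); last by ring.
rewrite [K * L * _]mulrAC; apply; exists `|2 * u| => s _ //=.
Qed.

Lemma Phi_polynomial N : exists (Q : {poly R}) K, 0 <= K /\ forall u, 0 < u <= u0 ->
  `|Phi u - (Q.[u] - Q.[- u])| <= K * u ^+ N.+1.
Proof.
have [r [cr [K [K0 HK]]]] := inner_integral_expansion N.
have [n [C [C0 [sr [br mr]]]]] := cr.
have ic k : leb.-integrable `[0, L[ (EFin \o (fun s => (r s)`_k)).
  by apply: (bounded_integrable (C := C)) => //; [exact: mr|move=> s /= sL; apply: br; move: sL; rewrite in_itv].
(* Integration over s acts on the coefficients. *)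
pose Q := \poly_(k < n) \int[leb]_(s in `[0, L[) (r s)`_k.
have Qx x : leb.-integrable `[0, L[ (EFin \o (fun s => (r s).[x])) /\
    \int[leb]_(s in `[0, L[) (r s).[x] = Q.[x].
  have E (s : R) : (r s).[x] = \sum_(i < n) (r s)`_i * x ^+ i by rewrite (horner_coef_wide _ (sr s)).
  have [|i1 e1] := @Rintegral_ord_sum _ _ _ leb `[0%R, L[%classic n (fun i (s : R) => (r s)`_i * x ^+ i) (measurable_itv _).
    move=> i; apply: (bounded_integrable (C := C * `|x ^+ i|)) => //.
      by apply: measurable_funM; [exact: mr|exact: measurable_cst].
    move=> s /= sL; rewrite normrM ler_wpM2r//; apply: br; move: sL; rewrite in_itv//.
  split.
    by apply: eq_integrable i1 => // s _ /=; rewrite E.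
  transitivity (\int[leb]_(s in `[0, L[) (\sum_(i < n) (r s)`_i * x ^+ i)).
    by apply: eq_Rintegral => s _; exact: E.
  rewrite e1 /Q horner_poly; apply: eq_bigr => i _; rewrite (RintegralZr (mu := leb))//.
exists Q, (K * L); split; first by rewrite mulr_ge0// ltW.
move=> u uI; have up : 0 < u by case/andP: uI.
have [i1 <-] := Qx u; have [i2 <-] := Qx (- u).
rewrite -RintegralB// mulrAC; apply: average_approx.
- apply: measurable_funB.
    by have /integrableP[/measurable_EFinP] := i1.
  by have /integrableP[/measurable_EFinP] := i2.
- have [B [B0 HB]] := horner_coef_bounded u cr.
  exists (B + B) => s sL; apply: le_trans (ler_normB _ _) _; apply: lerD; apply: HB => //.
    by rewrite gtr0_norm.
  by rewrite normrN gtr0_norm.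
- by move=> s sL; exact: HK.
Qed.

Lemma Phi_odd_expansion m : exists P : {poly R}, (size P <= m)%N /\
  exists C, forall u : R, 0 < u <= u0 -> `|Phi u - u * P.[u ^+ 2]| <= C * u ^+ m.*2.+1.
Proof.
have [Q [K [K0 HK]]] := Phi_polynomial m.*2.
(* Only the odd part of Q survives in Q(u) - Q(-u); its terms of order u^(2m+1) and above join the
   error. *)
pose O := 2 *: odd_poly Q; exists (take_poly m O); split; first exact: size_take_poly.
have [B [B0 HB]] := horner_bounded (drop_poly m O) (u0 ^+ 2).
exists (K + B) => u uI; have /andP[up uu0] := uI.
have E : Q.[u] - Q.[- u] = u * (take_poly m O).[u ^+ 2] + (drop_poly m O).[u ^+ 2] * u ^+ m.*2.+1.
  rewrite horner_odd_part (_ : 2 * u * _ = u * O.[u ^+ 2]); last by rewrite hornerZ; ring.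
  have -> : u ^+ m.*2.+1 = u * (u ^+ 2) ^+ m by rewrite exprS -mul2n exprM.
  by rewrite -{1}(poly_take_drop m O) hornerD hornerM hornerXn; ring.
rewrite (_ : _ - _ = (Phi u - (Q.[u] - Q.[- u])) + (drop_poly m O).[u ^+ 2] * u ^+ m.*2.+1); last first.
  by rewrite E; ring.
apply: le_trans (ler_normD _ _) _; rewrite [leRHS]mulrDl; apply: lerD; first exact: HK.
rewrite normrM normrX (gtr0_norm up) ler_wpM2r ?exprn_ge0 ?(ltW up)//.
by apply: HB; rewrite normrX (gtr0_norm up) lerXn2r ?nnegrE ?(ltW up) ?(ltW u00).
Qed.

Lemma Phi_coefficients (M : R) : exists c : nat -> R, c 0%N = 2 * L /\
  forall N, exists C, forall u : R, 0 < u <= M ->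
  `|odd_remainder Phi c N u| <= C * u ^+ N.*2.+1.
Proof.
have [c Hc] := odd_coefficients u00 Phi_odd_expansion; exists c; split.
  (* The approximations c_0 u + O(u^3) and 2 L u + O(u^2) of the same function are compared as u ->
     0. *)
  have [C HC] := Hc 1%N; have [K HK] := Phi_near.
  apply/eqP; rewrite -subr_eq0 -normr_le0; apply/ler_addgt0Pr => eps eps0; rewrite add0r.
  pose S := `|C| * u0 + `|K| + 1.
  have S0 : 0 < S by rewrite ltr_pwDr// addr_ge0// mulr_ge0// ltW.
  pose u := Num.min u0 (eps / S).
  have up : 0 < u by rewrite lt_min u00 divr_gt0.
  have uI : 0 < u <= u0 by rewrite up ge_min lexx.
  have := HC u uI; have := HK u uI; rewrite big_ord1 /= expr1 => h1 h2.
  rewrite -(ler_pM2l up) -{1}(gtr0_norm up) -normrM.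
  rewrite (_ : u * _ = (Phi u - 2 * L * u) - (Phi u - c 0%N * u)); last by ring.
  apply: le_trans (ler_normB _ _) _; apply: (@le_trans _ _ (u * (S * u))); last first.
    by rewrite ler_wpM2l ?(ltW up)// mulrC -ler_pdivlMr// ge_min lexx orbT.
  have u30 : 0 <= u ^+ 2 by exact: sqr_ge0.
  apply: (@le_trans _ _ (`|K| * u ^+ 2 + `|C| * u0 * u ^+ 2)).
    apply: lerD; first by apply: le_trans h1 _; rewrite ler_wpM2r// ler_norm.
    apply: le_trans h2 _; rewrite (_ : 1.*2.+1 = 3)%N// exprS mulrA ler_wpM2r//.
    apply: (@le_trans _ _ (`|C| * u)); first by rewrite ler_wpM2r ?ler_norm// ltW.
    by rewrite ler_wpM2l// ge_min lexx.
  rewrite (_ : u * (S * u) = S * u ^+ 2); last by ring.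
  by rewrite -mulrDl ler_wpM2r// /S addrC lerDl.
move=> N; have [C HC] := Hc N.
(* For u0 < u <= M the remainder is at most S while u^(2N+1) >= u0^(2N+1), so adding S / u0^(2N+1)
   to the constant extends the bound up to M. *)
pose S := 1 * fine ((@leb2 R) (torus L)) + \sum_(j < N) `|c j| * `|M| ^+ j.*2.+1.
have PhiS u : `|Phi u| <= 1 * fine ((@leb2 R) (torus L)).
  apply: normr_sublevel_integral_le => //.
  - exact: measurable_torus.
  - exact: leb2_torus_lty.
  - by apply: measurable_funTS; exact: (measurable_dist12 Hg).
  - exact: measurable_funTS.
have S0 : 0 <= S.
  rewrite addr_ge0//; first exact: le_trans (normr_ge0 _) (PhiS 0).
  by rewrite sumr_ge0// => j _; rewrite mulr_ge0// exprn_ge0.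
exists (`|C| + S / u0 ^+ N.*2.+1) => u /andP[up uM].
have un : 0 <= u ^+ N.*2.+1 by rewrite exprn_ge0// ltW.
have u0n : 0 < u0 ^+ N.*2.+1 by rewrite exprn_gt0.
have [uu0|u0u] := leP u u0.
  apply: le_trans (HC u _) _; first by rewrite up.
  rewrite ler_wpM2r//; apply: le_trans (ler_norm C) _; rewrite lerDl divr_ge0// ltW//.
apply: (@le_trans _ _ S).
  apply: le_trans (ler_normB _ _) _; apply: lerD => //.
  apply: le_trans (ler_norm_sum _ _ _) _; apply: ler_sum => j _.
  rewrite normrM normrX ler_wpM2l// lerXn2r ?nnegrE//.
  by rewrite (gtr0_norm up) (le_trans uM)// ler_norm.
rewrite mulrDl; apply: ler_wpDl; first by rewrite mulr_ge0.
rewrite mulrAC -mulrA ler_peMr// ler_pdivlMr// mul1r lerXn2r ?nnegrE ?(ltW up) ?(ltW u00)//.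
exact: ltW.
Qed.

End CurvePhi.

(** * Comparison of the Neumann and Weber kernels *)

Section NeumannWeber.
Variables (R : realType) (L : R) (g : R -> 'rV[R]_3).
Hypothesis Hg : arclength_simple_closed_curve L g.
Variables (a C2 : R).
Notation leb := (@lebesgue_measure R).
Notation pos := (coord3 g).
Notation spd := (fun i => derive1 (coord3 g i)).
Notation dist := (dist12 g).

Hypotheses (L0 : 0 < L) (a0 : 0 < a) (a1 : 0 <= 1 - a) (aL : 0 < L - 2 * a).
Hypotheses (C20 : 0 <= C2) (aC : 0 <= 2^-1 - 6 * C2 * a).
Hypothesis Hlip : forall i x y, -1 <= x <= L + 1 -> -1 <= y <= L + 1 ->
  `|spd i x - spd i y| <= C2 * `|x - y|.

Variable u0 : R.
Hypothesis u00 : 0 < u0.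
Hypothesis Harc : forall s u, 0 <= s < L -> 0 < u <= u0 ->
  exists t1 t2, [/\ - a <= t1 < 0, 0 < t2 <= a, dist (s, s + t1) = u, dist (s, s + t2) = u &
    forall t, t1 <= t < t1 + L -> (dist (s, s + t) <= u) = (t <= t2)].

Let sg i : smooth_fun (pos i). Proof. by case: Hg. Qed.

Definition kernel_gap (p : R * R) := (rhoW g p - rhoN g p) / dist p.

Let chord_speed s t := \sum_(i < 3) (pos i (s + t) - pos i s) * spd i s.

Lemma is_derive_ord_sum (n : nat) (F : 'I_n -> R -> R) (dF : 'I_n -> R) (x : R) :
  (forall i, is_derive x 1 (F i) (dF i)) ->
  is_derive x 1 (fun t => \sum_(i < n) F i t) (\sum_(i < n) dF i).
Proof.
move=> H; rewrite (_ : (fun t => _) = \sum_(i < n) F i); first exact: is_derive_sum.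
by apply/funext => t; rewrite fct_sumE.
Qed.

Let is_derive_chord i (s t : R) :
  is_derive t 1 (fun t => pos i (s + t) - pos i s) (spd i (s + t)).
Proof.
have h : is_derive t 1 (fun t : R => s + t) 1.
  by apply: (is_derive_eq (is_deriveD (is_derive_cst s t 1) (is_derive_id t 1))); rewrite add0r.
apply: (is_derive_eq (is_deriveB (is_derive1_comp (smooth_is_derive1 (s + t) (@sg i)) h)
  (is_derive_cst (pos i s) t 1))).
by rewrite mulr1 subr0.
Qed.

(** Quotient rule with v = gamma(s+t) - gamma(s): the numerator v . gamma'(s) has derivative rhoN,
    and the derivative v . gamma'(s+t) / d of the denominator produces rhoW. *)
Lemma is_derive_kernel_gap (s t : R) : 0 < dist (s, s + t) ->
  is_derive t 1 (fun t => - (chord_speed s t / dist (s, s + t))) (kernel_gap (s, s + t)).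
Proof.
move=> d0.
have dc : is_derive t 1 (chord_speed s) (\sum_(i < 3) spd i (s + t) * spd i s).
  apply: (@is_derive_ord_sum 3 (fun i t => (pos i (s + t) - pos i s) * spd i s)) => i.
  apply: (is_derive_eq (is_deriveM (is_derive_chord i s t) (is_derive_cst (spd i s) t 1))).
  by rewrite scaler0 add0r mulrC.
have dq : is_derive t 1 (fun t => sqdist g (s, s + t))
    (\sum_(i < 3) 2 * (pos i (s + t) - pos i s) * spd i (s + t)).
  apply: (@is_derive_ord_sum 3 (fun i t => (pos i (s + t) - pos i s) ^+ 2)) => i.
  apply: (is_derive_eq (is_deriveM (is_derive_chord i s t) (is_derive_chord i s t))).
  by rewrite /GRing.scale /=; ring.
have q0 : 0 < sqdist g (s, s + t) by rewrite -sqr_dist12 exprn_gt0.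
have dd : is_derive t 1 (fun t => dist (s, s + t))
    ((\sum_(i < 3) (pos i (s + t) - pos i s) * spd i (s + t)) / dist (s, s + t)).
  rewrite (_ : (fun t => dist (s, s + t)) = Num.sqrt \o (fun t => sqdist g (s, s + t))); last first.
    by apply/funext => x; rewrite /= dist12E.
  have := is_derive1_comp (is_derive1_sqrt q0) dq; move=> h'; apply: (is_derive_eq h').
  rewrite -dist12E invfM mulrC mulrA; congr (_ / _).
  by rewrite mulr_suml; apply: eq_bigr => i _; rewrite -!mulrA mulrCA mulrC; field.
have dn : dist (s, s + t) != 0 by rewrite gt_eqF.
have := is_deriveN (is_deriveM dc (is_deriveV (f := fun t => dist (s, s + t)) dn dd)); move=> h'; apply: (is_derive_eq h').
rewrite /GRing.scale /= /kernel_gap rhoNE rhoWE /=.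
have -> : \sum_(i < 3) spd i s * spd i (s + t) = \sum_(i < 3) spd i (s + t) * spd i s.
  by apply: eq_bigr => i _; rewrite mulrC.
rewrite -/(chord_speed s t); move: (chord_speed s t) (dist _) dn => x d dn.
by field.
Qed.

Lemma continuous_kernel_gap (s t : R) : 0 < dist (s, s + t) ->
  {for t, continuous (fun t : R => kernel_gap (s, s + t))}.
Proof.
move=> d0; have dn : dist (s, s + t) != 0 by rewrite gt_eqF.
have cd : {for t, continuous (fun t : R => (dist (s, s + t))^-1)}.
  by apply: continuousV => //; exact: (continuous_dist12_shift Hg).
have cs : {for t, continuous (fun t : R => s + t)}.
  by apply: continuousD; [exact: cst_continuous|exact: cvg_id].
have cv i : {for t, continuous (fun t : R => spd i (s + t))}.
  by apply: continuous_comp => //; exact: (smooth_continuous (smooth_derive1 (@sg i))).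
have cp i : {for t, continuous (fun t : R => pos i (s + t) - pos i s)}.
  exact: (is_derive_continuous (is_derive_chord i s t)).
have cc (c : R) : {for t, continuous (fun _ : R => c)} by exact: cst_continuous.
have csum (F : 'I_3 -> R -> R) : (forall i, {for t, continuous (F i)}) ->
    {for t, continuous (fun t => \sum_(i < 3) F i t)} by exact: continuous_ord_sum.
have c1 := csum _ (fun i => continuousM (cp i) (cc (spd i s))).
have c2 := csum _ (fun i => continuousM (cp i) (cv i)).
have c3 := csum _ (fun i => continuousM (cc (spd i s)) (cv i)).
have h := continuousM (continuousB (continuousM (continuousM cd cd) (continuousM c1 c2)) c3) cd.
apply: (eq_ind _ (fun F : R -> R => {for t, continuous F}) h).
by apply/funext => x; rewrite /kernel_gap rhoNE rhoWE expr2.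
Qed.

Let cut e p := kernel_gap p * (e < dist p)%R%:R.

Let mcut e : measurable_fun setT (cut e).
Proof.
apply: measurable_funM.
  apply: measurable_funM; last exact: (measurable_inv_dist12 Hg).
  by apply: measurable_funB; [exact: (measurable_rhoW Hg)|exact: (measurable_rhoN Hg)].
apply: measurable_fun_bool_natr.
by apply: measurable_fun_ltr => //; exact: (measurable_dist12 Hg).
Qed.

Let bcut e p : 0 < e -> `|cut e p| <= 2 / e.
Proof.
move=> e0; rewrite /cut; case: ltP => ed; last by rewrite mulr0 normr0 divr_ge0// ltW.
rewrite mulr1 normrM normfV (ger0_norm (dist12_ge0 g p)); apply: ler_pM => //; first by rewrite invr_ge0 dist12_ge0.
  apply: le_trans (ler_normB _ _) _; rewrite (_ : 2 = 1 + 1 :> R); last by ring.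
  by apply: lerD; [exact: (normr_rhoW_le1 Hg)|exact: (normr_rhoN_le1 Hg)].
by rewrite lef_pV2 ?posrE ?(lt_trans e0 ed)// ltW.
Qed.

Let pcut e x y : cut e (x, y + L) = cut e (x, y).
Proof.
by rewrite /cut /kernel_gap (rhoW_periodic Hg) (rhoN_periodic Hg) (dist12_periodic Hg).
Qed.

Let chord_flux s t := chord_speed s t / dist (s, s + t).

(** The gap is integrated over the complementary arc ]t2, t1 + L[, where d > e; periodicity brings
    the far end t1 + L back to t1. *)
Let cut_inner s e t1 t2 : 0 <= s < L -> 0 < e -> - a <= t1 < 0 -> 0 < t2 <= a ->
  dist (s, s + t1) = e -> dist (s, s + t2) = e ->
  (forall t, t1 <= t < t1 + L -> (dist (s, s + t) <= e) = (t <= t2)) ->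
  \int[leb]_(y in `[0, L[) cut e (s, y) = chord_flux s t2 - chord_flux s t1.
Proof.
move=> sL e0 T1 T2 d1 d2 H.
rewrite (Rintegral_section_shift L0 a0 (ltW aL) (mcut e) (fun p => bcut p e0) (pcut e) sL T1).
have /andP[t1a t10] := T1; have /andP[t20 t2a] := T2.
have aL' := aL; have a0' := a0; have L0' := L0.
have dp (t : R) : t2 <= t <= t1 + L -> 0 < dist (s, s + t).
  move=> /andP[]; rewrite le_eqVlt => /predU1P[<- _|t2t]; first by rewrite d2.
  rewrite le_eqVlt => /predU1P[->|tt]; first by rewrite addrA (dist12_periodic Hg) d1.
  apply: (lt_trans e0); rewrite ltNge H -?ltNge// tt andbT; lra.
have gi : leb.-integrable `[t2, t1 + L] (EFin \o (fun t => kernel_gap (s, s + t))).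
  by apply: continuous_itv_integrable => t /dp; exact: continuous_kernel_gap.
have E : `]t2, t1 + L[%classic = `[t1, t1 + L[%classic `&` [set t | t2 < t] :> set R.
  apply/seteqP; split => t /=; rewrite !in_itv/=.
    move=> /andP[h1 h2]; split => //; rewrite h2 andbT; lra.
  by move=> [/andP[_ ->] ->].
transitivity (\int[leb]_(t in `]t2, t1 + L[) kernel_gap (s, s + t)).
  rewrite E Rintegral_mkcondr; apply: eq_Rintegral => t; rewrite inE /= in_itv/= => tI.
  rewrite /cut ltNge H// -ltNge patchE; case: ifPn => [|].
    by rewrite inE/= => ->; rewrite mulr1.
  by rewrite notin_setE/= => /negP/negbTE ->; rewrite mulr0.
rewrite Rintegral_itv_bndo_bndc; last first.
  by apply: integrableS gi => //; apply: subset_itv; rewrite bnd_simp.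
rewrite Rintegral_itv_obnd_cbnd; last first.
  by apply: integrableS gi => //; apply: subset_itv; rewrite bnd_simp.
have t12 : t2 <= t1 + L by lra.
have -> := Rintegral_FTC2 t12 (F := fun t => - chord_flux s t)
  (fun t ti => is_derive_kernel_gap (dp t ti)) (fun t ti => continuous_kernel_gap (dp t ti)).
rewrite opprK addrC /chord_flux; congr (_ - _); congr (_ / _).
  by apply: eq_bigr => i _; rewrite addrA (curve_periodic Hg).
by rewrite addrA (dist12_periodic Hg).
Qed.

(** At an arc end sigma / d is 1 or -1. Replacing t v by t, where v is [chord_start], and then t by
    sigma costs 6 C2 t^2 each; with |t| <= 2d and division by d this is 48 C2 d. *)
Let chord_flux_near s t : 0 <= s < L -> 0 < `|t| <= a ->
  `|chord_flux s t - signed_dist g s t / dist (s, s + t)| <= 48 * C2 * dist (s, s + t).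
Proof.
move=> sL ta; have /andP[tp ta'] := ta; have t0 : t != 0 by rewrite -normr_gt0.
have A := chord_start_near Hg a0 a1 C20 Hlip sL ta.
have B := signed_dist_near Hg a0 a1 C20 aC Hlip sL ta.
have le2 := normr_le_signed_dist Hg a0 a1 C20 aC Hlip sL ta.
rewrite (normr_signed_dist g s ta) in le2.
have d0 : 0 < dist (s, s + t) by have := lt_le_trans tp le2; rewrite pmulr_rgt0.
set d := dist _ in d0 le2 *.
have -> : chord_flux s t = t * chord_start g s t / d.
  rewrite /chord_flux -/d; congr (_ / d); rewrite /chord_start mulr_sumr.
  by apply: eq_bigr => i _; rewrite /chord_quotient; field.
rewrite -mulrBl normrM normfV (gtr0_norm d0) ler_pdivrMr//.
rewrite (_ : _ - _ = t * (chord_start g s t - 1) - (signed_dist g s t - t)); last by ring.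
apply: le_trans (ler_normB _ _) _.
apply: (@le_trans _ _ (6 * C2 * `|t| ^+ 2 + 6 * C2 * `|t| ^+ 2)).
  apply: lerD => //; rewrite normrM expr2 mulrCA; exact: ler_wpM2l.
rewrite (_ : _ + _ = 12 * C2 * `|t| ^+ 2); last by ring.
rewrite (_ : 48 * C2 * d * d = 12 * C2 * (2 * d) ^+ 2); last by ring.
by rewrite ler_wpM2l ?mulr_ge0// lerXn2r ?nnegrE// mulr_ge0// ltW.
Qed.

Let cut_inner_near s e : 0 <= s < L -> 0 < e <= u0 ->
  `|\int[leb]_(y in `[0, L[) cut e (s, y) - 2| <= 96 * C2 * e.
Proof.
move=> sL eI; have [t1 [t2 [T1 T2 d1 d2 H]]] := Harc sL eI.
have e0 : 0 < e by case/andP: eI.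
have [A1 A2 S1 S2] := arc_signed_dist sL e0 T1 T2 d1 d2.
rewrite (cut_inner sL e0 T1 T2 d1 d2 H).
have := chord_flux_near sL A1; have := chord_flux_near sL A2.
rewrite S1 S2 d1 d2 mulNr divff ?gt_eqF// => h2 h1.
rewrite (_ : _ - 2 = (chord_flux s t2 - 1) - (chord_flux s t1 - -1)); last by ring.
apply: le_trans (ler_normB _ _) _.
by rewrite (_ : 96 * C2 * e = 48 * C2 * e + 48 * C2 * e); [exact: lerD|ring].
Qed.

Let mI : measurable (`[0, L[%classic : set R). Proof. exact: measurable_itv. Qed.
Let finI : (leb `[0%R, L[ < +oo)%E. Proof. exact: lebesgue_itv_lty. Qed.
Let lebI : fine (leb `[0%R, L[) = L.
Proof. by rewrite lebesgue_measure_itv/= lte_fin L0 -EFinB subr0. Qed.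

Lemma kernel_gap_integral_near e : 0 < e <= u0 ->
  `|\int[@leb2 R]_(p in Deps L g e) kernel_gap p - 2 * L| <= 96 * C2 * L * e.
Proof.
move=> eI; have e0 : 0 < e by case/andP: eI.
have -> : \int[@leb2 R]_(p in Deps L g e) kernel_gap p =
    \int[leb]_(s in `[0, L[) \int[leb]_(y in `[0, L[) cut e (s, y).
  transitivity (\int[@leb2 R]_(p in `[0, L[%classic `*` `[0, L[%classic) cut e p).
    rewrite -torusE (_ : Deps L g e = torus L `&` [set p | e < dist p])//.
    rewrite Rintegral_mkcondr; apply: eq_Rintegral => p _.
    rewrite /cut patchE; case: ifPn => [|].
      by rewrite inE/= => ->; rewrite mulr1.
    by rewrite notin_setE/= => /negP/negbTE ->; rewrite mulr0.
  rewrite /leb2.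
  apply: (@Rintegral_prod12 _ _ _ _ R leb leb `[0, L[%classic `[0, L[%classic (cut e) (2 / e)) => //.
    exact: measurable_funTS (mcut e).
  by move=> p _; exact: bcut.
have mi : measurable_fun (`[0, L[%classic : set R) (fun s => \int[leb]_(y in `[0, L[) cut e (s, y)).
  apply: (@measurable_fun_Rintegral1 _ _ _ _ R leb leb `[0, L[%classic `[0, L[%classic (cut e) (2 / e)) => //.
    exact: measurable_funTS (mcut e).
  by move=> p _; exact: bcut.
have near s : `[0, L[%classic s -> `|\int[leb]_(y in `[0, L[) cut e (s, y) - 2| <= 96 * C2 * e.
  by rewrite /= in_itv/= => sL; exact: cut_inner_near.
have -> : 2 * L = \int[leb]_(s in `[0, L[) 2 by rewrite Rintegral_cst// lebI.
rewrite -RintegralB//; last 2 first.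
- apply: (bounded_integrable (C := 96 * C2 * e + 2)) => // s sI.
  rewrite -(subrK 2 (\int[leb]_(y in _) _)); apply: le_trans (ler_normD _ _) _.
  by apply: lerD; [exact: near|rewrite ger0_norm].
- by apply: (bounded_integrable (C := 2)) => // s _; rewrite ger0_norm.
rewrite mulrAC -[X in _ <= _ * X]lebI; apply: normr_Rintegral_le => //.
exact: (measurable_funB mi).
Qed.

End NeumannWeber.

(** * Choice of scales and regularization for a general density *)

Section Assembly.
Variables (R : realType) (L : R) (g : R -> 'rV[R]_3).
Hypothesis Hg : arclength_simple_closed_curve L g.
Notation spd := (fun i => derive1 (coord3 g i)).
Notation dist := (dist12 g).
Notation kernel_integral rho := (fun e => \int[@leb2 R]_(p in Deps L g e) (rho p / dist p)).

Let L0 : 0 < L. Proof. by case: Hg. Qed.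

Lemma exists_arc_scale : exists a C2 : R,
  [/\ 0 < a, 0 <= 1 - a, 0 < L - 2 * a, 0 <= C2 & 0 <= 2^-1 - 6 * C2 * a /\
    forall i x y, -1 <= x <= L + 1 -> -1 <= y <= L + 1 ->
      `|spd i x - spd i y| <= C2 * `|x - y|].
Proof.
have [C2 [C20 Hlip]] := exists_speed_lipschitz Hg.
have L0' := L0.
(* The three bounds give a <= 1, 2a < L and 6 C2 a <= 1/2; the shift C2 + 1 allows for C2 = 0. *)
pose a := Num.min 1 (Num.min (L / 4) (12 * (C2 + 1))^-1).
have a0 : 0 < a by rewrite !lt_min ltr01 divr_gt0// invr_gt0 mulr_gt0// ltr_wpDl.
have h1 : a <= 1 by rewrite ge_min lexx.
have h2 : a <= L / 4 by rewrite !ge_min lexx orbT.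
have h3 : a * (12 * (C2 + 1)) <= 1.
  by rewrite -ler_pdivlMr ?mulr_gt0 ?ltr_wpDl// div1r !ge_min lexx !orbT.
exists a, C2; split => //; [lra|lra|split => //; nra].
Qed.

Section Regularization.
Variables (a C2 u0 : R).
Hypotheses (a0 : 0 < a) (a1 : 0 <= 1 - a) (aL : 0 < L - 2 * a).
Hypotheses (C20 : 0 <= C2) (aC : 0 <= 2^-1 - 6 * C2 * a).
Hypothesis Hlip : forall i x y, -1 <= x <= L + 1 -> -1 <= y <= L + 1 ->
  `|spd i x - spd i y| <= C2 * `|x - y|.
Hypothesis u00 : 0 < u0.
Hypothesis Harc : forall s u, 0 <= s < L -> 0 < u <= u0 ->
  exists t1 t2, [/\ - a <= t1 < 0, 0 < t2 <= a, dist (s, s + t1) = u, dist (s, s + t2) = u &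
    forall t, t1 <= t < t1 + L -> (dist (s, s + t) <= u) = (t <= t2)].

(** The volume is the sublevel integral of the density 1, which satisfies all hypotheses on rho; its
    order 0 expansion is the linear bound. *)
Lemma volume_sublevel_curve (M : R) : exists K, forall u, 0 < u <= M ->
  fine (@leb2 R (torus L `&` [set p | dist p <= u])) <= K * u.
Proof.
have [||||c [_ H]] := Phi_coefficients (rho := cst 1) (C1 := 0) Hg L0 a0 a1 aL C20 aC Hlip u00 Harc
  (measurable_cst _) _ _ _ _ M.
- by move=> p; rewrite normr1.
- by [].
- by move=> N; exact: expands_cst.
- by move=> s t _ _; rewrite subrr normr0 mul0r.
have [C HC] := H 0%N; exists C => u uM; have := HC u uM.
rewrite /odd_remainder /odd_partial_sum big_ord0 subr0 expr1; apply: le_trans.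
have mdist := measurable_funTS (D := torus L) (measurable_dist12 Hg).
rewrite /sublevel_integral Rintegral_cst; first by rewrite mul1r ler_norm.
exact: (measurable_sublevel (measurable_torus L) mdist).
Qed.

(** The logarithms cancel in the difference, leaving the integral of [kernel_gap] over {d > e},
    which is 2L + O(e). *)
Lemma regularization_gap (HN HW : R) :
  (forall e : R, 0 < e -> (@leb2 R).-integrable (Deps L g e) (fun p => (rhoN g p / dist p)%:E)) ->
  (forall e : R, 0 < e -> (@leb2 R).-integrable (Deps L g e) (fun p => (rhoW g p / dist p)%:E)) ->
  (fun e : R => kernel_integral (rhoN g) e + 2 * L * ln e) @ 0^'+ --> HN ->
  (fun e : R => kernel_integral (rhoW g) e + 2 * L * ln e) @ 0^'+ --> HW ->
  HW = HN + 2 * L.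
Proof.
move=> iN iW hN hW.
have gapE e : 0 < e -> \int[@leb2 R]_(p in Deps L g e) kernel_gap g p =
    (kernel_integral (rhoW g) e + 2 * L * ln e) - (kernel_integral (rhoN g) e + 2 * L * ln e).
  move=> e0; rewrite opprD addrACA subrr addr0 -RintegralB//; last 3 first.
  - apply: (measurable_superlevel (measurable_torus L)).
    by apply: measurable_funTS; exact: (measurable_dist12 Hg).
  - exact: iW.
  - exact: iN.
  by apply: eq_Rintegral => p _; rewrite /kernel_gap mulrBl.
suff lim : (fun e : R => (kernel_integral (rhoW g) e + 2 * L * ln e) -
    (kernel_integral (rhoN g) e + 2 * L * ln e)) @ 0^'+ --> 2 * L.
  have E : HW - HN = 2 * L by apply: cvg_unique lim => //; exact: cvgB.
  by rewrite -E addrC subrK.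
apply/cvgrPdist_le => eps eps0.
have K0 : 0 < 96 * C2 * L + 1 by rewrite ltr_wpDl// !mulr_ge0// ltW.
near=> e.
have e0 : 0 < e by near: e; exact: nbhs_right_gt.
have eu : e <= u0 by near: e; exact: nbhs_right_le.
have es : e <= eps / (96 * C2 * L + 1) by near: e; apply: nbhs_right_le; rewrite divr_gt0.
rewrite -gapE// distrC.
apply: le_trans (kernel_gap_integral_near Hg L0 a0 a1 aL C20 aC Hlip Harc _) _; first by rewrite e0.
rewrite ler_pdivlMr// in es; apply: le_trans es.
by rewrite mulrC ler_wpM2l ?(ltW e0)// lerDl.
Unshelve. all: by end_near.
Qed.

Variable rho : R * R -> R.
Hypotheses (mrho : measurable_fun setT rho) (brho : forall p, `|rho p| <= 1).
Hypothesis prho : forall x y, rho (x, y + L) = rho (x, y).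
Hypothesis erho : forall N, expands L a (fun _ t => t) (fun s t => rho (s, s + t)) N.
Variable C1 : R.
Hypothesis rho1 : forall s t, 0 <= s < L -> 0 < `|t| <= a -> `|rho (s, s + t) - 1| <= C1 * `|t|.

Let mD := measurable_torus L.
Let Dfin := leb2_torus_lty L.
Let mdist : measurable_fun (torus L) dist.
Proof. by apply: measurable_funTS; exact: (measurable_dist12 Hg). Qed.
Let mrhoD : measurable_fun (torus L) rho. Proof. exact: measurable_funTS. Qed.
Let brhoD p : torus L p -> `|rho p| <= 1. Proof. by []. Qed.
Let M0 : 0 < 2 * L. Proof. by rewrite mulr_gt0. Qed.
Let distM p : torus L p -> dist p <= 2 * L. Proof. exact: dist12_le. Qed.
Let dist0 p : torus L p -> 0 <= dist p. Proof. by move=> _; exact: dist12_ge0. Qed.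

Lemma curve_kernel_integrable e : 0 < e ->
  (@leb2 R).-integrable (Deps L g e) (fun p => (rho p / dist p)%:E).
Proof.
move=> e0; exact: (superlevel_bounded_integrable (mu := @leb2 R) mD Dfin mdist mrhoD brhoD e0).
Qed.

Lemma curve_regularization : exists (H : R) (G : R[i] -> R[i]),
  [/\ (fun e : R => kernel_integral rho e + 2 * L * ln e) @ 0^'+ --> H,
      forall z, -1 < complex.Re z ->
        cintegrable L (Fkernel g rho z) /\ G z = cintegral L (Fkernel g rho z),
      forall z, ~ neg_odd_int z -> exists D, hol2 G z D,
      forall z, neg_odd_int z -> exists D : R[i], (fun w => (w - z) * G w) @ z^' --> D &
      (fun w => (w + 1) * G w) @ (-1 : R[i])^' --> (2 * L)%:C%C /\
      (fun w => G w - (2 * L)%:C%C / (w + 1)) @ (-1 : R[i])^' --> H%:C%C].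
Proof.
have [c [c0 Hc]] := Phi_coefficients Hg L0 a0 a1 aL C20 aC Hlip u00 Harc mrho brho prho erho rho1 (2 * L).
have [K vol] := volume_sublevel_curve (2 * L).
pose Phi := sublevel_integral (@leb2 R) (torus L) dist rho.
have mPhi : measurable_fun (`]0, 2 * L]%classic : set R) Phi.
  have m := measurable_fun_sublevel_integral (mu := @leb2 R) mD Dfin mdist mrhoD brhoD.
  by apply: m; [exact: measurable_itv|exact: lebesgue_itv_lty].
exists (regularized_limit (@leb2 R) (torus L) dist rho (2 * L) c), (continuation (2 * L) Phi c).
split.
- have := regularized_integral_cvg (mu := @leb2 R) mD Dfin mdist mrhoD brhoD M0 distM vol Hc; rewrite c0; exact.
- move=> z z1; split.
    exact: (kernel_integrable (mu := @leb2 R) mD Dfin mdist mrhoD brhoD M0 distM dist0 vol).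
  by have := kernel_integral_continuation (mu := @leb2 R) mD Dfin mdist mrhoD brhoD M0 distM dist0 vol Hc z1.
- by move=> z; exact: (hol2_continuation M0 mPhi Hc).
- move=> _ [k ->]; exists (- (- (k.*2.+1)%:R) * (c k)%:C%C).
  exact: (continuation_residue M0 mPhi Hc).
- have res := continuation_residueN1 M0 mPhi Hc; rewrite c0 in res.
  have fin := continuation_constant_term_regularized (mu := @leb2 R) mD Dfin mdist mrhoD brhoD M0 Hc.
  by rewrite c0 in fin; split; [exact: res|exact: fin].
Qed.

End Regularization.

End Assembly.

Lemma cvg_cscale (R : realType) (T : Type) (F : set_system T) {FF : Filter F}
  (f : T -> R[i]) (k l : R[i]) : f @ F --> l -> (fun w => k * f w) @ F --> k * l.
Proof. by move=> h; exact: (@cvgMl_tmp (R[i])%type T F FF f k l h). Qed.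


Theorem theorem2p1 (R : realType) (L mu0 : R) (g : R -> 'rV[R]_3) :
  0 < mu0 ->
  arclength_simple_closed_curve L g ->
  exists (HN HW : R) (GN GW : R[i] -> R[i]) (AN AW : R[i]),
  (* (1) the regularized limits H_N, H_W exist *)
  [/\ (forall e : R, 0 < e ->
         (@leb2 R).-integrable (Deps L g e) (fun p => (rhoN g p / dist12 g p)%:E) /\
         (@leb2 R).-integrable (Deps L g e) (fun p => (rhoW g p / dist12 g p)%:E)),
      (fun e : R => mu0 / (4 * pi) *
           Rintegral (@leb2 R) (Deps L g e) (fun p => rhoN g p / dist12 g p)
         + mu0 * L / (2 * pi) * ln e) @ 0^'+ --> HN &
      (fun e : R => mu0 / (4 * pi) *
           Rintegral (@leb2 R) (Deps L g e) (fun p => rhoW g p / dist12 g p)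
         + mu0 * L / (2 * pi) * ln e) @ 0^'+ --> HW ] /\
  (* (2) F_N, F_W are well defined for Re z > -1, where they coincide with
         GN, GW; GN, GW are meromorphic on C, holomorphic off the negative odd
         integers, with at most simple poles there; residue at -1 and the
         constant terms A_N, A_W *)
  [/\ forall z : R[i], -1 < complex.Re z ->
        [/\ cintegrable L (Fkernel g (rhoN g) z),
            cintegrable L (Fkernel g (rhoW g) z),
            GN z = (mu0 / (4 * pi))%:C%C * cintegral L (Fkernel g (rhoN g) z) &
            GW z = (mu0 / (4 * pi))%:C%C * cintegral L (Fkernel g (rhoW g) z)],
      (forall z : R[i], ~ neg_odd_int z -> holomorphic_at GN z /\ holomorphic_at GW z),
      (forall z : R[i], neg_odd_int z ->
         cvg ((fun w => (w - z) * GN w) @ z^') /\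
         cvg ((fun w => (w - z) * GW w) @ z^')),
      (fun w => (w + 1) * GN w) @ (-1 : R[i])^' --> (mu0 * L / (2 * pi))%:C%C /\
      (fun w => (w + 1) * GW w) @ (-1 : R[i])^' --> (mu0 * L / (2 * pi))%:C%C &
      (fun w => GN w - (mu0 * L / (2 * pi))%:C%C / (w + 1)) @ (-1 : R[i])^' --> AN /\
      (fun w => GW w - (mu0 * L / (2 * pi))%:C%C / (w + 1)) @ (-1 : R[i])^' --> AW ] /\
  (* (3) H = A *)
  (AN = HN%:C%C /\ AW = HW%:C%C) /\
  (* (4) *)
  HW = HN + mu0 / (2 * pi) * L.
Proof.
move=> mu0p Hg; have L0 : 0 < L by case: Hg.
have [a [C2 [a0 a1 aL C20 [aC Hlip]]]] := exists_arc_scale Hg.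
have [u0 [u00 Harc]] := sublevel_arc Hg L0 a0 a1 (ltW aL) C20 aC Hlip.
have [HN [GN [limN intN holN poleN [resN fpN]]]] := curve_regularization Hg a0 a1 aL C20 aC Hlip
  u00 Harc (measurable_rhoN Hg) (normr_rhoN_le1 Hg) (rhoN_periodic Hg) (expands_rhoN Hg a1)
  (rhoN_near Hg a0 a1 C20 Hlip).
have [HW [GW [limW intW holW poleW [resW fpW]]]] := curve_regularization Hg a0 a1 aL C20 aC Hlip
  u00 Harc (measurable_rhoW Hg) (normr_rhoW_le1 Hg) (rhoW_periodic Hg)
  (expands_rhoW Hg a0 a1 C20 aC Hlip) (rhoW_near Hg a0 a1 C20 aC Hlip).
have iN := curve_kernel_integrable Hg (measurable_rhoN Hg) (normr_rhoN_le1 Hg).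
have iW := curve_kernel_integrable Hg (measurable_rhoW Hg) (normr_rhoW_le1 Hg).
have gap := regularization_gap Hg a0 a1 aL C20 aC Hlip u00 Harc iN iW limN limW.
(* The curve results are normalized by c_0 = 2L; multiplication by k turns this constant into the
   residue, the logarithmic coefficient and the gap of (4). *)
pose k := mu0 / (4 * pi) : R.
have pi0 : pi != 0 :> R by rewrite gt_eqF// pi_gt0.
have kL : mu0 * L / (2 * pi) = k * (2 * L).
  by rewrite /k; move: (pi : R) pi0 => q q0; field.
have limk (rho : R * R -> R) (H : R) :
    (fun e : R => \int[@leb2 R]_(p in Deps L g e) (rho p / dist12 g p) + 2 * L * ln e) @ 0^'+ --> H ->
    (fun e : R => k * \int[@leb2 R]_(p in Deps L g e) (rho p / dist12 g p) +
      mu0 * L / (2 * pi) * ln e) @ 0^'+ --> k * H.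
  move=> h; rewrite (_ : (fun e => _) = fun e : R =>
      k * (\int[@leb2 R]_(p in Deps L g e) (rho p / dist12 g p) + 2 * L * ln e)).
    exact: cvgMl_tmp h.
  by apply/funext => e; rewrite kL mulrDr -mulrA.
have kC : (mu0 * L / (2 * pi))%:C%C = k%:C%C * (2 * L)%:C%C :> R[i] by rewrite kL rmorphM.
have resk (G : R[i] -> R[i]) (z l : R[i]) : (fun w => (w - z) * G w) @ z^' --> l ->
    (fun w => (w - z) * (k%:C%C * G w)) @ z^' --> k%:C%C * l.
  move=> h; rewrite (_ : (fun w => _) = fun w => k%:C%C * ((w - z) * G w)); first exact: cvg_cscale h.
  by apply/funext => w; rewrite mulrCA.
have resk1 (G : R[i] -> R[i]) : (fun w => (w + 1) * G w) @ (-1 : R[i])^' --> (2 * L)%:C%C ->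
    (fun w => (w + 1) * (k%:C%C * G w)) @ (-1 : R[i])^' --> (mu0 * L / (2 * pi))%:C%C.
  by have := resk G (-1) (2 * L)%:C%C; rewrite opprK -kC.
have fpk (G : R[i] -> R[i]) (H : R) :
    (fun w => G w - (2 * L)%:C%C / (w + 1)) @ (-1 : R[i])^' --> H%:C%C ->
    (fun w => k%:C%C * G w - (mu0 * L / (2 * pi))%:C%C / (w + 1)) @ (-1 : R[i])^' --> (k * H)%:C%C.
  have -> : (k * H)%:C%C = k%:C%C * H%:C%C :> R[i] by rewrite rmorphM.
  have <- : (fun w => k%:C%C * (G w - (2 * L)%:C%C / (w + 1))) =
      (fun w => k%:C%C * G w - (mu0 * L / (2 * pi))%:C%C / (w + 1)).
    by apply/funext => w; rewrite kC mulrBr mulrA.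
  exact: cvg_cscale.
have holk (G : R[i] -> R[i]) (z : R[i]) : (exists D, hol2 G z D) ->
    holomorphic_at (fun w => k%:C%C * G w) z.
  by move=> [D hD]; exact: (hol2_holomorphic (hol2M (hol2_cst _ _) hD)).
exists (k * HN), (k * HW), (fun z => k%:C%C * GN z), (fun z => k%:C%C * GW z),
  (k * HN)%:C%C, (k * HW)%:C%C.
split; first by split; [move=> e e0; split; [exact: iN|exact: iW]|exact: limk|exact: limk].
split; last by split => //; rewrite gap mulrDr -kL [mu0 * L / _]mulrAC.
split.
- by move=> z z1; have [cN eN] := intN z z1; have [cW eW] := intW z z1; split; rewrite /= ?eN ?eW.
- by move=> z zo; split; apply: holk; [exact: holN|exact: holW].
- move=> z zo; have [lN hN] := poleN z zo; have [lW hW] := poleW z zo.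
  by split; apply/cvg_ex; eexists; apply: resk; [exact: hN|exact: hW].
- by split; exact: resk1.
- by split; exact: fpk.
Qed.
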